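(* Let $A\ge1$, let $(X,d)$ be an unbounded, locally complete $A$-uniform metric space, and let $k$ be the quasihyperbolic metric of $X$. Let $\partial_kX$ be the Gromov boundary of the Gromov hyperbolic space $(X,k)$. Then there is a natural map $\phi\colon\partial_kX\to\partial X\cup\{\infty\}$ and a point $\xi\in\partial_kX$ with $\phi(\xi)=\infty$ such that, for every Busemann function $b\in\mathcal B_k(\xi)$ and every Hamenstädt metric $k_{b,\varepsilon}$ on $\partial_kX\setminus\{\xi\}$ based at $b$ with (admissible) parameter $\varepsilon$, the map $$\phi\colon(\partial_kX\setminus\{\xi\},k_{b,\varepsilon})\to(\partial X,d)$$ is $\eta$-quasisymmetric, where the function $\eta$ depends only on $A$ and $\varepsilon$.
   Context: **Metric boundary.** For a metric space $(X,d)$, $\overline X$ is its metric completion, $\partial X=\overline X\setminus X$ (with the metric $d$ extended to $\overline X$). $X$ is incomplete if $\partial X\ne\emptyset$, and locally complete if every point has a complete neighbourhood. For $x\in X$, $d(x):=d(x,\partial X)$ is the distance from $x$ to $\partial X$; it is positive when $X$ is locally complete and incomplete. **Uniform spaces and quasihyperbolic metric.** $\ell(\gamma)$ denotes the length of a curve; $X$ is rectifiably connected if any two points are joined by a rectifiable curve. A rectifiably connected, incomplete metric space $(X,d)$ is $A$-uniform if any $x,y\in X$ can be joined by a rectifiable curve $\gamma$ in $X$ with $\ell(\gamma)\le A\,d(x,y)$ and $\min\{\ell(\gamma[x,z]),\ell(\gamma[z,y])\}\le A\,d(z)$ for all $z\in\gamma$, where $\gamma[u,v]$ is the subcurve between $u$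 and $v$. The quasihyperbolic metric is $k(x,y)=\inf_\gamma\int_\gamma\frac{ds}{d(z)}$, the infimum over rectifiable curves $\gamma$ in $X$ joining $x$ and $y$. If $X$ is $A$-uniform (and locally complete), $(X,k)$ is $\delta$-hyperbolic with $\delta=\delta(A)$. **Gromov hyperbolicity.** For a metric space $(X,m)$, $(x|y)_w=\frac12[m(x,w)+m(y,w)-m(x,y)]$. $(X,m)$ is $\delta$-hyperbolic if $(x|y)_w\ge\min\{(x|z)_w,(z|y)_w\}-\delta$ for all $x,y,z,w\in X$, and Gromov hyperbolic if this holds for some $\delta\ge0$. A sequence $\{x_i\}$ is a Gromov sequence if $(x_i|x_j)_w\to\infty$ as $i,j\to\infty$; Gromov sequences $\{x_i\},\{y_i\}$ are equivalent if $(x_i|y_i)_w\to\infty$. The Gromov boundary ($\partial_\infty X$, or $\partial_mX$ to indicate the metric $m$) is the set of equivalence classes. For $x\in X$, $\xi,\zeta\in\partial_mX$: $(x|\xi)_w=\inf\{\liminf_i(x|y_i)_w:\{y_i\}\in\xi\}$ and $(\xi|\zeta)_w=\inf\{\liminf_i(x_i|y_i)_w:\{x_i\}\in\xi,\{y_i\}\in\zeta\}$. **Busemann functions and Hamenstädt metrics.** Let $(X,m)$ be $\delta$-hyperbolic and $\xi\in\partial_mX$. A Busemann function based at $\xi$ is a function $b=b_{\xi,w}\colon X\to\mathbb R$, $b(x)=(\xi|w)_x-(\xi|x)_w$, for some $w\in X$; the set of these is $\mathcal B_m(\xi)$. Put $(x|y)_b=\frac12(b(x)+b(y)-m(x,y))$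 for $x,y\in X$, and for $\xi_1,\xi_2\in\partial_mX\setminus\{\xi\}$, $(\xi_1|\xi_2)_b=\inf\{\liminf_i(x_i|y_i)_b:\{x_i\}\in\xi_1,\{y_i\}\in\xi_2\}$. A parameter $\varepsilon>0$ is admissible if $e^{22\varepsilon\delta}\le2$. For admissible $\varepsilon$ let $\rho_{b,\varepsilon}(\xi_1,\xi_2)=e^{-\varepsilon(\xi_1|\xi_2)_b}$ (with $e^{-\infty}=0$). The Hamenstädt metric based at $b$ with parameter $\varepsilon$ on $\partial_mX\setminus\{\xi\}$, denoted $m_{b,\varepsilon}$, is $m_{b,\varepsilon}(\xi_1,\xi_2)=\inf\sum_{i=1}^n\rho_{b,\varepsilon}(\zeta_{i-1},\zeta_i)$, the infimum over all $n\ge1$ and all chains $\xi_1=\zeta_0,\dots,\zeta_n=\xi_2$ in $\partial_mX\setminus\{\xi\}$. It is a metric with $\frac12\rho_{b,\varepsilon}\le m_{b,\varepsilon}\le\rho_{b,\varepsilon}$. **Natural maps.** For unbounded $X$, equip $\overline X\cup\{\infty\}$ with the topology whose open sets are the open sets of $\overline X$ and the sets $U\ni\infty$ whose complement is a closed bounded subset of $\overline X$. If $m$ is a metric on $X$ with $(X,m)$ Gromov hyperbolic, a map $\psi\colon\partial_mX\to\partial X\cup\{\infty\}$ is natural if it is a continuous extension of the identity map $(X,m)\to(X,d)$, i.e. the identity together with $\psi$ is continuous from $X\cup\partial_mX$ to $\overline X\cup\{\infty\}$. Here $X\cup\partial_mX$ has its usual topology: $X$ is open with the $m$-topology, and the sets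 $\{z:(z|\zeta)_w>t\}$, $t>0$, form a neighbourhood base at $\zeta\in\partial_mX$. In particular $x_i\to\psi(\zeta)$ for every Gromov sequence $\{x_i\}\in\zeta$. **Quasisymmetry.** A homeomorphism $f\colon(Y,\sigma)\to(Y',\sigma')$ is $\eta$-quasisymmetric, for a homeomorphism $\eta\colon[0,\infty)\to[0,\infty)$, if $\sigma(x,y)\le t\,\sigma(x,z)$ implies $\sigma'(f(x),f(y))\le\eta(t)\,\sigma'(f(x),f(z))$ for all $t>0$ and $x,y,z\in Y$. *)

(* Defs.v *)
From HB Require Import structures.
From mathcomp Require Import all_boot all_order all_algebra.
From mathcomp Require Import all_classical all_reals all_analysis.

Set Implicit Arguments.
Unset Strict Implicit.
Unset Printing Implicit Defensive.

Import Order.TTheory GRing.Theory Num.Theory.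
Import numFieldNormedType.Exports.

Local Open Scope classical_set_scope.
Local Open Scope ring_scope.

Definition metric_bounded (R : realType) (X : metricType R) (B : set X) : Prop :=
  exists M : R, forall x y, B x -> B y -> mdist x y <= M.

Definition complete_set (R : realType) (X : metricType R) (B : set X) : Prop :=
  forall u : nat -> X, (forall n, B (u n)) -> cauchy (u @ \oo) ->
    exists2 p, B p & u @ \oo --> p.

Definition locally_complete (R : realType) (X : metricType R) : Prop :=
  forall x : X, exists2 U : set X, nbhs x U & complete_set U.

(** A completion is determined up to isometry over [X] by these fields;
    statements quantify over an arbitrary one. *)
Record completion (R : realType) (X : metricType R) := Completion {
  completion_space :> metricType R ;
  emb : X -> completion_space ;
  emb_isometry : forall x y, mdist (emb x) (emb y) = mdist x y ;
  emb_dense : closure (range emb) = [set: completion_space] ;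
  completion_complete : complete_set [set: completion_space]
}.
Arguments emb {R X} c x.

Definition metric_boundary (R : realType) (X : metricType R)
    (Xb : completion X) : set Xb := ~` range (emb Xb).
Arguments metric_boundary {R X} Xb.

Definition dist_boundary (R : realType) (X : metricType R)
    (Xb : completion X) (x : X) : R :=
  inf [set mdist (emb Xb x) z | z in metric_boundary Xb].

Definition curve_length (R : realType) (X : metricType R)
    (a b : R) (g : R -> X) : \bar R :=
  ereal_sup [set (\sum_(0 <= i < size s)
                    mdist (g (nth b (a :: s) i)) (g (nth b s i)))%:E
            | s in [set s | itv_partition a b s]].

Definition rectifiable_curve (R : realType) (X : metricType R)
    (a b : R) (g : R -> X) (x y : X) : Prop :=
  [/\ a <= b, {within `[a, b], continuous g}, g a = x, g b = y
    & (curve_length a b g < +oo)%E].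

(** For a curve that is not injective, [z] on the curve is read as a parameter
    [t] with [z = g t], and the subcurves are the restrictions of [g] to
    [[a, t]] and [[t, b]]. *)
Record uniform_space (R : realType) (X : metricType R)
    (Xb : completion X) (A : R) : Prop := UniformSpace {
  uniform_rectifiably_connected : forall x y : X,
    exists a b g, rectifiable_curve a b g x y ;
  uniform_incomplete : metric_boundary Xb !=set0 ;
  uniform_curves : forall x y : X, exists a b g,
    [/\ rectifiable_curve a b g x y,
        (curve_length a b g <= (A * mdist x y)%:E)%E
      & forall t, a <= t <= b ->
          (Order.min (curve_length a t g) (curve_length t b g)
             <= (A * dist_boundary Xb (g t))%:E)%E]
}.

(** The point of the curve reached at arc length [u]; [g] is constant on the
    set of parameters [t] at which the arc length equals [u], and [inf] picks
    the first of them. *)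
Definition arclength_param (R : realType) (X : metricType R)
    (a b : R) (g : R -> X) (u : R) : X :=
  g (inf [set t | a <= t <= b /\ (u%:E <= curve_length a t g)%E]).

Definition line_integral (R : realType) (X : metricType R)
    (a b : R) (g : R -> X) (f : X -> R) : \bar R :=
  (\int[@lebesgue_measure R]_(u in `[0%R, fine (curve_length a b g)])
     (f (arclength_param a b g u))%:E)%E.

Definition quasihyperbolic (R : realType) (X : metricType R)
    (Xb : completion X) (x y : X) : R :=
  fine (ereal_inf [set l | exists a b g, rectifiable_curve a b g x y /\
    l = line_integral a b g (fun z => (dist_boundary Xb z)^-1)]).

(** The quasihyperbolic metric is a second metric on the carrier of [X], so
    the metrics below are plain functions. *)

Definition is_metric_on (R : realType) (T : Type) (D : set T)
    (m : T -> T -> R) : Prop :=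
  [/\ forall x y, D x -> D y -> 0 <= m x y,
      forall x y, D x -> D y -> m x y = 0 <-> x = y,
      forall x y, D x -> D y -> m x y = m y x
    & forall x y z, D x -> D y -> D z -> m x z <= m x y + m y z].

Definition gromov_product (R : realType) (T : Type) (m : T -> T -> R)
    (w x y : T) : R := (m x w + m y w - m x y) / 2.

Definition delta_hyperbolic (R : realType) (T : Type) (m : T -> T -> R)
    (delta : R) : Prop :=
  [/\ is_metric_on [set: T] m, 0 <= delta
    & forall x y z w : T,
        Order.min (gromov_product m w x z) (gromov_product m w z y) - delta
          <= gromov_product m w x y].

Definition gromov_hyperbolic (R : realType) (T : Type)
    (m : T -> T -> R) : Prop :=
  exists delta, delta_hyperbolic m delta.

(** The choice of base point is immaterial, since
    [|(x|y)_w - (x|y)_w'| <= m w w']; every base point is quantified over. *)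
Definition gromov_sequence (R : realType) (T : Type) (m : T -> T -> R)
    (u : nat -> T) : Prop :=
  forall (w : T) (M : R), exists N : nat, forall i j : nat,
    (N <= i)%N -> (N <= j)%N -> M <= gromov_product m w (u i) (u j).

Definition gromov_equivalent (R : realType) (T : Type) (m : T -> T -> R)
    (u v : nat -> T) : Prop :=
  forall w : T, gromov_product m w (u i) (v i) @[i --> \oo] --> +oo.

(** A point of the Gromov boundary is an equivalence class, i.e. the set of
    Gromov sequences equivalent to some Gromov sequence. *)
Definition gromov_boundary (R : realType) (T : Type) (m : T -> T -> R) : Type :=
  {C : set (nat -> T) | exists2 u, gromov_sequence m u
      & C = [set v | gromov_sequence m v /\ gromov_equivalent m u v]}.

Definition gclass (R : realType) (T : Type) (m : T -> T -> R)
    (xi : gromov_boundary m) : set (nat -> T) := proj1_sig xi.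

(** [(x|xi)_w] *)
Definition gromov_product_pb (R : realType) (T : Type) (m : T -> T -> R)
    (w x : T) (xi : gromov_boundary m) : \bar R :=
  ereal_inf [set limn_einf (fun i => (gromov_product m w x (v i))%:E)
            | v in gclass xi].

(** [(xi|zeta)_w] *)
Definition gromov_product_bb (R : realType) (T : Type) (m : T -> T -> R)
    (w : T) (xi zeta : gromov_boundary m) : \bar R :=
  ereal_inf [set limn_einf (fun i => (gromov_product m w (u i) (v i))%:E)
            | u in gclass xi & v in gclass zeta].

(** [(xi|w)_x] lies between [0] and [m x w], so that [fine] is harmless. *)
Definition busemann (R : realType) (T : Type) (m : T -> T -> R)
    (xi : gromov_boundary m) (w : T) (x : T) : R :=
  fine (gromov_product_pb x w xi) - fine (gromov_product_pb w x xi).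

Definition busemann_functions (R : realType) (T : Type) (m : T -> T -> R)
    (xi : gromov_boundary m) : set (T -> R) := range (busemann xi).

Definition busemann_product (R : realType) (T : Type) (m : T -> T -> R)
    (b : T -> R) (x y : T) : R := (b x + b y - m x y) / 2.

Definition busemann_product_bb (R : realType) (T : Type) (m : T -> T -> R)
    (b : T -> R) (xi1 xi2 : gromov_boundary m) : \bar R :=
  ereal_inf [set limn_einf (fun i => (busemann_product m b (u i) (v i))%:E)
            | u in gclass xi1 & v in gclass xi2].

Definition admissible (R : realType) (delta eps : R) : Prop :=
  0 < eps /\ expR (22 * eps * delta) <= 2.

Definition hamenstadt_rho (R : realType) (T : Type) (m : T -> T -> R)
    (b : T -> R) (eps : R) (xi1 xi2 : gromov_boundary m) : \bar R :=
  expeR (- (eps%:E * busemann_product_bb b xi1 xi2))%E.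

(** [xi] is the point at which [b] is based; chains avoid it. *)
Definition hamenstadt (R : realType) (T : Type) (m : T -> T -> R)
    (xi : gromov_boundary m) (b : T -> R) (eps : R)
    (xi1 xi2 : gromov_boundary m) : R :=
  fine (ereal_inf [set l | exists (n : nat) (c : nat -> gromov_boundary m),
    [/\ (1 <= n)%N, c 0%N = xi1, c n = xi2,
        forall i, (i <= n)%N -> c i <> xi
      & l = (\sum_(0 <= i < n) hamenstadt_rho b eps (c i) (c i.+1))%E]]).

Definition metric_continuous_on (R : realType) (T T' : Type) (D : set T)
    (s : T -> T -> R) (s' : T' -> T' -> R) (f : T -> T') : Prop :=
  forall x, D x -> forall e, 0 < e -> exists2 r, 0 < r &
    forall y, D y -> s x y < r -> s' (f x) (f y) < e.

(** Second clause: the inverse of the bijection [f] is continuous. *)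
Definition homeomorphism_on (R : realType) (T T' : Type)
    (D : set T) (D' : set T') (s : T -> T -> R) (s' : T' -> T' -> R)
    (f : T -> T') : Prop :=
  [/\ set_bij D D' f, metric_continuous_on D s s' f
    & forall x, D x -> forall e, 0 < e -> exists2 r, 0 < r &
        forall y, D y -> s' (f x) (f y) < r -> s x y < e].

Definition homeomorphism_halfline (R : realType) (eta : R -> R) : Prop :=
  homeomorphism_on [set t : R | 0 <= t] [set t : R | 0 <= t]
    (fun s t => `|s - t|) (fun s t => `|s - t|) eta.

Definition quasisymmetric (R : realType) (T T' : Type)
    (D : set T) (D' : set T') (s : T -> T -> R) (s' : T' -> T' -> R)
    (eta : R -> R) (f : T -> T') : Prop :=
  [/\ is_metric_on D s, is_metric_on D' s', homeomorphism_on D D' s s' f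
    & forall t x y z, 0 < t -> D x -> D y -> D z ->
        s x y <= t * s x z -> s' (f x) (f y) <= eta t * s' (f x) (f z)].

(** [None] is the point at infinity. *)
Definition with_infinity (Y : Type) : Type := option Y.

HB.instance Definition _ (Y : choiceType) := Choice.on (with_infinity Y).

Definition with_infinity_open (R : realType) (Y : metricType R) :
    set_system (with_infinity Y) :=
  [set U | open (Some @^-1` U) /\
           (U None -> metric_bounded (~` (Some @^-1` U)))].

Lemma metric_boundedS (R : realType) (Y : metricType R) (B C : set Y) :
  B `<=` C -> metric_bounded C -> metric_bounded B.
Proof. by move=> BC [M CM]; exists M => x y /BC Cx /BC Cy; exact: CM. Qed.

Lemma metric_boundedU (R : realType) (Y : metricType R) (B C : set Y) :
  metric_bounded B -> metric_bounded C -> metric_bounded (B `|` C).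
Proof.
move=> [M BM] [N CN].
have [->|/set0P[p Bp]] := eqVneq B set0; first by rewrite set0U; exists N.
have [->|/set0P[q Cq]] := eqVneq C set0; first by rewrite setU0; exists M.
have M0 : 0 <= M by exact: le_trans (mdist_ge0 p p) (BM _ _ Bp Bp).
have N0 : 0 <= N by exact: le_trans (mdist_ge0 q q) (CN _ _ Cq Cq).
have H x y : B x -> C y -> mdist x y <= M + mdist p q + N.
  move=> Bx Cy; rewrite (le_trans (metric_triangle x q y))// lerD ?CN//.
  by rewrite (le_trans (metric_triangle x p q))// lerD ?BM.
have pq0 := mdist_ge0 p q.
exists (M + mdist p q + N) => x y [Bx|Cx] [By|Cy]; last 1 first.
- by rewrite (le_trans (CN _ _ Cx Cy))// lerDr addr_ge0.
- by rewrite (le_trans (BM _ _ Bx By))// -addrA lerDl addr_ge0.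
- exact: H.
- by rewrite metric_sym; exact: H.
Qed.

Lemma with_infinity_openT (R : realType) (Y : metricType R) :
  @with_infinity_open R Y setT.
Proof.
split=> [|_]; first by rewrite preimage_setT; exact: openT.
by rewrite preimage_setT setCT; exists 0 => x y [].
Qed.

Lemma with_infinity_openI (R : realType) (Y : metricType R) :
  setI_closed (@with_infinity_open R Y).
Proof.
move=> U V [oU bU] [oV bV]; split.
  by rewrite preimage_setI; exact: openI.
move=> [UN VN]; rewrite preimage_setI setCI.
by apply: metric_boundedU; [exact: bU|exact: bV].
Qed.

Lemma with_infinity_open_bigU (R : realType) (Y : metricType R) (I : Type)
    (f : I -> set (with_infinity Y)) :
  (forall i, with_infinity_open (f i)) ->
  with_infinity_open (\bigcup_i f i).
Proof.
move=> fo; split.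
  by rewrite preimage_bigcup; apply: bigcup_open => i _; have [] := fo i.
move=> [i _ fiN]; have [_ /(_ fiN)] := fo i; apply: metric_boundedS.
by apply: subsetC => y fiy; exists i.
Qed.

HB.instance Definition _ (R : realType) (Y : metricType R) :=
  isOpenTopological.Build (with_infinity Y)
    (@with_infinity_openT R Y) (@with_infinity_openI R Y)
    (@with_infinity_open_bigU R Y).

Definition bordification (R : realType) (T : Type) (m : T -> T -> R) : Type :=
  (T + gromov_boundary m)%type.

Definition gromov_product_bord (R : realType) (T : Type) (m : T -> T -> R)
    (w : T) (z : bordification m) (zeta : gromov_boundary m) : \bar R :=
  match z with
  | inl x => gromov_product_pb w x zeta
  | inr xi => gromov_product_bb w xi zeta
  end.

Definition bordification_nbhs (R : realType) (T : Type) (m : T -> T -> R)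
    (w : T) (p : bordification m) : set_system (bordification m) :=
  match p with
  | inl x => filter_from [set r : R | 0 < r]
      (fun r => inl @` [set y | m x y < r])
  | inr zeta => filter_from [set t : R | 0 < t]
      (fun t => [set z | (t%:E < gromov_product_bord w z zeta)%E])
  end.

Definition extend_identity (R : realType) (X : metricType R)
    (Xb : completion X) (m : X -> X -> R)
    (psi : gromov_boundary m -> with_infinity Xb) (p : bordification m) :
    with_infinity Xb :=
  match p with
  | inl x => Some (emb Xb x)
  | inr zeta => psi zeta
  end.

Record natural_map (R : realType) (X : metricType R)
    (Xb : completion X) (m : X -> X -> R)
    (psi : gromov_boundary m -> with_infinity Xb) : Prop := NaturalMap {
  natural_range : forall zeta z, psi zeta = Some z -> metric_boundary Xb z ;
  natural_continuous : forall (w : X) (p : bordification m),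
    extend_identity psi @ bordification_nbhs w p --> extend_identity psi p
}.

(* Main.v *)
(** Write [r] for the distance to the boundary and
    [p x y = d x y + r x + r y]. Integrating [1/r] along arbitrary curves and
    along uniform curves gives
    [ln (1 + d x y / r x) <= k x y <= C (ln (p x y / r x) + ln (p x y / r y) + 1)],
    and [(X, k)] is a length space. Everything about [k] is deduced from these
    facts. A rough [k]-geodesic climbs exponentially to a highest point, whose
    height [r] is comparable to [p x y], and then descends. Hence the Gromov
    product of [x] and [y] based at a point [c] high above both is, up to a
    constant, the [k]-distance from [c] to the top [u] of a geodesic from [x]
    to [y]. Tops of two geodesics issuing from the same point lie roughly above
    one another, so a difference of such products
    [tau = (x|z)_c - (x|y)_c] controls the ratio of the distances:
    [ln (p x y / p x z) <= max (tau, tau / C) + B].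
    This inequality yields the hyperbolicity of [k], the identification of
    [k]-Gromov sequences with the sequences converging in [d] to a boundary
    point or to infinity, and, letting [c] tend to infinity so that the products
    become Busemann products, the quasisymmetry with a power gauge. *)

Require Import Defs.
From mathcomp Require Import all_boot all_order all_algebra.
From mathcomp Require Import all_classical all_reals all_analysis.
From mathcomp Require Import ring lra.

Set Implicit Arguments.
Unset Strict Implicit.
Unset Printing Implicit Defensive.

Import Order.TTheory GRing.Theory Num.Theory.
Import numFieldNormedType.Exports.

Local Open Scope classical_set_scope.
Local Open Scope ring_scope.

(** * Arc length *)

Section curve_length_theory.
Variables (R : realType) (X : metricType R).
Implicit Types (a b c t : R) (s : seq R) (g : R -> X).

(** The gauge may depend only on [A] and [eps], so every coarse constant is produced before the
    space: the estimates are stated for an abstract [qh_model] whose only quantitative parameter is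
    [C], and read [exists B, forall T f P k]. The constant [delta] in the Busemann and Hamenstädt
    estimates is arbitrary; it leaves the gauge because admissibility bounds [eps * delta], and the
    same bound makes the chain construction a metric. The obstacle is that the upper bound on [k]
    carries the factor [C], not merely an additive error, so lengths cannot be read off from
    endpoints. Rough geodesics are controlled through their height alone: a curve that stays below a
    level lets [expR P] grow at most linearly in its length, while the upper bound on [k] makes the
    length of a rough geodesic logarithmic in [expR P]. The factor [C] reappears in the comparison
    of products as a second slope [1 / C], hence the two exponents of the gauge. *)

Fixpoint polygon_length g a s : R :=
  if s is t :: s' then mdist (g a) (g t) + polygon_length g t s' else 0.

Lemma polygon_lengthE g a s :
  \sum_(0 <= i < size s) mdist (g (nth a (a :: s) i)) (g (nth a s i)) =
  polygon_length g a s.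
Proof.
elim: s a => [|t s IH] a; first by rewrite big_nil.
rewrite big_nat_recl//= -IH; congr (_ + _).
apply: eq_big_nat => i /andP[_ ils].
by congr (mdist (g _) (g _)); apply: set_nth_default => //=; exact: ltnW.
Qed.

Lemma itv_partition_cons a b t s :
  itv_partition a b (t :: s) <-> a < t /\ itv_partition t b s.
Proof.
rewrite /itv_partition/=; split; first by move=> [/andP[]].
by move=> [-> [-> ->]].
Qed.

Lemma itv_partition0 a b : itv_partition a b [::] <-> a = b.
Proof. by rewrite /itv_partition/=; split => [[_ /eqP]|->]. Qed.

Lemma itv_partition_bounds a b s : itv_partition a b s -> a <= b.
Proof.
elim: s a => [|t s IH] a; first by move/itv_partition0 => ->.
by move=> /itv_partition_cons[at_ /IH tb]; rewrite (le_trans (ltW at_)).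
Qed.

Lemma curve_lengthE a b g : curve_length a b g =
  ereal_sup [set (polygon_length g a s)%:E | s in itv_partition a b].
Proof.
rewrite /curve_length; congr ereal_sup; apply: eq_imagel => s /= abs.
congr EFin; rewrite -polygon_lengthE; apply: eq_big_nat => i /andP[_ ils].
congr (mdist (g _) (g _)); apply: set_nth_default => //=; exact: ltnW.
Qed.

Lemma polygon_length_le a b g s : itv_partition a b s ->
  ((polygon_length g a s)%:E <= curve_length a b g)%E.
Proof. by move=> abs; rewrite curve_lengthE; apply: ereal_sup_ubound; exists s. Qed.

Lemma curve_length_le a b g (M : \bar R) :
  (forall s, itv_partition a b s -> ((polygon_length g a s)%:E <= M)%E) ->
  (curve_length a b g <= M)%E.
Proof.
by move=> H; rewrite curve_lengthE; apply: ge_ereal_sup => _ [s abs <-]; exact: H.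
Qed.

Lemma curve_lengthxx a g : curve_length a a g = 0%E.
Proof.
apply/eqP; rewrite eq_le; apply/andP; split.
  apply: curve_length_le => -[//|t s] /itv_partition_cons[at_].
  by move=> /itv_partition_bounds; rewrite leNgt at_.
by apply: (@polygon_length_le a a g [::]); exact/itv_partition0.
Qed.

Lemma mdist_le_curve_length a b g : a <= b ->
  ((mdist (g a) (g b))%:E <= curve_length a b g)%E.
Proof.
rewrite le_eqVlt => /predU1P[<-|ab]; first by rewrite mdistxx curve_lengthxx.
have -> : mdist (g a) (g b) = polygon_length g a [:: b] by rewrite /= addr0.
apply: polygon_length_le.
by apply/itv_partition_cons; split => //; exact/itv_partition0.
Qed.

Lemma curve_length_ge0 a b g : a <= b -> (0 <= curve_length a b g)%E.
Proof. by move=> ab; apply: le_trans (mdist_le_curve_length g ab); rewrite lee_fin mdist_ge0. Qed.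

Lemma polygon_length_cat a c b g s1 s2 :
  itv_partition a c s1 -> itv_partition c b s2 ->
  itv_partition a b (s1 ++ s2) /\
  polygon_length g a (s1 ++ s2) = polygon_length g a s1 + polygon_length g c s2.
Proof.
elim: s1 a => [|t s1 IH] a.
  by move=> /itv_partition0 -> h; rewrite /= add0r.
move=> /itv_partition_cons[at_ tc] cb; have [h1 h2] := IH _ tc cb.
by split; [exact/itv_partition_cons|rewrite /= h2 addrA].
Qed.

(** Concatenating partitions gives one inequality. For the other, a partition of [[a, b]] that skips
    [c] is refined by inserting [c], which by the triangle inequality does not shorten the
    polygon. *)
Lemma curve_lengthD a c b g : a <= c -> c <= b ->
  curve_length a b g = (curve_length a c g + curve_length c b g)%E.
Proof.
move=> ac cb; apply/eqP; rewrite eq_le; apply/andP; split; last first.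
  have cbfin : curve_length c b g != -oo%E.
    by rewrite gt_eqF// (lt_le_trans _ (curve_length_ge0 g cb))// ltNyr.
  have h1 s2 : itv_partition c b s2 ->
      (curve_length a c g + (polygon_length g c s2)%:E <= curve_length a b g)%E.
    move=> cbs; rewrite -leeBrDr//; apply: curve_length_le => s1 acs.
    rewrite leeBrDr// -EFinD.
    by have [h <-] := polygon_length_cat g acs cbs; exact: polygon_length_le.
  have [acy|acy] := eqVneq (curve_length a c g) +oo%E.
    have [s2 cbs] : exists s2, itv_partition c b s2.
      move: cb; rewrite le_eqVlt => /predU1P[<-|cb].
        by exists [::]; exact/itv_partition0.
      by exists [:: b]; apply/itv_partition_cons; split => //; exact/itv_partition0.
    by rewrite acy; have := h1 _ cbs; rewrite acy !addye// ?gt_eqF.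
  have acf : curve_length a c g \is a fin_num.
    by rewrite ge0_fin_numE ?curve_length_ge0// ltey.
  rewrite addeC -leeBrDr//; apply: curve_length_le => s2 cbs.
  by rewrite leeBrDr// addeC; exact: h1.
apply: curve_length_le => s; elim: s a ac => [|t s IH] a ac.
  move=> /itv_partition0 abE; have cE : c = a by apply/le_anti; rewrite ac abE cb.
  by rewrite adde_ge0 ?curve_length_ge0.
move=> /itv_partition_cons[at_ tb] /=; have [tc|ct] := leP t c.
  rewrite EFinD (le_trans (leeD2l _ (IH _ tc tb)))// addeA leeD2r//.
  have at1 : itv_partition a t [:: t].
    by apply/itv_partition_cons; split => //; exact/itv_partition0.
  rewrite -leeBrDl//; apply: curve_length_le => s1 tcs; rewrite leeBrDl// -EFinD.
  have [h _] := polygon_length_cat g at1 tcs.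
  exact: (polygon_length_le g h).
have cbs : itv_partition c b (t :: s) by apply/itv_partition_cons.
rewrite (@le_trans _ _ ((mdist (g a) (g c))%:E + (polygon_length g c (t :: s))%:E)%E)//.
  by rewrite -EFinD lee_fin addrA lerD2r metric_triangle.
by rewrite leeD ?mdist_le_curve_length//; exact: polygon_length_le.
Qed.

End curve_length_theory.

Section rectifiable.
Variables (R : realType) (X : metricType R) (a b : R) (g : R -> X).
Hypotheses (ab : a <= b) (gc : {within `[a, b], continuous g})
  (gfin : (curve_length a b g < +oo)%E).

Definition arclength (t : R) : R := fine (curve_length a t g).
Let V := arclength.
Let l := fine (curve_length a b g).

Lemma arclength_fin t : a <= t <= b ->
  curve_length a t g = (V t)%:E /\ curve_length t b g = (l - V t)%:E.
Proof.
move=> /andP[at_ tb]; have := gfin; rewrite (curve_lengthD g at_ tb) => h.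
have h1 := curve_length_ge0 g at_; have h2 := curve_length_ge0 g tb.
have f1 : curve_length a t g \is a fin_num.
  by rewrite ge0_fin_numE// (le_lt_trans _ h)// leeDl.
have f2 : curve_length t b g \is a fin_num.
  by rewrite ge0_fin_numE// (le_lt_trans _ h)// leeDr.
split; first by rewrite fineK.
by rewrite /l (curve_lengthD g at_ tb) fineD// /V /arclength addrC addKr fineK.
Qed.

Lemma arclength0 : V a = 0.
Proof. by rewrite /V /arclength curve_lengthxx. Qed.

Lemma arclength_end : V b = l.
Proof. by []. Qed.

Lemma arclength_sub s t : a <= s -> s <= t -> t <= b ->
  curve_length s t g = (V t - V s)%:E.
Proof.
move=> as_ st tb.
have [|h1 _] := @arclength_fin t; first by rewrite (le_trans as_ st).
have [|h2 _] := @arclength_fin s; first by rewrite as_ (le_trans st).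
have := curve_lengthD g as_ st; rewrite h1 h2 => h.
have f : curve_length s t g \is a fin_num.
  rewrite ge0_fin_numE ?curve_length_ge0// (le_lt_trans _ (ltry (V t)))// h.
  by rewrite leeDr// -h2 curve_length_ge0.
by move: h; rewrite -(fineK f) -EFinD => -[->]; rewrite addrC addKr.
Qed.

Lemma mdist_arclength s t : a <= s -> s <= t -> t <= b ->
  mdist (g s) (g t) <= V t - V s.
Proof.
move=> as_ st tb; rewrite -lee_fin -arclength_sub//.
exact: mdist_le_curve_length.
Qed.

Lemma arclength_le s t : a <= s -> s <= t -> t <= b -> V s <= V t.
Proof.
move=> as_ st tb; rewrite -subr_ge0.
by rewrite (le_trans _ (mdist_arclength as_ st tb))// mdist_ge0.
Qed.

Lemma mdist_arclength_norm s t : a <= s <= b -> a <= t <= b ->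
  mdist (g s) (g t) <= `|V s - V t|.
Proof.
move=> /andP[as_ sb] /andP[at_ tb]; have [st|/ltW ts] := leP s t.
  by rewrite distrC (le_trans (mdist_arclength as_ st tb))// ler_norm.
by rewrite metric_sym (le_trans (mdist_arclength at_ ts sb))// ler_norm.
Qed.

Lemma rectifiable_continuous c e : a <= c <= b -> 0 < e ->
  exists2 r, 0 < r & forall t, a <= t <= b -> `|c - t| < r ->
    mdist (g c) (g t) < e.
Proof.
move=> cab e0; have /subspace_continuousP gc' := gc.
have /gc' : `[a, b]%classic c by rewrite /= in_itv.
move=> /cvg_ballP/(_ e e0); rewrite /within/= => /nbhs_ballP[r r0 H].
exists r => // t tab ct; have := H t ct; rewrite in_itv/= => /(_ tab).
by rewrite ballEmdist.
Qed.

(** In a polygon on [[a, c]] almost as long as the arc only the last edge reaches [c], and moving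
    its endpoint back to [t] costs at most [mdist (g t) (g c)], which is small by continuity. *)
Lemma arclength_left c e : a < c -> c <= b -> 0 < e ->
  exists2 t1, t1 < c & forall t, a <= t -> t1 < t -> t <= c -> V c - e < V t.
Proof.
move=> ac cb e0; have e20 : 0 < e / 2 by rewrite divr_gt0.
have ccab : a <= c <= b by rewrite (ltW ac).
have [hc _] := arclength_fin ccab.
have : ((V c - e / 2)%:E < curve_length a c g)%E by rewrite hc lte_fin ltrBlDr ltrDl.
rewrite curve_lengthE => /ereal_sup_gt[_ [s acs <-]]; rewrite lte_fin => hs.
suff [t1 t1c H] : exists2 t1, t1 < c & forall t, a <= t -> t1 < t -> t <= c ->
    polygon_length g a s <= V t + mdist (g t) (g c).
  have [r r0 gr] := rectifiable_continuous ccab e20.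
  exists (Order.max t1 (c - r)); first by rewrite gt_max t1c/= ltrBlDr ltrDl.
  move=> t at_; rewrite gt_max => /andP[t1t rt] tc.
  have := H _ at_ t1t tc; have := gr t; rewrite at_ (le_trans tc)//= => /(_ isT).
  rewrite ger0_norm ?subr_ge0// metric_sym => h; have : c - t < r by lra.
  by move=> /h; lra.
(* The starting point is freed for an induction on the partition that peels off edges until the one
   ending at [c]. *)
suff {hs hc} H a' : a <= a' -> a' < c -> itv_partition a' c s ->
    exists2 t1, t1 < c & forall t, a' <= t -> t1 < t -> t <= c ->
    polygon_length g a' s <= V t - V a' + mdist (g t) (g c).
  have [t1 h1 h2] := H _ (lexx a) ac acs; exists t1 => // t at_ t1t tc.
  by have := h2 t at_ t1t tc; rewrite arclength0 subr0.
elim: s {acs} a' => [|t s IH] a' aa' a'c.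
  by move=> /itv_partition0 E; move: a'c; rewrite E ltxx.
move=> /itv_partition_cons[a't tc].
have [tc'|] := ltP t c; last first.
  move=> ct; have tE : t = c by apply/le_anti; rewrite (itv_partition_bounds tc).
  have sE : s = [::].
    by case: s tc {IH} => //= u s /itv_partition_cons[tu /itv_partition_bounds]; rewrite -tE leNgt tu.
  exists a' => // u a'u _ uc; rewrite sE /= addr0 tE.
  rewrite (le_trans (metric_triangle _ (g u) _))// lerD2r.
  by apply: mdist_arclength => //; exact: le_trans cb.
have [t1 t1c H] := IH t (le_trans aa' (ltW a't)) tc' tc.
exists (Order.max t t1); first by rewrite gt_max tc'.
move=> u a'u; rewrite gt_max => /andP[tu t1u] uc.
have := H u (ltW tu) t1u uc.
by have := mdist_arclength aa' (ltW a't) (le_trans (ltW tc') cb); rewrite /=; lra.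
Qed.

Lemma arclength_right c e : a <= c -> c < b -> 0 < e ->
  exists2 t1, c < t1 & forall t, c <= t -> t < t1 -> t <= b -> V t < V c + e.
Proof.
move=> ac cb e0; have e20 : 0 < e / 2 by rewrite divr_gt0.
have ccab : a <= c <= b by rewrite ac (ltW cb).
have [_ hc] := arclength_fin ccab.
have : ((l - V c - e / 2)%:E < curve_length c b g)%E by rewrite hc lte_fin ltrBlDr ltrDl.
rewrite curve_lengthE => /ereal_sup_gt[_ [[|t s] cbs <-]]; rewrite lte_fin => hs.
  by move: cbs cb => /itv_partition0 ->; rewrite ltxx.
have [ct tb] : c < t /\ itv_partition t b s by apply/itv_partition_cons.
have tb' := itv_partition_bounds tb.
have [r r0 gr] := rectifiable_continuous ccab e20.
exists (Order.min t (c + r)); first by rewrite lt_min ct/= ltrDl.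
move=> u cu; rewrite lt_min => /andP[ut ur] ub.
have := gr u; rewrite (le_trans ac cu) ub distrC ger0_norm ?subr_ge0// => /(_ isT) h.
have {h} cu' : mdist (g c) (g u) < e / 2 by apply: h; lra.
have := polygon_length_le g tb.
have [|_ ->] := @arclength_fin t; first by rewrite (le_trans ac (ltW ct)).
rewrite lee_fin => hp.
have := mdist_arclength (le_trans ac cu) (ltW ut) tb'.
have := metric_triangle (g c) (g u) (g t); rewrite /= in hs; lra.
Qed.

(** The infimum chosen in [arclength_param] realises the arc length [u] exactly: left continuity of
    arc length excludes a value above [u], right continuity a value below it. *)
Lemma arclength_inf u : 0 <= u <= l ->
  let t := inf [set t | a <= t <= b /\ (u%:E <= curve_length a t g)%E] in
  a <= t <= b /\ V t = u.
Proof.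
move=> /andP[u0 ul]; set E := [set t | _ /\ _] => t.
have EV s : E s <-> a <= s <= b /\ u <= V s.
  rewrite /E/=; split=> -[sab h]; split => //; move: h.
    by have [-> _] := arclength_fin sab.
  by have [-> _] := arclength_fin sab.
have Eb : E b by apply/EV; rewrite ab lexx.
have hE : has_inf E by split; [exists b|exists a => s [/andP[]]].
have at_ : a <= t by apply: lb_le_inf; [exists b|move=> s [/andP[]]].
have tb : t <= b by apply: ge_inf => //; exact: hE.2.
have notE s : a <= s -> s < t -> V s < u.
  move=> as_ st; rewrite ltNge; apply/negP => h.
  have : t <= s by apply: ge_inf; [exact: hE.2|apply/EV; rewrite as_ (le_trans (ltW st))].
  by rewrite leNgt st.
rewrite at_ tb; split => //; apply/le_anti/andP; split.
  rewrite leNgt; apply/negP => h; have : 0 < V t - u by lra.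
  have {at_} at_ : a < t.
    by rewrite lt_neqAle at_ andbT; apply/eqP => E'; move: h; rewrite -E' arclength0 ltNge u0.
  move=> /(arclength_left at_ tb)[t1 t1t H].
  pose s := Order.max a ((t1 + t) / 2).
  have st : s < t by rewrite gt_max at_/=; lra.
  have : V t - (V t - u) < V s.
    apply: H; [by rewrite le_max lexx| |exact: ltW].
    by rewrite lt_max; apply/orP; right; lra.
  have := notE s; rewrite le_max lexx => /(_ isT st); lra.
rewrite leNgt; apply/negP => h; have : 0 < u - V t by lra.
have {tb} tb : t < b.
  by rewrite lt_neqAle tb andbT; apply/eqP => E'; move: h; rewrite E' arclength_end ltNge ul.
move=> /(arclength_right at_ tb)[t1 tt1 H].
have t1t : 0 < t1 - t by rewrite subr_gt0.
have [s Es st] := inf_adherent t1t hE.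
have ts : t <= s by apply: ge_inf; [exact: hE.2|].
move: Es => /EV[/andP[_ sb] us]; have := H s ts; rewrite -/t in st.
have -> : s < t1 by lra.
by move=> /(_ isT sb); lra.
Qed.

End rectifiable.

(** * Integrals over segments and their comparison with logarithms *)

Section continuous_integral.
Variable R : realType.
Implicit Types (F : R -> R) (a b c : R).

Definition segment_integral F a b : R := \int[lebesgue_measure]_(u in `[a, b]) F u.
Local Notation I := segment_integral.

Lemma continuous_integrable F a b : continuous F ->
  lebesgue_measure.-integrable `[a, b] (EFin \o F).
Proof.
move=> Fc; apply: continuous_compact_integrable; first exact: segment_compact.
exact: continuous_subspaceT.
Qed.

Lemma segment_integralE F a b : continuous F ->
  (\int[lebesgue_measure]_(u in `[a, b]) (F u)%:E)%E = (I F a b)%:E.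
Proof.
move=> Fc; rewrite /segment_integral /Rintegral fineK//.
by apply: integrable_fin_num => //; exact: continuous_integrable.
Qed.

Lemma segment_integralD F a b c : continuous F -> a <= b -> b <= c ->
  I F a c = I F a b + I F b c.
Proof.
move=> Fc ab bc; apply/eqP; rewrite addrC -subr_eq; apply/eqP.
rewrite /segment_integral Rintegral_itvB//; last exact: continuous_integrable.
rewrite Rintegral_itv_obnd_cbnd//.
apply: integrableS (continuous_integrable b c Fc) => //.
by move=> x /=; rewrite !in_itv/= => /andP[/ltW -> ->].
Qed.

Lemma segment_integral_cst a b c : a <= b -> I (fun=> c) a b = c * (b - a).
Proof.
move=> ab; rewrite /segment_integral Rintegral_cst//; congr (c * _).
transitivity (fine (lebesgue_measure (`[a, b]%classic : set R))) => //.
rewrite lebesgue_measure_itv/= lte_fin.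
by move: ab; rewrite le_eqVlt => /predU1P[->|->//]; rewrite ltxx subrr.
Qed.

Lemma segment_integral_le F F' a b : continuous F -> continuous F' ->
  (forall u, a <= u <= b -> F u <= F' u) -> I F a b <= I F' a b.
Proof.
move=> Fc F'c H; apply: le_Rintegral => [//|||u]; [exact: continuous_integrable..|].
by rewrite /= in_itv => /H.
Qed.

Lemma segment_integral_ge_cst F a b c : continuous F -> a <= b ->
  (forall u, a <= u <= b -> c <= F u) -> c * (b - a) <= I F a b.
Proof.
move=> Fc ab H; rewrite -segment_integral_cst//.
by apply: segment_integral_le => //; exact: cst_continuous.
Qed.

Lemma segment_integral_le_cst F a b c : continuous F -> a <= b ->
  (forall u, a <= u <= b -> F u <= c) -> I F a b <= c * (b - a).
Proof.
move=> Fc ab H; rewrite -segment_integral_cst//.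
by apply: segment_integral_le => //; exact: cst_continuous.
Qed.

Lemma segment_integralN F a b : continuous F -> a <= b ->
  I F (- b) (- a) = I (F \o -%R) a b.
Proof.
move=> Fc ab; rewrite /segment_integral /Rintegral.
by rewrite integration_by_substitution_oppr//; exact: continuous_subspaceT.
Qed.

(** Replaces differentiation: over a fine subdivision the defects [e * (t - s)] add up to
    [e * (b - a)], and [e] is arbitrary. It compares integrals with logarithms, and integrals before
    and after reparametrisation. *)
Lemma locally_nondecreasing_le (G : R -> R) a b : a <= b ->
  (forall e, 0 < e -> exists2 d, 0 < d & forall s t, a <= s -> s <= t ->
     t <= b -> t - s <= d -> G s - e * (t - s) <= G t) -> G a <= G b.
Proof.
move=> ab H; apply/ler_addgt0Pr => e e0.
have ba0 : 0 < b - a + 1 by rewrite ltr_wpDl// subr_ge0.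
have [d d0 Hd] := H _ (divr_gt0 e0 ba0); set e' := e / _ in Hd.
have e'0 : 0 < e' by rewrite divr_gt0.
have step n : forall t, a <= t -> t <= b -> t - a <= n.+1%:R * d ->
    G a - e' * (t - a) <= G t.
  elim: n => [|n IH] t at_ tb tn; first by apply: Hd => //; rewrite mul1r in tn.
  have [td|dt] := leP (t - a) d; first exact: Hd.
  have tn' : t - d - a <= n.+1%:R * d.
    by move: tn; rewrite -[n.+2%:R]natr1 mulrDl mul1r; lra.
  have h1 := IH (t - d) _ _ tn'.
  have h2 : G (t - d) - e' * (t - (t - d)) <= G t by apply: Hd; lra.
  have -> : e' * (t - a) = e' * (t - d - a) + e' * (t - (t - d)) by ring.
  have := h1 _ _; lra.
have n0 : 0 <= (b - a) / d by rewrite divr_ge0 ?(ltW d0)// subr_ge0.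
have /andP[_ n2] := truncn_itv n0.
have h := step _ b ab (lexx b) (_ : b - a <= (Num.trunc ((b - a) / d)).+1%:R * d).
have {}h := h _; rewrite -lerBlDr (le_trans _ (h _))//; last first.
  by rewrite -ler_pdivrMr// ltW.
rewrite lerD2l lerN2 /e' -mulrA ler_piMr ?(ltW e0)//.
by rewrite mulrC ler_pdivrMr// mul1r lerDl.
Qed.

Lemma ln_incr_bounds (x y : R) : 0 < x -> x <= y ->
  (y - x) / y <= ln y - ln x /\ ln y - ln x <= (y - x) / x.
Proof.
move=> x0 xy; have y0 := lt_le_trans x0 xy; rewrite -ln_div ?posrE//; split.
  rewrite -[leRHS]opprK -lnV ?posrE ?divr_gt0// invf_div.
  have -> : x / y = 1 + - ((y - x) / y) by field; rewrite gt_eqF.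
  rewrite lerNr le_ln1Dx//.
  have -> : - ((y - x) / y) = x / y - 1 by field; rewrite gt_eqF.
  by rewrite ltrBrDr addrC subrr divr_gt0.
have -> : y / x = 1 + (y - x) / x by field; rewrite gt_eqF.
by rewrite le_ln1Dx// (lt_le_trans (ltrN10 _))// divr_ge0 ?subr_ge0// ltW.
Qed.

Lemma inv_incr_bound (r e x y : R) : 0 < r -> r <= x -> x <= y -> 0 < e ->
  y - x <= e * r ^+ 2 -> x^-1 - y^-1 <= e.
Proof.
move=> r0 rx xy e0 h; have x0 := lt_le_trans r0 rx; have y0 := lt_le_trans x0 xy.
have -> : x^-1 - y^-1 = (y - x) / (x * y) by field; rewrite !gt_eqF.
rewrite ler_pdivrMr ?mulr_gt0// (le_trans h)// ler_pM2l// expr2.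
by rewrite ler_pM ?(ltW r0)// (le_trans rx).
Qed.

(** [c * ln (r + (t - a))] is a primitive of the bounding density; the difference [G] of the two
    sides is nondecreasing up to second order errors. *)
Lemma segment_integral_ge_ln F a b c r : continuous F -> a <= b -> 0 < r ->
  0 <= c -> (forall u, a <= u <= b -> c / (r + (u - a)) <= F u) ->
  c * ln (1 + (b - a) / r) <= I F a b.
Proof.
move=> Fc ab r0 c0 H.
pose h t := r + (t - a).
have h0 t : a <= t -> r <= h t by move=> at_; rewrite /h lerDl subr_ge0.
pose G t := I F a t - c * ln (h t).
have : G a <= G b.
  apply: locally_nondecreasing_le => // e e0.
  have c1 : 0 < c + 1 by rewrite ltr_wpDl.
  have e'0 : 0 < e / (c + 1) by rewrite divr_gt0.
  (* Over a step of this size [1 / h] varies by at most [e / (c + 1)], because [h >= r]. *)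
  exists (e / (c + 1) * r ^+ 2); first by rewrite mulr_gt0 ?exprn_gt0.
  move=> s t as_ st tb std; rewrite /G (segment_integralD Fc as_ st).
  have hs0 := lt_le_trans r0 (h0 _ as_).
  have hst : h s <= h t by rewrite /h lerD2l lerD2r.
  have ht0 := lt_le_trans hs0 hst.
  have [_ l2] := ln_incr_bounds hs0 hst.
  have hE : h t - h s = t - s by rewrite /h; ring.
  rewrite hE in l2.
  have i1 : c / h t * (t - s) <= I F s t.
    apply: segment_integral_ge_cst => // u /andP[su ut].
    apply: (le_trans _ (H u _)); last by rewrite (le_trans as_ su) (le_trans ut).
    rewrite ler_wpM2l// lef_pV2 ?posrE//; first by rewrite /h lerD2l lerD2r.
    by apply: (lt_le_trans r0); apply: (h0 u); exact: le_trans as_ su.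
  have i2 : (h s)^-1 - (h t)^-1 <= e / (c + 1).
    by apply: (inv_incr_bound r0) => //; [exact: h0|rewrite hE].
  have i3 : c * ((h s)^-1 - (h t)^-1) * (t - s) <= e * (t - s).
    rewrite ler_wpM2r ?subr_ge0// (le_trans (ler_wpM2l c0 i2))//.
    by rewrite mulrCA ler_piMr ?(ltW e0)// ler_pdivrMr// mul1r lerDl.
  have i4 : c * (ln (h t) - ln (h s)) <= c * ((t - s) / h s) by rewrite ler_wpM2l.
  move: i1 i3 i4; rewrite mulrA.
  set A := (h s)^-1; set B := (h t)^-1; lra.
have Ia : I F a a = 0 by rewrite /segment_integral set_itv1 Rintegral_set1.
rewrite /G Ia /h subrr addr0.
have -> : 1 + (b - a) / r = (r + (b - a)) / r by field; rewrite gt_eqF.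
by rewrite ln_div ?posrE//; [lra|rewrite ltr_wpDr ?subr_ge0].
Qed.

Lemma segment_integral_le_ln F a b c r : continuous F -> a <= b -> 0 < r ->
  0 <= c -> (forall u, a <= u <= b -> F u <= c / (r + (u - a))) ->
  I F a b <= c * ln (1 + (b - a) / r).
Proof.
move=> Fc ab r0 c0 H.
pose h t := r + (t - a).
have h0 t : a <= t -> r <= h t by move=> at_; rewrite /h lerDl subr_ge0.
pose G t := c * ln (h t) - I F a t.
have : G a <= G b.
  apply: locally_nondecreasing_le => // e e0.
  have c1 : 0 < c + 1 by rewrite ltr_wpDl.
  have e'0 : 0 < e / (c + 1) by rewrite divr_gt0.
  exists (e / (c + 1) * r ^+ 2); first by rewrite mulr_gt0 ?exprn_gt0.
  move=> s t as_ st tb std; rewrite /G (segment_integralD Fc as_ st).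
  have hs0 := lt_le_trans r0 (h0 _ as_).
  have hst : h s <= h t by rewrite /h lerD2l lerD2r.
  have ht0 := lt_le_trans hs0 hst.
  have [l1 _] := ln_incr_bounds hs0 hst.
  have hE : h t - h s = t - s by rewrite /h; ring.
  rewrite hE in l1.
  have i1 : I F s t <= c / h s * (t - s).
    apply: segment_integral_le_cst => // u /andP[su ut].
    apply: (le_trans (H u _)); first by rewrite (le_trans as_ su) (le_trans ut).
    rewrite ler_wpM2l// lef_pV2 ?posrE//; first by rewrite /h lerD2l lerD2r.
    by apply: (lt_le_trans r0); apply: (h0 u); exact: le_trans as_ su.
  have i2 : (h s)^-1 - (h t)^-1 <= e / (c + 1).
    by apply: (inv_incr_bound r0) => //; [exact: h0|rewrite hE].
  have i3 : c * ((h s)^-1 - (h t)^-1) * (t - s) <= e * (t - s).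
    rewrite ler_wpM2r ?subr_ge0// (le_trans (ler_wpM2l c0 i2))//.
    by rewrite mulrCA ler_piMr ?(ltW e0)// ler_pdivrMr// mul1r lerDl.
  have i4 : c * ((t - s) / h t) <= c * (ln (h t) - ln (h s)) by rewrite ler_wpM2l.
  move: i1 i3 i4; rewrite mulrA.
  set A := (h s)^-1; set B := (h t)^-1; lra.
have Ia : I F a a = 0 by rewrite /segment_integral set_itv1 Rintegral_set1.
rewrite /G Ia /h subrr addr0.
have -> : 1 + (b - a) / r = (r + (b - a)) / r by field; rewrite gt_eqF.
by rewrite ln_div ?posrE//; [lra|rewrite ltr_wpDr ?subr_ge0].
Qed.

End continuous_integral.

(** * The quasihyperbolic metric *)

Section clamp.
Variables (R : realType) (l : R).
Hypothesis l0 : 0 <= l.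

(** Extends the arc length parametrisation from [[0, l]] to the whole line and keeps it 1-Lipschitz,
    so that densities along it are continuous everywhere. *)
Definition clamp (u : R) : R := Order.max 0 (Order.min u l).

Lemma clamp_itv u : 0 <= clamp u <= l.
Proof. by rewrite le_max lexx/= ge_max l0/= ge_min lexx orbT. Qed.

Lemma clamp_id u : 0 <= u <= l -> clamp u = u.
Proof. by move=> /andP[u0 ul]; rewrite /clamp (min_idPl ul) (max_idPr u0). Qed.

Lemma clamp_lipschitz u v : `|clamp u - clamp v| <= `|u - v|.
Proof.
have cases w : [\/ w <= 0 /\ clamp w = 0, 0 <= w <= l /\ clamp w = w
    | l <= w /\ clamp w = l].
  have [w0|/ltW w0] := leP w 0.
    by apply: Or31; rewrite /clamp (min_idPl (le_trans w0 l0)) (max_idPl w0).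
  have [wl|/ltW wl] := leP w l; first by apply: Or32; rewrite clamp_id w0.
  by apply: Or33; rewrite /clamp (min_idPr wl) (max_idPr l0).
have l0' := l0; have h1 := ler_norm (u - v); have h2 := ler_norm (v - u); rewrite distrC in h2.
rewrite ler_norml; move: (`|u - v|) h1 h2 => n h1 h2.
by case: (cases u) => -[h3 ->]; case: (cases v) => -[h4 ->]; apply/andP; split; lra.
Qed.

End clamp.

Section boundary_distance.
Variables (R : realType) (X : metricType R) (Xb : completion X).
Local Notation r := (dist_boundary Xb).

Lemma completion_approx (z : Xb) e : 0 < e ->
  exists x, mdist (emb Xb x) z < e.
Proof.
move=> e0; have : closure (range (emb Xb)) z by rewrite emb_dense.
move=> /(_ _ (nbhsx_ballx z e e0))[_ [[x _ <-]]].
by rewrite ballEmdist/= metric_sym; exists x.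
Qed.

Lemma cvg_mdistP (Y : metricType R) (u : nat -> Y) (z : Y) :
  u @ \oo --> z <->
  (forall e, 0 < e -> exists N, forall i, (N <= i)%N -> mdist (u i) z < e).
Proof.
split=> [/cvg_ballP h e e0|h].
  have [N _ H] := h e e0; exists N => i Ni; have := H i Ni.
  by rewrite ballEmdist/= metric_sym.
apply/cvg_ballP => e e0; have [N H] := h e e0; exists N => // i Ni.
by rewrite /= ballEmdist/= metric_sym; exact: H.
Qed.

Lemma cauchy_mdistP (Y : metricType R) (u : nat -> Y) :
  (forall e, 0 < e -> exists N, forall i j, (N <= i)%N -> (N <= j)%N ->
    mdist (u i) (u j) < e) -> cauchy (u @ \oo).
Proof.
move=> h; apply/cauchy_exP => e e0; have [N H] := h e e0.
by exists (u N); exists N => // i Ni; rewrite /= ballEmdist/=; exact: H.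
Qed.

Lemma mdist_limit_unique (Y : metricType R) (y z : Y) :
  (forall e, 0 < e -> mdist y z < e) -> y = z.
Proof.
move=> h; apply: mdist_positivity; apply/le_anti; rewrite mdist_ge0 andbT.
by apply/ler_addgt0Pr => e /h/ltW; rewrite add0r.
Qed.

Hypothesis incomplete : metric_boundary Xb !=set0.

Lemma dist_boundary_le x z : metric_boundary Xb z ->
  r x <= mdist (emb Xb x) z.
Proof.
move=> bz; apply: ge_inf; last by exists z.
by exists 0 => _ [y _ <-]; exact: mdist_ge0.
Qed.

Lemma dist_boundary_ge x m :
  (forall z, metric_boundary Xb z -> m <= mdist (emb Xb x) z) -> m <= r x.
Proof.
move=> h; have [z bz] := incomplete.
by apply: lb_le_inf; [exists (mdist (emb Xb x) z); exists z|move=> _ [y by_ <-]; exact: h].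
Qed.

Lemma dist_boundary_lipschitz x y : r x <= r y + mdist x y.
Proof.
rewrite -lerBlDr; apply: dist_boundary_ge => z bz; rewrite lerBlDr.
rewrite (le_trans (dist_boundary_le x bz))// addrC -(emb_isometry Xb).
exact: metric_triangle.
Qed.

Hypothesis lc : locally_complete X.

(** If a boundary point [z] were within [e / 2] of [x], points of [X] approximating it would form a
    Cauchy sequence in the complete set [U], and its limit would place [z] in [X]. *)
Lemma dist_boundary_gt0 x : 0 < r x.
Proof.
have [U /nbhs_ballP[e e0 eU] cU] := lc x.
have e20 : 0 < e / 2 by rewrite divr_gt0.
suff : e / 2 <= r x by exact: lt_le_trans.
apply: dist_boundary_ge => z bz; rewrite leNgt; apply/negP => xz.
have pos n : 0 < Order.min (e / 2 - mdist (emb Xb x) z) n.+1%:R^-1.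
  by rewrite lt_min subr_gt0 xz invr_gt0 ltr0Sn.
have [u Hu] := choice (fun n => completion_approx z (pos n)).
have u1 n : mdist (emb Xb (u n)) z < e / 2 - mdist (emb Xb x) z.
  by have := Hu n; rewrite lt_min => /andP[].
have u2 n : mdist (emb Xb (u n)) z < n.+1%:R^-1.
  by have := Hu n; rewrite lt_min => /andP[].
have uU n : U (u n).
  apply: eU; rewrite ballEmdist/= -(emb_isometry Xb).
  have := metric_triangle (emb Xb x) z (emb Xb (u n)).
  by have := u1 n; rewrite (metric_sym z); lra.
have small e' : 0 < e' -> exists N, forall i, (N <= i)%N -> mdist (emb Xb (u i)) z < e'.
  move=> e'0; exists (Num.trunc e'^-1) => i Ni; apply: (lt_le_trans (u2 i)).
  have e'i : 0 <= e'^-1 by rewrite invr_ge0 ltW.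
  have /andP[_ h] := truncn_itv e'i.
  rewrite -[leRHS]invrK lef_pV2 ?posrE ?invr_gt0//.
  by rewrite (le_trans (ltW h))// ler_nat ltnS.
have cu : cauchy (u @ \oo).
  apply: cauchy_mdistP => e' e'0; have [|N HN] := small (e' / 2); first by rewrite divr_gt0.
  exists N => i j Ni Nj; rewrite -(emb_isometry Xb).
  have := metric_triangle (emb Xb (u i)) z (emb Xb (u j)).
  have := HN i Ni; have := HN j Nj; rewrite (metric_sym z); lra.
have [p Up /cvg_mdistP up] := cU u uU cu.
apply: bz; exists p => //; apply: mdist_limit_unique => e' e'0.
have [|N HN] := small (e' / 2); first by rewrite divr_gt0.
have [|N' HN'] := up (e' / 2); first by rewrite divr_gt0.
have := HN _ (leq_maxl N N'); have := HN' _ (leq_maxr N N').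
set n := maxn N N'; rewrite -(emb_isometry Xb) metric_sym.
have := metric_triangle (emb Xb p) (emb Xb (u n)) z; lra.
Qed.

End boundary_distance.

Section quasihyperbolic_metric.
Variables (R : realType) (X : metricType R) (Xb : completion X).
Hypotheses (incomplete : metric_boundary Xb !=set0) (lc : locally_complete X).
Hypothesis rc : forall x y : X, exists a b g, rectifiable_curve a b g x y.
Local Notation r := (dist_boundary Xb).
Local Notation k := (quasihyperbolic Xb).
Local Notation I := segment_integral.

(** Global, and an inequality rather than unit speed: the class is then stable under reversal and
    concatenation. *)
Definition lipschitz1_curve (g : R -> X) :=
  forall s t, mdist (g s) (g t) <= `|s - t|.

Definition qh_density (g : R -> X) (t : R) : R := (r (g t))^-1.

Let r0 x : 0 < r x. Proof. exact: dist_boundary_gt0. Qed.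

Section lipschitz_curve.
Variable g : R -> X.
Hypothesis gl : lipschitz1_curve g.

Lemma lipschitz1_dist_boundary s t : r (g t) <= r (g s) + `|s - t|.
Proof.
rewrite (le_trans (dist_boundary_lipschitz incomplete (g t) (g s)))// lerD2l.
by rewrite distrC gl.
Qed.

Lemma dist_boundary_continuous : continuous (r \o g).
Proof.
move=> s; apply/cvgrPdist_le => e e0.
near=> t; have ste : `|s - t| <= e.
  by near: t; apply: (@cvgr_dist_le _ R^o) => //; exact: cvg_id.
have := lipschitz1_dist_boundary s t; have := lipschitz1_dist_boundary t s.
by rewrite (distrC t s) ler_norml/=; lra.
Unshelve. all: end_near. Qed.

Lemma qh_density_continuous : continuous (qh_density g).
Proof.
move=> s; apply: (@cvgV R R (nbhs s) _ (r \o g) (r (g s))); first by rewrite gt_eqF.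
exact: dist_boundary_continuous.
Qed.

Lemma qh_density_uniform a b e : a <= b -> 0 < e ->
  exists2 d, 0 < d & forall s t, a <= s <= b -> a <= t <= b ->
    `|s - t| <= d -> qh_density g s <= qh_density g t + e.
Proof.
move=> ab e0.
have [|c _ cmin] := @EVT_min R (r \o g) a b ab.
  by apply: continuous_subspaceT; exact: dist_boundary_continuous.
exists (e * r (g c) ^+ 2); first by rewrite mulr_gt0// exprn_gt0.
move=> s t sab tab std; rewrite -lerBlDl /qh_density.
have [st|ts] := leP (r (g s)) (r (g t)).
  apply: (@inv_incr_bound _ (r (g c))) => //.
    by apply: cmin; rewrite in_itv.
  by rewrite (le_trans _ std)// lerBlDl lipschitz1_dist_boundary.
by rewrite (le_trans _ (ltW e0))// subr_le0 lef_pV2 ?posrE// ltW.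
Qed.

Lemma qh_length_ge_ln a b : a <= b ->
  ln (1 + mdist (g a) (g b) / r (g a)) <= I (qh_density g) a b.
Proof.
move=> ab; have := @segment_integral_ge_ln R (qh_density g) a b 1 (r (g a))
  qh_density_continuous ab (r0 _) ler01.
rewrite mul1r => H; apply: le_trans (H _); last first.
  move=> u /andP[au ub]; rewrite mul1r lef_pV2 ?posrE//; last first.
    by rewrite ltr_wpDr ?subr_ge0.
  by have := lipschitz1_dist_boundary a u; rewrite distrC ger0_norm ?subr_ge0.
have pos c : 0 <= c -> 0 < 1 + c / r (g a).
  by move=> c0; rewrite ltr_wpDr// divr_ge0// ltW.
rewrite ler_ln ?posrE ?pos ?mdist_ge0 ?subr_ge0// lerD2l ler_pM2r ?invr_gt0//.
by rewrite (le_trans (gl _ _))// distrC ger0_norm ?subr_ge0.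
Qed.

Lemma lipschitz1_polygon a b s : itv_partition a b s ->
  polygon_length g a s <= b - a.
Proof.
elim: s a => [|t s IH] a; first by move=> /itv_partition0 ->; rewrite subrr.
move=> /itv_partition_cons[at_ /IH]; rewrite /=; have := gl a t.
have -> : `|a - t| = t - a by rewrite distrC ger0_norm// subr_ge0 ltW.
lra.
Qed.

Lemma lipschitz1_continuous_curve (A : set R) : {within A, continuous g}.
Proof.
apply: continuous_subspaceT => s; apply/cvg_ballP => e e0.
near=> t; rewrite ballEmdist/=; apply: (le_lt_trans (gl _ _)).
by near: t; apply: (@cvgr_dist_lt _ R^o) => //; exact: cvg_id.
Unshelve. all: end_near. Qed.

Lemma lipschitz1_rectifiable a b : a <= b -> rectifiable_curve a b g (g a) (g b).
Proof.
move=> ab; split => //; first exact: lipschitz1_continuous_curve.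
apply: le_lt_trans (ltry (b - a)); apply: curve_length_le => s abs.
by rewrite lee_fin lipschitz1_polygon.
Qed.

End lipschitz_curve.

(** Arc length turns a rectifiable curve into a 1-Lipschitz one, whose density is continuous and
    whose line integral is an ordinary integral. The lengths of the subcurves are recorded for the
    condition on uniform curves. *)
Lemma arclength_reparametrization a b (g : R -> X) x y :
  rectifiable_curve a b g x y -> exists (h : R -> X) (l : R),
  [/\ [/\ 0 <= l, lipschitz1_curve h, h 0 = x, h l = y
        & curve_length a b g = l%:E],
      line_integral a b g (fun z => (r z)^-1) = (I (qh_density h) 0 l)%:E,
      forall u, 0 <= u <= l -> exists2 t, a <= t <= b &
        [/\ h u = g t, curve_length a t g = u%:E
          & curve_length t b g = (l - u)%:E]
    & forall t, a <= t <= b -> h (arclength a g t) = g t].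
Proof.
move=> [ab gc gx gy gfin]; pose l := fine (curve_length a b g).
have aab : a <= a <= b by rewrite lexx.
have bab : a <= b <= b by rewrite lexx ab.
have [lE _] := arclength_fin gfin bab.
have V0 := arclength0 a g; have Vl : arclength a g b = l by [].
have l0 : 0 <= l by rewrite -Vl -V0; apply: (arclength_le gfin).
pose h u := arclength_param a b g (clamp l u).
have hP u : exists2 t, a <= t <= b & h u = g t /\ arclength a g t = clamp l u.
  have [tab tu] := arclength_inf ab gc gfin (clamp_itv l0 u).
  by eexists; [exact: tab|split].
have hl : lipschitz1_curve h.
  move=> u v; have [s sab [-> Vs]] := hP u; have [t tab [-> Vt]] := hP v.
  rewrite (le_trans (mdist_arclength_norm gfin sab tab))//.
  by rewrite Vs Vt clamp_lipschitz.
have hV t : a <= t <= b -> h (arclength a g t) = g t.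
  move=> tab; have [s sab [-> Vs]] := hP (arclength a g t).
  have Vt : 0 <= arclength a g t <= l.
    case/andP: tab => at_ tb; rewrite -V0 -Vl.
    by rewrite (arclength_le gfin (lexx a) at_ tb) (arclength_le gfin at_ tb (lexx b)).
  apply: mdist_positivity; apply/le_anti; rewrite mdist_ge0 andbT.
  by rewrite (le_trans (mdist_arclength_norm gfin sab tab))// Vs clamp_id// subrr normr0.
exists h, l; split => //.
- by split => //; rewrite -?gx -?gy -?V0 -?Vl hV.
- rewrite /line_integral -segment_integralE; last exact: qh_density_continuous.
  apply: eq_integral => u; rewrite inE/= in_itv/= => ul.
  by rewrite /qh_density /h clamp_id.
- move=> u ul; have [t tab [-> Vt]] := hP u; exists t => //.
  have [h1 h2] := arclength_fin gfin tab.
  by rewrite h1 h2 Vt clamp_id.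
Qed.

Let gfin_of a b (g : R -> X) (l : R) :
  curve_length a b g = l%:E -> (curve_length a b g < +oo)%E.
Proof. by move=> ->; rewrite ltry. Qed.

(* Passing to the arc length parameter does not increase the integral, since
   arc length grows at most as fast as the parameter of a 1-Lipschitz curve. *)
Lemma qh_length_reparametrization a b (g h : R -> X) (l : R) : a <= b ->
  lipschitz1_curve g -> lipschitz1_curve h -> curve_length a b g = l%:E ->
  (forall t, a <= t <= b -> h (arclength a g t) = g t) ->
  I (qh_density h) 0 l <= I (qh_density g) a b.
Proof.
move=> ab gl hl gE hg; have gfin := gfin_of gE.
pose V := arclength a g.
have V0 : V a = 0 := arclength0 a g.
have Vl : V b = l by rewrite /V /arclength gE.
have Vle s t : a <= s -> s <= t -> t <= b -> V s <= V t by exact: (arclength_le gfin).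
have Vlip s t : a <= s -> s <= t -> t <= b -> V t - V s <= t - s.
  move=> as_ st tb; rewrite -lee_fin -(arclength_sub gfin)//.
  apply: curve_length_le => s' part; rewrite lee_fin; exact: lipschitz1_polygon.
have Fgc := qh_density_continuous gl; have Fhc := qh_density_continuous hl.
have l0 : 0 <= l by rewrite -V0 -Vl; apply: Vle.
pose G t := I (qh_density g) a t - I (qh_density h) 0 (V t).
have : G a <= G b.
  apply: locally_nondecreasing_le => // e e0.
  have e20 : 0 < e / 2 by rewrite divr_gt0.
  have [d1 d10 H1] := qh_density_uniform gl ab e20.
  have [d2 d20 H2] := qh_density_uniform hl l0 e20.
  exists (Order.min d1 d2); first by rewrite lt_min d10.
  move=> s t as_ st tb; rewrite le_min => /andP[sd1 sd2].
  have Vs0 : 0 <= V s by rewrite -V0; apply: Vle => //; exact: le_trans tb.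
  have Vst := Vle _ _ as_ st tb.
  have Vtl : V t <= l by rewrite -Vl; apply: Vle => //; exact: le_trans st.
  have VL := Vlip _ _ as_ st tb.
  rewrite /G (segment_integralD Fgc as_ st) (segment_integralD Fhc Vs0 Vst).
  have sab : a <= s <= b by rewrite as_ (le_trans st).
  have i1 : (qh_density g s - e / 2) * (t - s) <= I (qh_density g) s t.
    apply: segment_integral_ge_cst => // u /andP[su ut]; rewrite lerBlDr.
    apply: H1 => //; first by rewrite (le_trans as_ su) (le_trans ut).
    by rewrite distrC ger0_norm ?subr_ge0// (le_trans _ sd1)// lerD2r.
  have i2 : I (qh_density h) (V s) (V t) <= (qh_density g s + e / 2) * (V t - V s).
    apply: segment_integral_le_cst => // u /andP[su ut].
    have -> : qh_density g s = qh_density h (V s) by rewrite /qh_density /V hg.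
    apply: H2.
    - by rewrite (le_trans Vs0 su) (le_trans ut).
    - by rewrite Vs0 (le_trans Vst).
    - rewrite ger0_norm ?subr_ge0// (le_trans _ sd2)// (le_trans _ VL)//.
      by rewrite lerD2r.
  have Fs0 : 0 <= qh_density g s by rewrite invr_ge0 ltW.
  have ts0 : 0 <= t - s by rewrite subr_ge0.
  have i3 : qh_density g s * (V t - V s) <= qh_density g s * (t - s).
    by rewrite ler_wpM2l.
  have i4 : e / 2 * (V t - V s) <= e / 2 * (t - s) by rewrite ler_wpM2l// ltW.
  move: i1 i2; rewrite mulrBl mulrDl.
  have -> : e * (t - s) = e / 2 * (t - s) + e / 2 * (t - s) by lra.
  lra.
rewrite /G V0 Vl.
have Ia F c : I F c c = 0 by rewrite /segment_integral set_itv1 Rintegral_set1.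
by rewrite !Ia subrr subr_ge0.
Qed.

Lemma qh_length_ge0 (g : R -> X) a b : 0 <= I (qh_density g) a b.
Proof. by apply: Rintegral_ge0 => u _; rewrite invr_ge0 ltW. Qed.

Let lengths (x y : X) : set (\bar R) := [set l | exists a b g,
  rectifiable_curve a b g x y /\
  l = line_integral a b g (fun z => (r z)^-1)].

Let lengthsP x y l : lengths x y l -> exists (h : R -> X) (L : R),
  [/\ 0 <= L, lipschitz1_curve h, h 0 = x, h L = y
    & l = (I (qh_density h) 0 L)%:E].
Proof.
move=> [a [b [g [gr ->]]]].
have [h [L [[L0 hl h0 hL _] -> _ _]]] := arclength_reparametrization gr.
by exists h, L.
Qed.

Let lengths_fin x y : ereal_inf (lengths x y) \is a fin_num.
Proof.
have [a [b [g gr]]] := rc x y.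
have Sl : lengths x y (line_integral a b g (fun z => (r z)^-1)).
  by exists a, b, g.
rewrite ge0_fin_numE.
  apply: (le_lt_trans (ereal_inf_lbound Sl)).
  by have [h [L [_ _ _ _ ->]]] := lengthsP Sl; rewrite ltry.
apply: le_ereal_inf_tmp => l /lengthsP[h [L [_ _ _ _ ->]]].
by rewrite lee_fin qh_length_ge0.
Qed.

Lemma quasihyperbolicE x y : (k x y)%:E = ereal_inf (lengths x y).
Proof. by rewrite /quasihyperbolic fineK// lengths_fin. Qed.

Lemma quasihyperbolic_approx x y e : 0 < e -> exists (h : R -> X) (L : R),
  [/\ 0 <= L, lipschitz1_curve h, h 0 = x, h L = y
    & I (qh_density h) 0 L < k x y + e].
Proof.
move=> e0; have [l Sl] := lb_ereal_inf_adherent e0 (lengths_fin x y).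
have [h [L [L0 hl h0 hL ->]]] := lengthsP Sl.
by rewrite -quasihyperbolicE -EFinD lte_fin => H; exists h, L.
Qed.

Lemma quasihyperbolic_le (g : R -> X) a b : lipschitz1_curve g -> a <= b ->
  k (g a) (g b) <= I (qh_density g) a b.
Proof.
move=> gl ab; have gr := lipschitz1_rectifiable gl ab.
have [h [L [[L0 hl h0 hL gE] lE _ hg]]] := arclength_reparametrization gr.
rewrite (le_trans _ (qh_length_reparametrization ab gl hl gE hg))//.
rewrite -lee_fin quasihyperbolicE -lE; apply: ereal_inf_lbound.
by exists a, b, g.
Qed.

Lemma quasihyperbolic_ge_ln x y : ln (1 + mdist x y / r x) <= k x y.
Proof.
apply/ler_addgt0Pr => e e0.
have [h [L [L0 hl h0 hL /ltW le]]] := quasihyperbolic_approx x y e0.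
by apply: le_trans le; rewrite -h0 -hL; exact: qh_length_ge_ln.
Qed.

Lemma quasihyperbolic_ge0 x y : 0 <= k x y.
Proof.
apply: le_trans (quasihyperbolic_ge_ln x y).
by rewrite ln_ge0// lerDl divr_ge0 ?mdist_ge0// ltW.
Qed.

Lemma quasihyperbolic_sym_le x y : k x y <= k y x.
Proof.
apply/ler_addgt0Pr => e e0.
have [h [L [L0 hl h0 hL /ltW le]]] := quasihyperbolic_approx y x e0.
apply: le_trans le.
have hNl : lipschitz1_curve (h \o -%R).
  by move=> s t; rewrite (le_trans (hl _ _))// -opprD normrN.
have := @quasihyperbolic_le (h \o -%R) (- L) (- 0) hNl.
rewrite lerN2 /= !opprK h0 hL => /(_ L0) /le_trans; apply.
have -> : qh_density (h \o -%R) = qh_density h \o -%R by [].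
rewrite -segment_integralN ?opprK//; first exact: qh_density_continuous.
by rewrite lerN2.
Qed.

Lemma quasihyperbolic_triangle x y z : k x z <= k x y + k y z.
Proof.
apply/ler_addgt0Pr => e e0; have e20 : 0 < e / 2 by rewrite divr_gt0.
have [h1 [L1 [L10 hl1 h10 h1L /ltW le1]]] := quasihyperbolic_approx y x e20.
have [h2 [L2 [L20 hl2 h20 h2L /ltW le2]]] := quasihyperbolic_approx y z e20.
(* Both pieces start at [y], so they are glued at the parameter 0, the first one run backwards. *)
pose g t := if t <= 0 then h1 (- t) else h2 t.
have gl : lipschitz1_curve g.
  move=> s t; rewrite /g; have [s0|s0] := leP s 0; have [t0|t0] := leP t 0.
  - by rewrite (le_trans (hl1 _ _))// -opprD normrN.
  - rewrite (le_trans (metric_triangle _ y _))//.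
    have := hl1 (- s) 0; have := hl2 0 t.
    rewrite h10 h20 subr0 sub0r normrN (ger0_norm (ltW t0)) normrN (ler0_norm s0).
    have := ler_norm (t - s); rewrite distrC; lra.
  - rewrite (le_trans (metric_triangle _ y _))//.
    have := hl1 0 (- t); have := hl2 s 0.
    rewrite h10 h20 subr0 opprK add0r (ger0_norm (ltW s0)) (ler0_norm t0).
    have := ler_norm (s - t); lra.
  - exact: hl2.
have h0 : h1 0 = h2 0 by rewrite h10 h20.
have gL1 : g (- L1) = x by rewrite /g oppr_le0 L10 opprK h1L.
have gL2 : g L2 = z.
  rewrite /g; have [L20'|//] := leP L2 0.
  by have -> : L2 = 0; [apply/le_anti; rewrite L20'|rewrite oppr0 h0 -h2L; congr h2; apply/le_anti; rewrite L20 L20'].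
have L1n : - L1 <= 0 by rewrite oppr_le0.
have gc := qh_density_continuous gl.
have := quasihyperbolic_le gl (le_trans L1n L20); rewrite gL1 gL2.
rewrite (segment_integralD gc L1n L20) => /le_trans; apply.
have -> : I (qh_density g) 0 L2 = I (qh_density h2) 0 L2.
  apply: eq_Rintegral => u; rewrite inE/= in_itv/= => /andP[u0 _].
  rewrite /qh_density /g; have [u0'|//] := leP u 0.
  by have -> : u = 0; [apply/le_anti; rewrite u0 u0'|rewrite oppr0 h0].
have -> : I (qh_density g) (- L1) 0 = I (qh_density h1) 0 L1.
  have h1c := qh_density_continuous hl1.
  have := segment_integralN h1c L1n; rewrite oppr0 opprK => ->.
  apply: eq_Rintegral => u; rewrite inE/= in_itv/= => /andP[_ u0].
  by rewrite /qh_density /g u0.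
have := quasihyperbolic_sym_le y x; lra.
Qed.

Lemma quasihyperbolic_metric : is_metric_on [set: X] k.
Proof.
split=> [x y _ _|x y _ _|x y _ _|x y z _ _ _].
- exact: quasihyperbolic_ge0.
- split=> [k0|->]; last first.
    have cl : lipschitz1_curve (fun=> y) by move=> s t; rewrite mdistxx.
    apply/le_anti; rewrite quasihyperbolic_ge0 andbT.
    rewrite (le_trans (quasihyperbolic_le cl (lexx 0)))//.
    by rewrite /segment_integral set_itv1 Rintegral_set1.
  apply: mdist_positivity; apply/le_anti; rewrite mdist_ge0 andbT leNgt.
  apply/negP => d0; have := quasihyperbolic_ge_ln x y.
  by rewrite k0 leNgt ln_gt0// ltrDl divr_gt0.
- by apply/le_anti; rewrite !quasihyperbolic_sym_le.
- exact: quasihyperbolic_triangle.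
Qed.

(** A curve whose quasihyperbolic length is within 1 of the infimum is parametrised by that length
    [U]. Without local compactness a minimiser may fail to exist, whence the excess 1. *)
Lemma quasihyperbolic_geodesic x y : exists (L : R) (g : R -> X),
  [/\ 0 <= L, L <= k x y + 1, g 0 = x, g L = y
    & forall s t, k (g s) (g t) <= `|s - t|].
Proof.
have [h [l [l0 hl h0 hL /ltW le]]] := quasihyperbolic_approx x y ltr01.
have hc := qh_density_continuous hl.
pose U t := I (qh_density h) 0 t.
have U0 : U 0 = 0 by rewrite /U /segment_integral set_itv1 Rintegral_set1.
have Uc : {within `[0, l], continuous U}.
  by apply: parameterized_integral_continuous => //; exact: continuous_integrable.
have Ul0 : 0 <= U l by exact: qh_length_ge0.
have inv s : exists t, 0 <= t <= l /\ U t = clamp (U l) s.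
  have [|t] := IVT (v := clamp (U l) s) l0 Uc.
    rewrite U0 (min_idPl Ul0) (max_idPr Ul0); exact: clamp_itv.
  by rewrite in_itv/= => tl Ut; exists t.
have [T HT] := choice inv.
have kU s t : 0 <= s <= l -> 0 <= t <= l -> k (h s) (h t) <= `|U s - U t|.
  suff H u v : 0 <= u -> u <= v -> v <= l -> k (h u) (h v) <= `|U u - U v|.
    move=> /andP[s0 sl] /andP[t0 tl]; have [st|/ltW ts] := leP s t; first exact: H.
    by rewrite distrC (le_trans (quasihyperbolic_sym_le _ _))// H.
  move=> u0 uv vl; rewrite (le_trans (quasihyperbolic_le hl uv))//.
  rewrite distrC {1}/U (segment_integralD hc u0 uv) /U addrC addKr ler_norm//.
(* The preimages under [U] are arbitrary choices, but points with equal [U] are at [k]-distance 0;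
   this pins down the two ends. *)
have eqk u v : 0 <= u <= l -> 0 <= v <= l -> U u = U v -> h u = h v.
  move=> ul vl E; have [_ kE _ _] := quasihyperbolic_metric.
  apply: (proj1 (kE (h u) (h v) Logic.I Logic.I)).
  apply/le_anti; rewrite quasihyperbolic_ge0 andbT.
  by rewrite (le_trans (kU _ _ ul vl))// E subrr normr0.
exists (U l), (fun s => h (T s)); split => //.
- rewrite -h0; have [Tl UT] := HT 0; apply: eqk => //; first by rewrite lexx.
  by rewrite UT U0 clamp_id// lexx.
- rewrite -hL; have [Tl UT] := HT (U l); apply: eqk => //; first by rewrite l0 lexx.
  by rewrite UT clamp_id// lexx Ul0.
- move=> s t; have [Ts Us] := HT s; have [Tt Ut] := HT t.
  rewrite (le_trans (kU _ _ Ts Tt))// Us Ut; exact: clamp_lipschitz.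
Qed.

End quasihyperbolic_metric.

(** * Hyperbolicity *)

(* [P x y] stands for the logarithm of [d x y + r x + r y] and [f x] for that
   of [r x], where [r] is the distance to the boundary; [k] plays the role of
   the quasihyperbolic metric. *)
Record qh_model (R : realType) (C : R) (T : Type) (f : T -> R)
    (P k : T -> T -> R) : Prop := QhModel {
  qh_metric : is_metric_on [set: T] k ;
  qh_sym : forall x y, P x y = P y x ;
  qh_triangle : forall x y z, expR (P x z) <= expR (P x y) + expR (P y z) ;
  qh_height : forall x y, f x <= P x y ;
  qh_lipschitz : forall x y, f y <= f x + k x y ;
  qh_lower : forall x y, P x y <= f x + k x y + 1 ;
  qh_upper : forall x y, k x y <= C * (2 * P x y - f x - f y + 1) ;
  qh_geodesic : forall x y, exists (L : R) (g : R -> T),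
    [/\ 0 <= L, L <= k x y + 1, g 0 = x, g L = y
      & forall s t, k (g s) (g t) <= `|s - t|] ;
  qh_unbounded : forall x M, exists y, M <= P x y
}.

Lemma ln_le_affine (R : realType) (a x : R) :
  0 < a -> 0 < x -> ln x <= x / a + ln a.
Proof.
move=> a0 x0; have xa0 : 0 < x / a by rewrite divr_gt0.
rewrite -{1}(divfK (lt0r_neq0 a0) x) lnM ?posrE//.
by rewrite lerD2r ltW// ln_sublinear.
Qed.

Lemma lipschitz1_continuous (R : realType) (h : R -> R) :
  (forall s t, h t <= h s + `|s - t|) -> continuous h.
Proof.
move=> hl s; apply/cvgrPdist_le => e e0.
near=> t; have ste : `|s - t| <= e.
  by near: t; apply: (@cvgr_dist_le _ R^o) => //; exact: cvg_id.
have := hl s t; have := hl t s; rewrite (distrC t s) ler_norml; lra.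
Unshelve. all: end_near. Qed.

Lemma continuous_IVT_incr (R : realType) (h : R -> R) (a b v : R) :
  continuous h -> a <= b -> h a <= v -> v <= h b ->
  exists2 c, a <= c <= b & h c = v.
Proof.
move=> hc ab av vb.
have [||c] := @IVT R h a b v ab; first exact: continuous_subspaceT.
  by rewrite ge_min av/= le_max vb orbT.
by rewrite in_itv/=; exists c.
Qed.

Lemma continuous_IVT_decr (R : realType) (h : R -> R) (a b v : R) :
  continuous h -> a <= b -> h b <= v -> v <= h a ->
  exists2 c, a <= c <= b & h c = v.
Proof.
move=> hc ab bv va.
have [||c] := @IVT R h a b v ab; first exact: continuous_subspaceT.
  by rewrite ge_min bv orbT/= le_max va.
by rewrite in_itv/=; exists c.
Qed.

Lemma continuous_EVT_max (R : realType) (h : R -> R) (a b : R) :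
  continuous h -> a <= b ->
  exists2 c, a <= c <= b & forall t, a <= t <= b -> h t <= h c.
Proof.
move=> hc ab.
have [|c] := @EVT_max R h a b ab; first exact: continuous_subspaceT.
by rewrite in_itv/= => cab H; exists c => // t tab; apply: H; rewrite in_itv.
Qed.

(** * Rough geodesics, their tops, and Gromov products at an apex *)

Section qh_model_theory.
Variables (R : realType) (C : R).
Hypothesis C1 : 1 <= C.

Let C0 : 0 < C. Proof. exact: lt_le_trans C1. Qed.

Section fixed_model.
Variables (T : Type) (f : T -> R) (P k : T -> T -> R).
Hypothesis M : qh_model C f P k.

Lemma qh_xx x : k x x = 0.
Proof. by have [_ h _ _] := qh_metric M; apply/h. Qed.

Lemma qh_ksym x y : k x y = k y x.
Proof. by have [_ _ h _] := qh_metric M; exact: h. Qed.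

Lemma qh_ktri x y z : k x z <= k x y + k y z.
Proof. by have [_ _ _ h] := qh_metric M; exact: h. Qed.

Lemma qh_height_r x y : f y <= P x y.
Proof. by rewrite (qh_sym M) (qh_height M). Qed.

Lemma qh_diag x : P x x <= f x + 1.
Proof. by have := qh_lower M x x; rewrite qh_xx addr0. Qed.

Lemma qh_quasi_ultrametric y x z : P x z <= Order.max (P x y) (P y z) + 1.
Proof.
rewrite -ler_expR (le_trans (qh_triangle M x y z))// expRD.
have e2 : 2 <= expR 1 :> R by rewrite (le_trans _ (expR_ge1Dx 1)).
have m0 := expR_gt0 (Order.max (P x y) (P y z)).
have h1 : expR (P x y) <= expR (Order.max (P x y) (P y z)).
  by rewrite ler_expR le_max lexx.
have h2 : expR (P y z) <= expR (Order.max (P x y) (P y z)).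
  by rewrite ler_expR le_max lexx orbT.
nra.
Qed.

Lemma qh_ultra y x z m : P x y <= m -> P y z <= m -> P x z <= m + 1.
Proof.
move=> xy yz; rewrite (le_trans (qh_quasi_ultrametric y x z))// lerD2r.
by rewrite ge_max xy.
Qed.

Lemma qh_upper_le x y c :
  2 * P x y - f x - f y <= c -> k x y <= C * (c + 1).
Proof.
move=> h; rewrite (le_trans (qh_upper M x y))// ler_pM2l//; lra.
Qed.

Lemma qh_curve_continuous (g : R -> T) :
  (forall s t, k (g s) (g t) <= `|s - t|) -> continuous (f \o g).
Proof.
move=> gl; apply: lipschitz1_continuous => s t /=.
by rewrite (le_trans (qh_lipschitz M (g s) (g t)))// lerD2l.
Qed.

(** [expR P] obeys the triangle inequality, and below height [m] each unit of length contributes at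
    most [expR (m + 2)] by [qh_lower]. *)
Lemma qh_curve_chain (g : R -> T) (m : R) (n : nat) s t :
  (forall s t, k (g s) (g t) <= `|s - t|) ->
  s <= t -> t - s <= n.+1%:R -> (forall u, s <= u <= t -> f (g u) <= m) ->
  expR (P (g s) (g t)) <= n.+1%:R * expR (m + 2).
Proof.
move=> gl; elim: n t => [|n IH] t st tsn fm.
  rewrite mul1r ler_expR.
  have := qh_lower M (g s) (g t); have := gl s t; have := fm s.
  by rewrite lexx st => /(_ isT); rewrite distrC ger0_norm ?subr_ge0//; lra.
have step u v : s <= u -> u <= v -> v <= t -> v - u <= 1 ->
    expR (P (g u) (g v)) <= expR (m + 2).
  move=> su uv vt uv1; rewrite ler_expR.
  have := qh_lower M (g u) (g v); have := gl u v.
  have := fm u; rewrite su (le_trans uv vt) => /(_ isT).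
  rewrite distrC ger0_norm ?subr_ge0//; lra.
have [ts1|ts1] := leP (t - s) 1.
  rewrite (le_trans (step _ _ _ _ _ _))//.
  by rewrite ler_peMl ?expR_ge0// ler1n.
rewrite -[n.+2%:R]natr1 in tsn *.
rewrite (le_trans (qh_triangle M _ (g (t - 1)) _))//.
rewrite mulrDl mul1r lerD//.
  apply: IH => [||u /andP[su ut]]; [lra|lra|].
  by apply: fm; rewrite su/=; lra.
by apply: step; lra.
Qed.

End fixed_model.

(** Linear growth beats logarithmic growth: by [qh_curve_chain] the scale of the two ends is at most
    [m] plus the logarithm of the length, and as both ends are near height [m], [qh_upper] bounds
    the length by a multiple of that logarithm. *)
Lemma qh_level (th : R) : exists B : R, forall (T : Type) (f : T -> R)
    (P k : T -> T -> R) (g : R -> T) (s t m : R), qh_model C f P k ->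
  (forall s t, k (g s) (g t) <= `|s - t|) ->
  s <= t -> t - s - 1 <= k (g s) (g t) ->
  (forall u, s <= u <= t -> f (g u) <= m) ->
  m - th <= f (g s) -> m - th <= f (g t) -> t - s <= B.
Proof.
exists (2 * (2 + C * (2 * ln (4 * C) + 5 + 2 * th))).
move=> T f P k g s t m M gl st kge fm fs ft.
have ts0 : 0 <= t - s by rewrite subr_ge0.
have /andP[n1 n2] := truncn_itv ts0.
have Pm : P (g s) (g t) <= ln (t - s + 1) + (m + 2).
  rewrite -ler_expR expRD lnK ?posrE ?ltr_wpDl//.
  apply: (le_trans (qh_curve_chain M gl st (ltW n2) fm)).
  rewrite ler_wpM2r ?expR_ge0// -natr1 lerD2r//.
(* With this slope the term [2 * C * ln (t - s + 1)] uses up only half of the length. *)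
have lnx : ln (t - s + 1) <= (t - s + 1) / (4 * C) + ln (4 * C).
  by apply: ln_le_affine; [rewrite mulr_gt0|rewrite ltr_wpDl].
have : k (g s) (g t) <= C * (2 * ln (t - s + 1) + 4 + 2 * th + 1).
  by apply: (qh_upper_le M); lra.
have : C * ln (t - s + 1) <= (t - s + 1) / 4 + C * ln (4 * C).
  have := lnx; rewrite -(ler_pM2l C0).
  suff -> : C * ((t - s + 1) / (4 * C) + ln (4 * C)) =
    (t - s + 1) / 4 + C * ln (4 * C) by [].
  by field; rewrite gt_eqF.
lra.
Qed.

(* Up to its highest point, a rough geodesic rises exponentially: by
   [qh_level] it can neither dip far below a height already reached, nor stay
   at the same level for long. *)
Lemma qh_rise : exists2 B : R, 0 <= B & forall (T : Type) (f : T -> R)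
    (P k : T -> T -> R) (g : R -> T) (tm : R), qh_model C f P k ->
  (forall s t, k (g s) (g t) <= `|s - t|) ->
  (forall s t, 0 <= s -> s <= t -> t <= tm -> t - s - 1 <= k (g s) (g t)) ->
  (forall u, 0 <= u <= tm -> f (g u) <= f (g tm)) ->
  forall s, 0 <= s <= tm -> P (g 0) (g s) <= f (g s) + B.
Proof.
have [B1 lev1] := qh_level 1.
have [B2 lev2] := qh_level (1 + Order.max 0 B1).
set T1 := Order.max 0 B1 in lev2.
have T10 : 0 <= T1 by rewrite le_max lexx.
set T2 := Order.max 1 (B2 + 1).
have T21 : 1 <= T2 by rewrite le_max lexx.
have T2B : B2 + 1 <= T2 by rewrite le_max lexx orbT.
exists (T1 + T2 + 2); first by lra.
move=> T f P k g tm M gl rough top.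
have gc := qh_curve_continuous M gl.
have fl s t : f (g t) <= f (g s) + `|s - t|.
  by rewrite (le_trans (qh_lipschitz M (g s) (g t)))// lerD2l.
pose argmax s c := [/\ 0 <= c, c <= s & forall u, 0 <= u <= s -> f (g u) <= f (g c)].
(* The curve ends at its top, so it regains the running maximum reached at [c]. Up to [s2], within 1
   of the first return time after [s], it exceeds this height by at most 1; [qh_level] then bounds
   the duration, hence the dip. *)
have nodip s c : s <= tm -> argmax s c -> f (g c) <= f (g s) + T1.
  move=> stm [c0 cs cmax].
  pose E := [set u | s <= u <= tm /\ f (g c) <= f (g u)].
  have Etm : E tm by split; [rewrite stm lexx|apply: top; rewrite c0 (le_trans cs)].
  have hE : has_inf E by split; [exists tm|exists s => u [/andP[]]].
  have [s2 [/andP[ss2 s2tm] fs2] s2lt] := inf_adherent (@ltr01 R) hE.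
  have s2c : s2 - c <= B1.
    apply: (lev1 _ _ _ _ g c s2 (f (g c) + 1) M) => //; last 2 first.
    - lra.
    - lra.
    - exact: le_trans ss2.
    - by apply: rough => //; apply: le_trans ss2.
    move=> u /andP[cu us2].
    have [us|su] := leP u s.
      by rewrite (le_trans (cmax u _)) ?us ?(le_trans c0)// lerDl.
    have [us1|su1] := leP (u - 1) s.
      have := fl s u; have := cmax s; rewrite lexx (le_trans c0 cs) => /(_ isT).
      by rewrite distrC ger0_norm; lra.
    have u1 : f (g (u - 1)) < f (g c).
      rewrite ltNge; apply/negP => H.
      have : inf E <= u - 1 by apply: ge_inf; [exact: hE.2|split => //; lra].
      lra.
    have := fl (u - 1) u.
    rewrite (_ : u - 1 - u = - 1); last by lra.
    rewrite normrN1; lra.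
  have : f (g c) <= f (g s) + (s - c).
    by have := fl s c; rewrite ger0_norm ?subr_ge0.
  have : B1 <= T1 by rewrite le_max lexx orbT.
  lra.
(* Otherwise the curve would stay at one level from [c'] to [s] for longer than [qh_level] allows.
   The tolerance contains [T1] because [g s] may lie that far below the running maximum. *)
have grow s c c' : T2 <= s -> s <= tm -> argmax s c -> argmax (s - T2) c' ->
    f (g c') + 1 <= f (g c).
  move=> Ts stm cmax [c'0 c's c'max]; rewrite leNgt; apply/negP => H.
  have : s - c' <= B2.
    apply: (lev2 _ _ _ _ g c' s (f (g c') + 1) M) => //.
    - lra.
    - by apply: rough => //; lra.
    - move=> u /andP[c'u us]; have [_ _ cm] := cmax.
      by rewrite (le_trans (cm u _))// ?(le_trans c'0)// ltW.
    - lra.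
    - have := nodip _ _ stm cmax.
      have [_ _ /(_ c')] := cmax; rewrite c'0 => cm.
      have : f (g c') <= f (g c) by apply: cm; lra.
      lra.
  lra.
(* The gain of 1 in the running maximum over each time [T2] pays for the 1 lost in each use of the
   quasi-ultrametric inequality, so the constant is independent of [n]. *)
have main n : forall s c, 0 <= s -> s <= n.+1%:R * T2 -> s <= tm ->
    argmax s c -> P (g 0) (g s) <= f (g c) + T2 + 2.
  elim: n => [|n IH] s c s0 sn stm cmax; have [c0 cs cm] := cmax;
    have fsc : f (g s) <= f (g c) by apply: cm; rewrite s0 lexx.
    rewrite (qh_sym M); have := qh_lower M (g s) (g 0); have := gl s 0.
    by rewrite subr0 ger0_norm//; lra.
  have [sT|Ts] := leP s T2.
    by apply: IH => //; rewrite (le_trans sT)// ler_peMl ?(le_trans _ T21)// ler1n.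
  have sT0 : 0 <= s - T2 by lra.
  have [c' /andP[c'0 c's] c'max] := continuous_EVT_max gc sT0.
  have c'am : argmax (s - T2) c' by [].
  have gr := grow _ _ _ (ltW Ts) stm cmax c'am.
  rewrite -[2]/(1 + 1) !addrA; apply: (qh_ultra M (y := g (s - T2))).
    have sn' : s - T2 <= n.+1%:R * T2.
      by move: sn; rewrite -[n.+2%:R]natr1 mulrDl mul1r; lra.
    have := IH _ _ sT0 sn' _ c'am; lra.
  rewrite (qh_sym M); have := qh_lower M (g s) (g (s - T2)).
  have := gl s (s - T2); rewrite opprB addrCA subrr addr0 ger0_norm; lra.
move=> s /andP[s0 stm].
have [c /andP[c0 cs] cm] := continuous_EVT_max gc s0.
have cam : argmax s c by [].
have sT : 0 <= s / T2 by rewrite divr_ge0//; lra.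
have /andP[_ n2] := truncn_itv sT.
have := nodip _ _ stm cam.
have : s <= (Num.trunc (s / T2)).+1%:R * T2 by rewrite -ler_pdivrMr ?ltW//; lra.
by move=> sn; have := main _ _ _ s0 sn stm cam; lra.
Qed.

Lemma qh_rough_geodesic T (f : T -> R) P k x y : qh_model C f P k ->
  exists (L : R) (g : R -> T),
  [/\ 0 <= L <= k x y + 1, g 0 = x, g L = y,
      forall s t, k (g s) (g t) <= `|s - t|
    & forall s t, 0 <= s -> s <= t -> t <= L -> t - s - 1 <= k (g s) (g t)].
Proof.
move=> M; have [L [g [L0 Lk g0 gL gl]]] := qh_geodesic M x y.
exists L, g; split => // [|s t s0 st tL]; first exact/andP.
have := qh_ktri M (g 0) (g s) (g L); have := qh_ktri M (g s) (g t) (g L).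
have := gl 0 s; rewrite sub0r normrN ger0_norm//.
have := gl t L; rewrite distrC ger0_norm ?subr_ge0// g0 gL; lra.
Qed.

(** Takes the place of the stability of geodesics. The curve and its reversal both climb to the
    highest point, so [qh_rise] applies to each half. *)
Lemma qh_morse : exists2 B : R, 0 <= B & forall (T : Type) (f : T -> R)
    (P k : T -> T -> R) (x y : T), qh_model C f P k ->
  exists (L tm : R) (g : R -> T), [/\ [/\ 0 <= tm, tm <= L & L <= k x y + 1],
      [/\ g 0 = x, g L = y & forall s t, k (g s) (g t) <= `|s - t|],
      forall s, 0 <= s <= tm -> P x (g s) <= f (g s) + B,
      forall s, tm <= s <= L -> P y (g s) <= f (g s) + B
    & f (g tm) <= P x y + B].
Proof.
have [B B0 rise] := qh_rise.
pose B' := C * (2 * B + 4 + 1) + 1.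
have B'0 : 0 <= B'.
  by rewrite addr_ge0// mulr_ge0 ?(ltW C0)//; lra.
exists (B + B'); first by rewrite addr_ge0.
move=> T f P k x y M; have [L [g [/andP[L0 Lk] g0 gL gl rough]]] := qh_rough_geodesic x y M.
have gc := qh_curve_continuous M gl.
have [tm /andP[tm0 tmL] top] := continuous_EVT_max gc L0.
have left s : 0 <= s <= tm -> P x (g s) <= f (g s) + B.
  move=> stm; rewrite -g0; apply: (rise _ _ _ _ g tm M) => //.
    by move=> u v u0 uv vt; apply: rough => //; exact: le_trans tmL.
  by move=> u /andP[u0 ut]; apply: top; rewrite u0 (le_trans ut).
have right s : tm <= s <= L -> P y (g s) <= f (g s) + B.
  move=> /andP[tms sL]; pose h u := g (L - u).
  have hl u v : k (h u) (h v) <= `|u - v|.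
    rewrite (le_trans (gl _ _))// distrC.
    by rewrite (_ : L - v - (L - u) = u - v)//; lra.
  have := rise _ _ _ _ h (L - tm) M hl; rewrite /h subr0 gL => H.
  have -> : s = L - (L - s) by lra.
  apply: H => [u v u0 uv vt|u /andP[u0 uL]|]; last by lra.
    have := rough (L - v) (L - u); rewrite (qh_ksym M (g (L - u))) => H.
    by have := H _ _ _; lra.
  by rewrite (_ : L - (L - tm) = tm); [apply: top; lra|lra].
exists L, tm, g; split=> //.
- by move=> s /left; lra.
- by move=> s /right; lra.
(* If the top is higher than [P x y], the points at height [P x y] on its two sides are at bounded
   [k]-distance, and the curve can rise above them only by the length in between. *)
have [h|/ltW h] := leP (f (g tm)) (P x y); first by lra.
have [|s1 /andP[s10 s1t] fs1] := continuous_IVT_incr gc tm0 _ h.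
  by rewrite /= g0 (qh_height M).
have [|s2 /andP[ts2 s2L] fs2] := continuous_IVT_decr gc tmL _ h.
  by rewrite /= gL (qh_height_r M).
rewrite /= in fs1 fs2.
have h1 : P (g s1) x <= P x y + B by have := left s1; rewrite fs1 (qh_sym M) s10; exact.
have h2 : P y (g s2) <= P x y + B by have := right s2; rewrite fs2 ts2; exact.
have h3 : P (g s1) y <= P x y + B + 1 by apply: (qh_ultra M h1); lra.
have h4 : P (g s1) (g s2) <= P x y + B + 1 + 1 by apply: (qh_ultra M h3); lra.
have : k (g s1) (g s2) <= C * (2 * B + 4 + 1).
  by apply: (qh_upper_le M); rewrite fs1 fs2; lra.
have := rough s1 s2 s10 (le_trans s1t ts2) s2L.
have := qh_lipschitz M (g s1) (g tm); have := gl s1 tm.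
rewrite distrC ger0_norm ?subr_ge0// fs1 /B'; lra.
Qed.

(* [z] lies on the vertical segment above [x] and below the top of a geodesic
   from [x] to [y]. *)
Lemma qh_between (c : R) : 0 <= c -> exists2 B : R, 0 <= B &
  forall (T : Type) (f : T -> R) (P k : T -> T -> R) (x y z : T),
  qh_model C f P k ->
  P x z <= f z + c -> f z <= P x y + c -> k x z + k z y <= k x y + B.
Proof.
move=> c0; have [B B0 morse] := qh_morse.
pose D := c + B + 1.
have D0 : 0 <= D by rewrite !addr_ge0.
pose E := C * (2 * (c + B + D + 1) + D + 1).
have E0 : 0 <= E by rewrite mulr_ge0 ?(ltW C0)//; lra.
exists (1 + 2 * E); first by lra.
move=> T f P k x y z M Pxz fz.
have [L [tm [g [[tm0 tmL Lk] [g0 gL gl] left right top]]]] := morse _ _ _ _ x y M.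
have gc := qh_curve_continuous M gl.
(* A point of the climb at about the height of [z] is [k]-close to [z], because the scale from [x]
   to either of them is comparable to this height. When [f z] is outside the range of the climb, one
   of its ends has nearly that height. *)
suff [s [/andP[s0 stm] s1 s2]] : exists s, [/\ 0 <= s <= tm,
    f z <= f (g s) + D & f (g s) <= f z + D].
  have h1 : P x (g s) <= f z + B + D by have := left s; rewrite s0 => /(_ stm); lra.
  have h2 : P z (g s) <= f z + c + B + D + 1.
    by apply: (qh_ultra M (y := x)); [rewrite (qh_sym M)|]; lra.
  have kz : k z (g s) <= E by apply: (qh_upper_le M); lra.
  have sL : s <= L by exact: le_trans tmL.
  have := qh_ktri M x (g s) z; have := qh_ktri M z (g s) y.
  rewrite (qh_ksym M (g s) z).
  have := gl 0 s; rewrite sub0r normrN ger0_norm//.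
  have := gl s L; rewrite distrC ger0_norm ?subr_ge0// g0 gL; lra.
have fx : f x <= f z + c by rewrite (le_trans (qh_height M x z)).
have Pxy : P x y <= f (g tm) + B + 1.
  apply: (qh_ultra M (left _ _)); first by rewrite lexx tm0.
  by rewrite (qh_sym M) right// lexx tmL.
have [zx|xz] := leP (f z) (f x).
  by exists 0; rewrite lexx tm0 g0; split => //; rewrite /D; lra.
have [zt|tz] := leP (f z) (f (g tm)); last first.
  by exists tm; rewrite lexx tm0; split => //; rewrite /D; lra.
have [|s sin /= fs] := continuous_IVT_incr gc tm0 _ zt; first by rewrite /= g0 ltW.
by exists s; split => //; rewrite fs; lra.
Qed.

(** The highest point of a rough geodesic plays the role of the branch point of [x] and [y] in a
    tree growing towards infinity. *)
Lemma qh_top : exists2 B : R, 0 <= B & forall (T : Type) (f : T -> R)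
    (P k : T -> T -> R) (x y : T), qh_model C f P k -> exists u,
  [/\ f u <= P x y + B, P x u <= f u + B, P y u <= f u + B
    & P x y <= f u + B].
Proof.
have [B B0 morse] := qh_morse.
exists (B + 1); first by rewrite addr_ge0.
move=> T f P k x y M.
have [L [tm [g [[tm0 tmL Lk] _ left right top]]]] := morse _ _ _ _ x y M.
have h1 : P x (g tm) <= f (g tm) + B by apply: left; rewrite tm0 lexx.
have h2 : P y (g tm) <= f (g tm) + B by apply: right; rewrite tmL lexx.
exists (g tm); split; [lra|lra|lra|].
by rewrite addrA; apply: (qh_ultra M h1); rewrite (qh_sym M).
Qed.

(* Points lying above all points of a given finite set, up to the constant
   [c]: they play the role of the boundary point at infinity. *)
Lemma qh_apex : exists2 B : R, 0 <= B & forall (T : Type) (f : T -> R)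
    (P k : T -> T -> R) (x : T) (N : R), qh_model C f P k -> exists c,
  N <= f c /\ P x c <= f c + B.
Proof.
have [B B0 top] := qh_top.
exists B => // T f P k x N M.
have [y Ny] := qh_unbounded M x (N + B).
have [u [_ h _ h']] := top _ _ _ _ x y M.
by exists u; split => //; lra.
Qed.

Lemma qh_apex_le (T : Type) (f : T -> R) (P k : T -> T -> R) (x y c : T)
    (B : R) : 0 <= B -> qh_model C f P k ->
  P x c <= f c + B -> P x y <= f c -> P y c <= f c + B + 1.
Proof.
move=> B0 M xc xy; apply: (qh_ultra M (y := x)) => //.
by rewrite (qh_sym M); lra.
Qed.

(* The Gromov product of [x] and [y] based at a far apex [c] is the distance
   from [c] to the top of a geodesic from [x] to [y]. *)
Lemma qh_cross (a : R) : 0 <= a -> exists2 B : R, 0 <= B &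
  forall (T : Type) (f : T -> R) (P k : T -> T -> R) (x y z c : T),
  qh_model C f P k ->
  P x c <= f c + a -> P y c <= f c + a -> P z c <= f c + a ->
  forall tau, tau = gromov_product k c x z - gromov_product k c x y ->
  P x y - P x z <= Order.max tau (tau / C) + B.
Proof.
move=> a0; have [b b0 top] := qh_top.
pose e := 3 * b + a + 3.
have [|D D0 btw] := @qh_between e; first by rewrite /e; lra.
have e0 : 0 <= e by rewrite /e; lra.
exists (8 * b + 3 + 3 * D); first by lra.
move=> T f P k x y z c M xc yc zc tau tauE.
have far p q : P p c <= f c + a -> P q c <= f c + a -> P p q <= f c + a + 1.
  by move=> pc qc; apply: (qh_ultra M pc); rewrite (qh_sym M).
(* [u] is almost between any two of [p], [q] and [c]: it is a centre of this triangle, so the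
   product is its distance to [c]. *)
have topP p q u : P p c <= f c + a -> P q c <= f c + a ->
    f u <= P p q + b -> P p u <= f u + b -> P q u <= f u + b ->
    k u c <= gromov_product k c p q + D /\ gromov_product k c p q <= k u c + D.
  move=> pc qc fu pu qu; have pq := far _ _ pc qc.
  have h1 : k p u + k u c <= k p c + D.
    apply: (btw _ f P) => //; first by rewrite /e; lra.
    by have := qh_height_r M p c; rewrite /e; lra.
  have h2 : k q u + k u c <= k q c + D.
    apply: (btw _ f P) => //; first by rewrite /e; lra.
    by have := qh_height_r M q c; rewrite /e; lra.
  have h3 : k p u + k u q <= k p q + D.
    by apply: (btw _ f P) => //; rewrite /e; lra.
  have := qh_ktri M p u c; have := qh_ktri M q u c; have := qh_ktri M p u q.
  rewrite (qh_ksym M q u) in h2 *.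
  by rewrite /gromov_product; split; lra.
have [u [u1 u2 u3 u4]] := top _ _ _ _ x y M.
have [v [v1 v2 v3 v4]] := top _ _ _ _ x z M.
have [gu1 gu2] := topP _ _ _ xc yc u1 u2 u3.
have [gv1 gv2] := topP _ _ _ xc zc v1 v2 v3.
have vx : P v x <= f v + b by rewrite (qh_sym M).
have ux : P u x <= f u + b by rewrite (qh_sym M).
(* In the first case [v] lies below [u], and the height difference bounds [k v u] from below: slope
   1. In the second [u] lies below [v], and the estimate rests on the upper bound for [k u v], with
   its factor [C]: slope [1 / C]. *)
have [le|/ltW le] := leP (P x z) (P x y).
  have vu : P v u <= f u + b + b + b + 1 by apply: (qh_ultra M (y := x)); lra.
  have xy := far _ _ xc yc; have := qh_height_r M v c => fcv.
  have h : k v u + k u c <= k v c + D.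
    by apply: (btw _ f P) => //; rewrite /e; lra.
  have := qh_lipschitz M v u => lip.
  have : P x y - P x z <= tau + 2 * b + 3 * D by rewrite tauE; lra.
  have : tau <= Order.max tau (tau / C) by rewrite le_max lexx.
  move: (Order.max tau _) => m; lra.
have uv : P u v <= f v + b + b + b + 1 by apply: (qh_ultra M (y := x)); lra.
have : k u v <= C * (P x z - P x y + 8 * b + 2 + 1).
  by apply: (qh_upper_le M); lra.
have := qh_ktri M u v c => ktri kuv.
have : P x y - P x z - 8 * b - 3 - 2 * D <= tau / C.
  rewrite ler_pdivlMr// mulrC.
  have : 2 * D <= C * (2 * D) by rewrite ler_peMl//; lra.
  rewrite tauE; lra.
have : tau / C <= Order.max tau (tau / C) by rewrite le_max lexx orbT.
move: (Order.max tau _) => m; lra.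
Qed.

End qh_model_theory.

(** * From products at an apex to products at any base point *)

Section qh_model_hyperbolic.
Variables (R : realType) (C : R).
Hypothesis C1 : 1 <= C.

Let C0 : 0 < C. Proof. exact: lt_le_trans C1. Qed.

(** Inverts the two slopes: a positive gap between scales passes to the products unchanged, a
    negative one is amplified by at most [C]. *)
Lemma max_divr_le (tau mu : R) : mu <= Order.max tau (tau / C) ->
  (0 <= mu -> mu <= tau) /\ (mu <= 0 -> C * mu <= tau).
Proof.
rewrite le_max => /orP[h|].
  by split => // mu0; rewrite (le_trans _ h)// ler_neMl.
rewrite ler_pdivlMr// mulrC => h; split => mu0 //.
by rewrite (le_trans _ h)// ler_peMl.
Qed.

Lemma qh_apex4 : exists2 a : R, 0 <= a & forall (T : Type) (f : T -> R)
    (P k : T -> T -> R) (x y z w : T), qh_model C f P k -> exists c,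
  [/\ P x c <= f c + a, P y c <= f c + a, P z c <= f c + a
    & P w c <= f c + a].
Proof.
have [B B0 apex] := qh_apex C1; exists (B + 1); first by rewrite addr_ge0.
move=> T f P k x y z w M.
have [c [h1 h2]] := apex _ _ _ _ x (Order.max (P x y) (Order.max (P x z) (P x w))) M.
exists c; move: h1; rewrite !ge_max => /andP[hy /andP[hz hw]].
by split; rewrite ?addrA; [lra|exact: (qh_apex_le B0 M h2)..].
Qed.

Lemma qh_cross_gap (a : R) : 0 <= a -> exists2 B : R, 0 <= B &
  forall (T : Type) (f : T -> R) (P k : T -> T -> R) (x y z c : T) (m : R),
  qh_model C f P k ->
  P x c <= f c + a -> P y c <= f c + a -> P z c <= f c + a ->
  m + B <= P x y - P x z ->
  (0 <= m -> m <= gromov_product k c x z - gromov_product k c x y) /\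
  (m <= 0 -> C * m <= gromov_product k c x z - gromov_product k c x y).
Proof.
move=> a0; have [B B0 cr] := qh_cross C1 a0; exists B => //.
move=> T f P k x y z c m M xc yc zc mB; apply: max_divr_le.
by have := cr _ _ _ _ _ _ _ _ M xc yc zc _ erefl; lra.
Qed.

(** A product at [w] becomes two differences of products at [c], each of pairs with a common point;
    this is the form that [qh_cross] controls when [c] is an apex. *)
Lemma gromov_product_change (T : Type) (k : T -> T -> R) (c w x y : T) :
  is_metric_on [set: T] k ->
  gromov_product k w x y =
  gromov_product k c x y - gromov_product k c x w +
  (gromov_product k c w w - gromov_product k c w y).
Proof.
move=> [_ /(_ w w I I)[_ /(_ erefl) kww] /(_ w y I I) kwy _].
by rewrite /gromov_product kww kwy; lra.
Qed.

(** The arithmetic by which hyperbolicity at one base point passes to all others with twice the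
    constant. *)
Lemma four_point_of_three (d xy xz xw yz yw zw : R) :
  Order.min xz yz - d <= xy -> Order.min xw yw - d <= xy ->
  Order.min xz xw - d <= zw -> Order.min yz yw - d <= zw ->
  Order.min (xz + yw) (yz + xw) - 2 * d <= xy + zw.
Proof.
rewrite !lerBlDr !ge_min.
move=> /orP[h1|h1] /orP[h2|h2] /orP[h3|h3] /orP[h4|h4];
  have [le|lt] := leP (xz + yw) (yz + xw);
  apply/orP; solve [left; lra | right; lra].
Qed.

Theorem qh_hyperbolic : exists d : R, forall (T : Type) (f : T -> R)
    (P k : T -> T -> R), qh_model C f P k -> delta_hyperbolic k d.
Proof.
have [a a0 apex] := qh_apex4; have [B B0 cr] := qh_cross_gap a0.
have d0 : 0 <= C * (1 + B) by rewrite mulr_ge0 ?(ltW C0)//; lra.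
exists (2 * (C * (1 + B))) => T f P k M; split; [exact: (qh_metric M)|lra|].
move=> x y z w; have [c [xc yc zc wc]] := apex _ _ _ _ x y z w M.
pose G := gromov_product k c.
have Gsym p q : G p q = G q p.
  by rewrite /G /gromov_product (qh_ksym M p q); lra.
(* Hyperbolicity at the apex: the quasi-ultrametric inequality bounds a gap between scales below by
   [- 1], and a negative gap costs the factor [C]. *)
have hG p q r : P p c <= f c + a -> P q c <= f c + a -> P r c <= f c + a ->
    Order.min (G p r) (G r q) - C * (1 + B) <= G p q.
  move=> pc qc rc; rewrite lerBlDr ge_min.
  have := qh_quasi_ultrametric M r p q; have m0 : - (1 + B) <= 0 by lra.
  rewrite -lerBlDr le_max => /orP[h|h]; apply/orP; [left|right].
    have [|_ /(_ m0)] := cr _ _ _ _ p r q c (- (1 + B)) M pc rc qc; first by lra.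
    by rewrite /G; lra.
  have [|_ /(_ m0)] := cr _ _ _ _ q r p c (- (1 + B)) M qc rc pc.
    by rewrite (qh_sym M q r) (qh_sym M q p); lra.
  by rewrite -/(G q p) -/(G q r) (Gsym q p) (Gsym q r); lra.
have := hG z w y zc wc yc; have := hG z w x zc wc xc.
rewrite (Gsym z x) (Gsym z y) => h3 h4.
have h1 := hG x y z xc yc zc; have h2 := hG x y w xc yc wc.
rewrite (Gsym z y) in h1; rewrite (Gsym w y) in h2.
have := four_point_of_three h1 h2 h3 h4.
rewrite !(gromov_product_change c w _ _ (qh_metric M)) -!/(G _ _).
rewrite !(Gsym w) (Gsym z y) !lerBlDr !ge_min => /orP[h|h]; apply/orP; [left|right]; lra.
Qed.

(** [P x w + P y w - P x y] is twice the Gromov product formed with [P]. It tends to infinity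
    together with the one formed with [k], which translates between [k]-products and
    [d]-convergence. The thresholds may depend on the space and on [w], as they serve only to find
    indices and neighbourhoods. *)
Lemma qh_product_large (T : Type) (f : T -> R) (P k : T -> T -> R) (w : T)
    (N : R) : qh_model C f P k ->
  (exists t, forall x y, t <= P x w + P y w - P x y ->
                         N <= gromov_product k w x y) /\
  (exists t, forall x y, t <= gromov_product k w x y ->
                         N <= P x w + P y w - P x y).
Proof.
move=> M; have [a a0 apex] := qh_apex4; have [B B0 cr] := qh_cross_gap a0.
have [B' B'0 cr'] := qh_cross C1 a0.
have d0 : 0 <= C * (1 + B) by rewrite mulr_ge0 ?(ltW C0)//; lra.
pose N' := `|N| + C * (1 + B).
have N'0 : 0 <= N' by rewrite addr_ge0.
have NN := ler_norm N.
have m0 : - (1 + B) <= 0 by lra.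
have Pww := qh_diag M w; have fw := ler_norm (f w).
have ksym p q : gromov_product k w p q = gromov_product k w q p.
  by rewrite /gromov_product (qh_ksym M p q); lra.
split.
  exists (2 * (N' + B) + `|f w| + 2).
  suff H x y : P y w <= P x w ->
      2 * (N' + B) + `|f w| + 2 <= P x w + P y w - P x y ->
      N <= gromov_product k w x y.
    move=> x y h; have [yx|/ltW xy] := leP (P y w) (P x w); first exact: H.
    by rewrite ksym; apply: H => //; rewrite (qh_sym M y x); lra.
  move=> yx h; have [c [xc yc _ wc]] := apex _ _ _ _ x y y w M.
  rewrite (gromov_product_change c _ _ _ (qh_metric M)).
  have h1 : P x y <= P x w + 1.
    by apply: (qh_ultra M (y := w)) => //; rewrite (qh_sym M).
  have h2 := qh_height M w y.
  rewrite (qh_sym M y w) in yx h.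
  have [|_ /(_ m0) g1] := cr _ _ _ _ x w y c (- (1 + B)) M xc wc yc.
    by lra.
  have [|_ /(_ m0) g2] := cr _ _ _ _ w y w c (- (1 + B)) M wc yc wc.
    by lra.
  (* Up to the bounded term [P w w] the quantity is [(P x w - P x y) + (P w y - P w w)]. One of the
     two differences is large, and the other one is bounded below. *)
  have [l1|l1] := leP (N' + B) (P x w - P x y).
    have [/(_ N'0) g _] := cr _ _ _ _ x w y c N' M xc wc yc l1.
    by rewrite /N' in g; lra.
  have [|/(_ N'0) g _] := cr _ _ _ _ w y w c N' M wc yc wc; first by lra.
  by rewrite /N' in g; lra.
pose t := 2 * (C * (`|N| + B' + `|f w| + 1)).
have t0 : 0 <= t by rewrite !mulr_ge0 ?(ltW C0)// !addr_ge0.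
have maxC tau : t / 2 <= tau ->
    Order.max (- tau) ((- tau) / C) <= - (`|N| + B' + `|f w| + 1).
  have D0 : 0 <= `|N| + B' + `|f w| + 1 by rewrite !addr_ge0.
  rewrite (_ : t / 2 = C * (`|N| + B' + `|f w| + 1)) => [h|]; last by rewrite /t; lra.
  rewrite ge_max; apply/andP; split.
    by rewrite lerN2 (le_trans _ h)// ler_peMl.
  by rewrite mulNr lerN2 ler_pdivlMr// mulrC.
have fw' : - f w <= `|f w| by rewrite -normrN ler_norm.
exists t => x y txy.
(* One of the two differences of products at [c] is at least [t / 2]: the first yields the claim,
   the second puts [y'] far from [w]. If both points are far, the quasi-ultrametric inequality
   concludes. *)
have far x' y' : t <= gromov_product k w x' y' ->
    N <= P x' w + P y' w - P x' y' \/ f w + `|N| + 1 + `|f w| <= P w y'.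
  move=> h; have [c [xc yc _ wc]] := apex _ _ _ _ x' y' y' w M.
  move: h; rewrite (gromov_product_change c _ _ _ (qh_metric M)).
  set t1 := _ - _; set t2 := (X in _ + X) => h.
  have [h1|h1] := leP (t / 2) t1; [left|right].
    have := cr' _ _ _ _ x' y' w c M xc yc wc (- t1) _; rewrite /t1 opprB.
    move=> /(_ erefl); have := maxC _ h1; rewrite /t1 opprB.
    by have := qh_height_r M y' w; lra.
  have /maxC mt2 : t / 2 <= t2 by lra.
  have := cr' _ _ _ _ w w y' c M wc wc yc (- t2) _; rewrite /t2 opprB.
  move=> /(_ erefl); move: mt2; rewrite /t2 opprB.
  by have := qh_height M w w; lra.
have [//|hy] := far _ _ txy; have [|h|hx] := far y x; first by rewrite ksym.
  by move: h; rewrite (qh_sym M y x); lra.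
have := qh_quasi_ultrametric M w x y.
rewrite -lerBlDr le_max (qh_sym M x w) (qh_sym M y w) => /orP[]; lra.
Qed.

End qh_model_hyperbolic.

(** * Uniform spaces as models *)

Section uniform_model.
Variables (R : realType) (X : metricType R) (Xb : completion X) (A : R).
Hypotheses (A1 : 1 <= A) (unb : ~ metric_bounded [set: X])
  (lc : locally_complete X) (unif : uniform_space Xb A).
Local Notation r := (dist_boundary Xb).
Local Notation k := (quasihyperbolic Xb).

Definition qh_height_of (x : X) : R := ln (r x).
(** The terms [r x + r y] make the scale of a pair at least the height of either point, and leave
    its exponential subadditive. *)
Definition qh_scale (x y : X) : R := ln (mdist x y + r x + r y).
Local Notation f := qh_height_of.
Local Notation P := qh_scale.

Let incomplete := uniform_incomplete unif.
Let rc := uniform_rectifiably_connected unif.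
Let r0 x : 0 < r x. Proof. exact: dist_boundary_gt0. Qed.

Let p0 x y : 0 < mdist x y + r x + r y.
Proof. by rewrite ltr_wpDl// addr_ge0 ?mdist_ge0// ltW. Qed.

Lemma qh_scaleE x y : expR (P x y) = mdist x y + r x + r y.
Proof. by rewrite /P lnK// posrE. Qed.

(* On the first half of a uniform curve starting at [x] one has both
   [r x - u <= r (h u)] and [u <= A * r (h u)]. *)
Lemma uniform_half_length (h : R -> X) (a b : R) : lipschitz1_curve h -> a <= b ->
  (forall u, a <= u <= b -> u - a <= A * r (h u)) ->
  segment_integral (qh_density Xb h) a b <= 3 * A * ln (1 + (b - a) / r (h a)).
Proof.
have A1' := A1; move=> hl ab H.
apply: segment_integral_le_ln => //; first exact: qh_density_continuous.
  by rewrite mulr_ge0//; lra.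
move=> u /andP[au ub]; have rx := r0 (h a); have ru := r0 (h u).
have u0 : 0 <= u - a by rewrite subr_ge0.
rewrite /qh_density ler_pdivlMr ?ltr_wpDr// ler_pdivrMl//.
have := H u; rewrite au => /(_ ub) h1.
have := dist_boundary_lipschitz incomplete (h a) (h u).
have := hl a u; rewrite distrC ger0_norm// => h2 h3.
(* Close to the start, [r (h u)] is at least [r (h a) / 2]; further on, [u - a <= A * r (h u)]
   dominates. Either way [r (h a) + (u - a) <= 3 * A * r (h u)], the origin of [3 * A]. *)
have [ux|xu] := leP (u - a) (r (h a) / 2); nra.
Qed.

(** The curve is cut at half its length, where the minimum in the uniformity condition changes
    sides; each half is measured from its own end. *)
Lemma quasihyperbolic_uniform_le x y :
  k x y <= 3 * A * (2 * P x y - f x - f y + 2 * ln A).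
Proof.
have A1' := A1.
have [a [b [g [gr glen gmin]]]] := uniform_curves unif x y.
have [h [l [[l0 hl h0 hL lE] _ hP _]]] := arclength_reparametrization incomplete lc gr.
have lA : l <= A * mdist x y by rewrite -lee_fin -lE.
have minr u : 0 <= u <= l -> Order.min u (l - u) <= A * r (h u).
  move=> /hP[t tab [-> t1 t2]]; have := gmin t tab; rewrite t1 t2.
  by rewrite -EFin_min lee_fin.
have l20 : 0 <= l / 2 by rewrite divr_ge0.
have l2l : l / 2 <= l by lra.
have hc := qh_density_continuous incomplete lc hl.
have := quasihyperbolic_le incomplete lc rc hl l0; rewrite h0 hL => /le_trans; apply.
rewrite (segment_integralD hc l20 l2l).
have b1 : segment_integral (qh_density Xb h) 0 (l / 2) <= 3 * A * ln (1 + l / 2 / r x).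
  rewrite -h0 -{2}[l / 2]subr0; apply: uniform_half_length => // u /andP[u0 ul].
  have := minr u; rewrite u0 (le_trans ul l2l) => /(_ isT).
  by rewrite (min_idPl _)//; lra.
have b2 : segment_integral (qh_density Xb h) (l / 2) l <= 3 * A * ln (1 + l / 2 / r y).
  have hl' : lipschitz1_curve (h \o -%R).
    by move=> s t; rewrite (le_trans (hl _ _))// -opprD normrN.
  have lNl2 : - l <= - (l / 2) by rewrite lerN2.
  have := uniform_half_length hl' lNl2; rewrite /= opprK hL.
  have -> : - (l / 2) + l = l / 2 by lra.
  have -> : qh_density Xb (h \o -%R) = qh_density Xb h \o -%R by [].
  rewrite -segment_integralN// !opprK; apply => u /andP[u0 ul].
  have := minr (- u); rewrite (min_idPr _); last by lra.
  by rewrite (addrC u) opprK; apply; lra.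
have lnb z : r z + l / 2 <= A * (mdist x y + r x + r y) ->
    ln (1 + l / 2 / r z) <= ln A + P x y - f z.
  move=> H; have Apos : 0 < A by lra.
  rewrite /P /f -lnM ?posrE// -ln_div ?posrE ?mulr_gt0//.
  rewrite ler_ln ?posrE ?divr_gt0 ?mulr_gt0//; last first.
    by rewrite ltr_wpDr// divr_ge0// ltW.
  rewrite ler_pdivlMr// mulrDl mul1r divfK ?gt_eqF//.
have d0 := mdist_ge0 x y; have rx := r0 x; have ry := r0 y.
have hx := lnb x _; have hy := lnb y _.
have A3 : 0 <= 3 * A by lra.
have -> : 3 * A * (2 * P x y - f x - f y + 2 * ln A) =
   3 * A * (ln A + P x y - f x) + 3 * A * (ln A + P x y - f y) by ring.
rewrite lerD//.
  by rewrite (le_trans b1)// ler_wpM2l// hx//; nra.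
by rewrite (le_trans b2)// ler_wpM2l// hy//; nra.
Qed.

Lemma uniform_constant_ge1 : 1 <= 3 * A * (1 + 2 * ln A).
Proof. by have A1' := A1; have := ln_ge0 A1; nra. Qed.

Lemma uniform_qh_model : qh_model (3 * A * (1 + 2 * ln A)) f P k.
Proof.
have A1' := A1; have lnA := ln_ge0 A1.
have P_sym x y : P x y = P y x.
  by rewrite /P metric_sym; congr ln; ring.
have fP x y : f x <= P x y.
  by rewrite ler_ln ?posrE// -addrA addrCA lerDl addr_ge0 ?mdist_ge0// ltW.
have lnE x y : f x + ln (1 + mdist x y / r x) = ln (r x + mdist x y).
  rewrite -lnM ?posrE//; last by rewrite ltr_wpDr// divr_ge0 ?mdist_ge0// ltW.
  by rewrite mulrDr mulr1 mulrCA divff ?mulr1// gt_eqF.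
have rd x y : 0 < r x + mdist x y by rewrite ltr_wpDr// mdist_ge0.
split => //.
- exact: quasihyperbolic_metric.
- move=> x y z; rewrite !qh_scaleE; have := metric_triangle x y z.
  have := r0 y; lra.
- move=> x y; apply: le_trans (lerD (lexx (f x)) (quasihyperbolic_ge_ln incomplete lc rc x y)).
  by rewrite lnE ler_ln ?posrE// metric_sym dist_boundary_lipschitz.
(* The additive 1 covers a factor 2, needed because [r y <= r x + mdist x y]. *)
- move=> x y; apply: le_trans (lerD (lerD (lexx (f x))
    (quasihyperbolic_ge_ln incomplete lc rc x y)) (lexx 1)).
  rewrite lnE -[X in _ + X](expRK 1) -lnM ?posrE ?expR_gt0//.
  rewrite ler_ln ?posrE ?mulr_gt0 ?expR_gt0//.
  have e2 : 1 + 1 <= expR 1 :> R by exact: expR_ge1Dx.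
  have := dist_boundary_lipschitz incomplete y x; rewrite metric_sym.
  have := rd x y; nra.
(* As [2 * P x y - f x - f y] is nonnegative, the additive [2 * ln A] is absorbed into the factor;
   this is the origin of the constant. *)
- move=> x y; apply: le_trans (quasihyperbolic_uniform_le x y) _.
  have Q0 : 0 <= 2 * P x y - f x - f y.
    by have := fP x y; have := fP y x; rewrite P_sym; lra.
  rewrite -subr_ge0.
  have -> : 3 * A * (1 + 2 * ln A) * (2 * P x y - f x - f y + 1) -
    3 * A * (2 * P x y - f x - f y + 2 * ln A) =
    3 * A * (1 + 2 * ln A * (2 * P x y - f x - f y)) by ring.
  by rewrite mulr_ge0 ?addr_ge0 ?mulr_ge0//; lra.
- exact: quasihyperbolic_geodesic.
- move=> x M; apply: contrapT => /forallNP H; apply: unb.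
  exists (2 * expR M) => y z _ _.
  have bd w : mdist x w <= expR M.
    have := H w; rewrite -ler_expR qh_scaleE => /negP; rewrite -ltNge.
    have := r0 x; have := r0 w; lra.
  have := metric_triangle y x z; rewrite (metric_sym y x).
  have := bd y; have := bd z; lra.
Qed.

End uniform_model.

(** * Chain metrics and quasisymmetry *)

(* Frink's lemma. The chain is cut at the first index where the partial sums
   exceed half of the total, so that both remaining parts carry at most half. *)
Lemma frink_chain (R : realType) (K : R) (n : nat) (e : nat -> nat -> R) :
  1 <= K -> K ^+ 2 <= 2 ->
  (forall i j, (i <= n)%N -> (j <= n)%N -> 0 <= e i j) ->
  (forall i, (i <= n)%N -> e i i = 0) ->
  (forall i j l, (i <= n)%N -> (j <= n)%N -> (l <= n)%N ->
    e i l <= K * Order.max (e i j) (e j l)) ->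
  e 0%N n <= 2 * \sum_(0 <= i < n) e i i.+1.
Proof.
move=> K1 K2 e0 ee ultra.
pose S a b := \sum_(a <= i < b) e i i.+1.
have S0 a b : (b <= n)%N -> 0 <= S a b.
  move=> bn; rewrite /S big_nat_cond sumr_ge0// => i /andP[/andP[_ ib] _].
  by rewrite e0// (leq_trans _ bn)// ltnW.
suff main m a b : (b <= a + m)%N -> (a <= b)%N -> (b <= n)%N -> e a b <= 2 * S a b.
  by apply: (main n) => //; rewrite add0n.
elim: m a b => [|m IH] a b bam ab bn.
  have -> : a = b by apply/eqP; rewrite eqn_leq ab -[a]addn0.
  by rewrite ee// /S big_geq// mulr0.
move: ab; rewrite leq_eqVlt => /predU1P[->|ab].
  by rewrite ee// /S big_geq// mulr0.
set s := S a b; have s0 : 0 <= s by exact: S0.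
(* The alternative [b <= p.+1] admits the last edge, so that such a [p] exists even when the total
   is 0. *)
pose Q p := [&& (a <= p)%N, (p < b)%N & (b <= p.+1)%N || (s / 2 < S a p.+1)].
have exQ : exists p, Q p.
  exists b.-1; rewrite /Q prednK ?(leq_ltn_trans _ ab)// leqnn/= andbT.
  by rewrite -ltnS prednK ?(leq_ltn_trans _ ab)// ab.
have [p /and3P[ap pb Qp] pmin] := ex_minnP exQ.
have split_ c : (a <= c)%N -> (c <= b)%N -> s = S a c + S c b.
  by move=> ac cb; rewrite /s /S (big_cat_nat ac cb).
have pn : (p <= n)%N by rewrite (leq_trans _ bn)// ltnW.
have p1n : (p.+1 <= n)%N by rewrite (leq_trans _ bn).
have left : S a p <= s / 2.
  move: ap; rewrite leq_eqVlt => /predU1P[<-|ap].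
    by rewrite {1}/S big_geq// divr_ge0.
  rewrite leNgt; apply/negP => h.
  have pE : p.-1.+1 = p by rewrite prednK// (leq_ltn_trans _ ap).
  have /pmin : Q p.-1.
    apply/and3P; rewrite pE; split; last by rewrite h orbT.
      by rewrite -ltnS pE.
    exact: ltnW.
  by rewrite -{1}pE ltnn.
have right : S p.+1 b <= s / 2.
  have [bp|pb'] := leqP b p.+1; first by rewrite {1}/S big_geq// divr_ge0.
  move: Qp; rewrite leqNgt pb'/= => h.
  have := split_ p.+1 (leqW ap) pb; lra.
have mid : e p p.+1 <= s.
  have h1 := split_ p.+1 (leqW ap) pb.
  have h2 : S a p.+1 = S a p + e p p.+1 by rewrite /S big_nat_recr.
  have := S0 a p pn; have := S0 p.+1 b bn; lra.
have e1 : e a p <= s.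
  by have := IH a p _ ap pn; rewrite -ltnS -addnS (leq_trans pb bam) => /(_ isT); lra.
have e2 : e p.+1 b <= s.
  have := IH p.+1 b _ pb bn; rewrite addSnnS (leq_trans bam) ?leq_add2r// => /(_ isT).
  lra.
have an : (a <= n)%N by rewrite (leq_trans _ bn)// ltnW.
have e3 : e p b <= K * s.
  apply: (le_trans (ultra p p.+1 b pn p1n bn)).
  by rewrite ler_wpM2l ?(le_trans ler01)// ge_max mid.
(* Three pieces of size at most [s] are joined in two steps, at the cost [K ^+ 2 <= 2]. *)
apply: (le_trans (ultra a p b an pn bn)).
have sK : s <= K * s by rewrite ler_peMl.
apply: (@le_trans _ _ (K * (K * s))).
  by rewrite ler_wpM2l ?(le_trans ler01)// ge_max e3 (le_trans e1 sK).
by rewrite mulrA -expr2 ler_wpM2r.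
Qed.

Section chain_metric.
Variables (R : realType) (T : Type) (D : set T) (rho : T -> T -> R) (K : R).
Hypotheses (K1 : 1 <= K) (K2 : K ^+ 2 <= 2).
Hypothesis rho_ge0 : forall x y, D x -> D y -> 0 <= rho x y.
Hypothesis rho_eq0 : forall x y, D x -> D y -> rho x y = 0 <-> x = y.
Hypothesis rho_sym : forall x y, D x -> D y -> rho x y = rho y x.
Hypothesis rho_ultra : forall x y z, D x -> D y -> D z ->
  rho x z <= K * Order.max (rho x y) (rho y z).

Definition chain_sums (x y : T) : set R := [set l | exists (n : nat) (c : nat -> T),
  [/\ (1 <= n)%N, c 0%N = x, c n = y, forall i, (i <= n)%N -> D (c i)
    & l = \sum_(0 <= i < n) rho (c i) (c i.+1)]].

Lemma chain_sums_ge x y l : chain_sums x y l -> rho x y <= 2 * l.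
Proof.
move=> [n [c [n1 <- <- Dc ->]]].
apply: (@frink_chain R K n (fun i j => rho (c i) (c j)) K1 K2).
- by move=> i j ni nj; apply: rho_ge0; apply: Dc.
- by move=> i ni; apply/rho_eq0 => //; exact: Dc.
- by move=> i j l' ni nj nl; apply: rho_ultra; apply: Dc.
Qed.

Lemma chain_sums_ge0 x y l : chain_sums x y l -> 0 <= l.
Proof.
move=> [n [c [n1 _ _ Dc ->]]]; rewrite big_nat_cond sumr_ge0// => i /andP[/andP[_ ni] _].
by apply: rho_ge0; apply: Dc => //; exact: ltnW.
Qed.

Lemma chain_sums_rho x y : D x -> D y -> chain_sums x y (rho x y).
Proof.
move=> Dx Dy; exists 1%N, (fun i => if i == 0%N then x else y); split => //.
  by move=> i _; case: eqP.
by rewrite big_nat1.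
Qed.

Lemma chain_sums_lbound x y : has_lbound (chain_sums x y).
Proof. by exists 0 => l /chain_sums_ge0. Qed.

Lemma chain_sums_sym x y l : chain_sums x y l -> chain_sums y x l.
Proof.
move=> [n [c [n1 c0 cn Dc ->]]]; exists n, (fun i => c (n - i)%N); split => //.
- by rewrite subn0.
- by rewrite subnn.
- by move=> i _; apply: Dc; exact: leq_subr.
rewrite big_nat_rev; apply: eq_big_nat => i /andP[_ ni]; rewrite add0n.
rewrite -subSn// subSS rho_sym//; first by apply: Dc; exact: leq_subr.
by apply: Dc; exact: leq_subr.
Qed.

Lemma chain_sums_cat x y z l l' : chain_sums x y l -> chain_sums y z l' ->
  chain_sums x z (l + l').
Proof.
move=> [n [c [n1 c0 cn Dc ->]]] [n' [c' [n1' c0' cn' Dc' ->]]].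
exists (n + n')%N, (fun i => if (i <= n)%N then c i else c' (i - n)%N).
have cE i : (n <= i)%N -> (if (i <= n)%N then c i else c' (i - n)%N) = c' (i - n)%N.
  move=> ni; case: ifP => // ni'.
  by have -> : i = n; [apply/eqP; rewrite eqn_leq ni'|rewrite cn subnn c0'].
split => //.
- by rewrite addn_gt0 n1.
- by rewrite cE ?leq_addr// addKn.
- by move=> i ni; case: ifP => [/Dc//|_]; apply: Dc'; rewrite leq_subLR.
rewrite (big_cat_nat (leq0n n) (leq_addr _ _))/=; congr (_ + _).
  by apply: eq_big_nat => i /andP[_ ni]; rewrite (ltnW ni) ni.
rewrite -[index_iota n _]/(index_iota (0 + n) _) big_addn addKn; apply: eq_big_nat => i _.
by rewrite !cE ?leq_addl// ?(leq_trans (leq_addl i n))// -addSn !addnK.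
Qed.

Lemma chain_inf_le x y : D x -> D y -> inf (chain_sums x y) <= rho x y.
Proof.
by move=> Dx Dy; apply: ge_inf; [exact: chain_sums_lbound|exact: chain_sums_rho].
Qed.

Lemma chain_inf_ge x y : D x -> D y -> rho x y <= 2 * inf (chain_sums x y).
Proof.
move=> Dx Dy; rewrite -ler_pdivrMl//; apply: lb_le_inf.
  by exists (rho x y); exact: chain_sums_rho.
by move=> l /chain_sums_ge; rewrite ler_pdivrMl.
Qed.

Lemma chain_inf_metric : is_metric_on D (fun x y => inf (chain_sums x y)).
Proof.
have ge0 x y : D x -> D y -> 0 <= inf (chain_sums x y).
  by move=> Dx Dy; have := chain_inf_ge Dx Dy; have := rho_ge0 Dx Dy; lra.
have hinf x y : D x -> D y -> has_inf (chain_sums x y).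
  by move=> Dx Dy; split; [exists (rho x y); exact: chain_sums_rho|exact: chain_sums_lbound].
split=> [//|x y Dx Dy|x y Dx Dy|x y z Dx Dy Dz].
- split=> [i0|xy].
    apply/rho_eq0 => //; have := chain_inf_ge Dx Dy; have := rho_ge0 Dx Dy.
    by rewrite i0; lra.
  have := chain_inf_le Dx Dy; rewrite (rho_eq0 Dx Dy).2// => h.
  by apply/le_anti; rewrite h ge0.
- congr inf; apply/seteqP; split => l; exact: chain_sums_sym.
apply/ler_addgt0Pr => e e0; have e20 : 0 < e / 2 by rewrite divr_gt0.
have [l1 h1 l1e] := inf_adherent e20 (hinf _ _ Dx Dy).
have [l2 h2 l2e] := inf_adherent e20 (hinf _ _ Dy Dz).
have : inf (chain_sums x z) <= l1 + l2.
  by apply: ge_inf; [exact: chain_sums_lbound|exact: chain_sums_cat h1 h2].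
lra.
Qed.

End chain_metric.

(** * Quasisymmetric bijections and power gauges *)

Section quasisymmetric_homeomorphism.
Variables (R : realType) (T T' : Type) (D : set T) (D' : set T')
  (s : T -> T -> R) (s' : T' -> T' -> R) (eta : R -> R) (f : T -> T').

(** Continuity of [f] and of its inverse comes from testing the distortion inequality against a
    fixed third point [z], with [t] tending to 0 for [f] and [t = s x z / e] for the inverse. The
    cases without such a point are trivial. *)
Lemma quasisymmetric_of_bij : homeomorphism_halfline eta -> eta 0 = 0 ->
  is_metric_on D s -> is_metric_on D' s' -> set_bij D D' f ->
  (forall t x y z, 0 < t -> D x -> D y -> D z ->
    s x y <= t * s x z -> s' (f x) (f y) <= eta t * s' (f x) (f z)) ->
  quasisymmetric D D' s s' eta f.
Proof.
move=> [_ etac _] eta0 sm s'm fbij qs.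
have [s_ge0 s_eq0 _ _] := sm; have [s'_ge0 s'_eq0 _ _] := s'm.
have [fD finj _] := fbij.
have Df x : D x -> D' (f x) by move=> Dx; apply: fD.
have pos x z : D x -> D z -> x <> z -> 0 < s x z /\ 0 < s' (f x) (f z).
  move=> Dx Dz xz; have Dfx := Df _ Dx; have Dfz := Df _ Dz.
  rewrite !lt_neqAle s_ge0// s'_ge0// !andbT; split; apply/eqP => /esym.
    by move=> /(s_eq0 _ _ Dx Dz).
  move=> /(s'_eq0 _ _ Dfx Dfz) /finj; rewrite !inE => h; apply: xz; exact: h.
split => //; split => // x Dx e e0; have Dfx := Df _ Dx.
  have [[z [Dz xz]]|alone] := pselect (exists z, D z /\ x <> z); last first.
    exists 1 => // y Dy _; have -> : y = x.
      by apply: contrapT => yx; apply: alone; exists y; split => // /esym.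
    by rewrite (s'_eq0 _ _ Dfx Dfx).2.
  have [sxz s'xz] := pos _ _ Dx Dz xz.
  have [t t0 Ht] := etac 0 (lexx 0) _ (divr_gt0 e0 s'xz).
  exists (t / 2 * s x z); first by rewrite !mulr_gt0.
  move=> y Dy /ltW xy; have t20 : 0 < t / 2 by rewrite divr_gt0.
  apply: (le_lt_trans (qs _ _ _ _ t20 Dx Dy Dz xy)).
  rewrite -ltr_pdivlMr//; have := Ht (t / 2) (ltW t20).
  rewrite eta0 !sub0r !normrN (ger0_norm (ltW t20)).
  have t2t : t / 2 < t by lra.
  by move=> /(_ t2t); apply: le_lt_trans; exact: ler_norm.
have [[z [Dz ez]]|small] := pselect (exists z, D z /\ e <= s x z); last first.
  exists 1 => // y Dy _; rewrite ltNge; apply/negP => ey; apply: small.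
  by exists y.
have xz : x <> z by move=> xz; move: ez; rewrite (s_eq0 _ _ Dx Dz).2// leNgt e0.
have [sxz s'xz] := pos _ _ Dx Dz xz.
pose t := s x z / e; have t0 : 0 < t by rewrite divr_gt0.
have key y : D y -> e <= s x y -> s' (f x) (f z) <= eta t * s' (f x) (f y).
  move=> Dy ey; apply: qs => //; rewrite /t mulrAC ler_pdivlMr//.
  by rewrite ler_pM2l.
have etat : 0 < eta t.
  by have := lt_le_trans s'xz (key z Dz ez); rewrite pmulr_lgt0.
exists (s' (f x) (f z) / eta t); first by rewrite divr_gt0.
move=> y Dy h; rewrite ltNge; apply/negP => /(key y Dy).
by move: h; rewrite ltr_pdivlMr// mulrC => h; rewrite leNgt h.
Qed.

End quasisymmetric_homeomorphism.

Section power_gauge.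
Variable R : realType.

Lemma homeomorphism_halfline_mono (eta : R -> R) : eta 0 = 0 ->
  (forall s t, 0 <= s -> s < t -> eta s < eta t) ->
  (forall y, 0 <= y -> exists2 t, 0 <= t & eta t = y) ->
  homeomorphism_halfline eta.
Proof.
move=> eta0 mono surj.
have ge0 t : 0 <= t -> 0 <= eta t.
  by rewrite le_eqVlt => /predU1P[<-|t0]; rewrite ?eta0// -eta0 ltW// mono.
have wmono s t : 0 <= s -> s <= t -> eta s <= eta t.
  by move=> s0; rewrite le_eqVlt => /predU1P[->//|st]; rewrite ltW// mono.
have anti s t : 0 <= t -> eta s < eta t -> s < t.
  by move=> t0 h; rewrite ltNge; apply/negP => /(wmono _ _ t0); rewrite leNgt h.
split.
- split.
  + by move=> t /ge0.
  + move=> s t; rewrite !inE/= => s0 t0 E; apply/eqP; rewrite eq_le !leNgt.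
    by apply/andP; split; apply/negP => h; [have := mono _ _ t0 h|have := mono _ _ s0 h];
      rewrite E ltxx.
  + by move=> y /= y0; have [t t0 <-] := surj y y0; exists t.
- move=> x /= x0 e e0.
  have [b b0 Eb] := surj (eta x + e) (addr_ge0 (ge0 _ x0) (ltW e0)).
  have xb : x < b by apply: anti => //; rewrite Eb ltrDl.
  have [a0|a0] := leP 0 (eta x - e).
    have [a a1 Ea] := surj _ a0.
    have ax : a < x by apply: anti => //; rewrite Ea ltrBlDr ltrDl.
    exists (Order.min (b - x) (x - a)); first by rewrite lt_min !subr_gt0 xb.
    move=> y /= y0; rewrite lt_min !ltr_norml => /andP[/andP[h1 h2] /andP[h3 h4]].
    have : eta y < eta b by apply: mono => //; lra.
    have : eta a < eta y by apply: mono => //; lra.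
    by rewrite Ea Eb; lra.
  exists (b - x); first by rewrite subr_gt0.
  move=> y /= y0; rewrite !ltr_norml => /andP[h1 h2].
  have : eta y < eta b by apply: mono => //; lra.
  by rewrite Eb; have := ge0 y y0; lra.
move=> x /= x0 e e0.
have hb : eta x < eta (x + e) by apply: mono => //; rewrite ltrDl.
have [a0|a0] := leP 0 (x - e).
  have ha : eta (x - e) < eta x by apply: mono => //; rewrite ltrBlDr ltrDl.
  exists (Order.min (eta (x + e) - eta x) (eta x - eta (x - e))).
    by rewrite lt_min !subr_gt0 hb.
  move=> y /= y0; rewrite lt_min !ltr_norml => /andP[/andP[h1 h2] /andP[h3 h4]].
  have : y < x + e by apply: anti; lra.
  have : x - e < y by apply: anti => //; lra.
  lra.
exists (eta (x + e) - eta x); first by rewrite subr_gt0.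
move=> y /= y0; rewrite !ltr_norml => /andP[h1 h2].
have : y < x + e by apply: anti; lra.
lra.
Qed.

(** For [p <= q] the first power governs [t <= 1] and the second [t >= 1]. *)
Definition power_gauge (c p q t : R) : R := c * Order.max (t `^ p) (t `^ q).

Lemma power_gauge0 c p q : 0 < p -> 0 < q -> power_gauge c p q 0 = 0.
Proof. by move=> p0 q0; rewrite /power_gauge !powR0 ?gt_eqF// maxxx mulr0. Qed.

Lemma homeomorphism_power_gauge c p q : 0 < c -> 0 < p -> p <= q ->
  homeomorphism_halfline (power_gauge c p q).
Proof.
move=> c0 p0 pq; have q0 := lt_le_trans p0 pq.
apply: homeomorphism_halfline_mono; first exact: power_gauge0.
  move=> s t s0 st; rewrite /power_gauge ltr_pM2l// lt_max !gt_max.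
  have h r : 0 < r -> s `^ r < t `^ r.
    by move=> r0; apply: gt0_ltr_powR => //; rewrite nnegrE// (le_trans s0 (ltW st)).
  have [le|lt] := leP (s `^ p) (s `^ q).
    by apply/orP; right; rewrite h// (le_lt_trans le)// h.
  by apply/orP; left; rewrite h//= (lt_trans lt)// h.
move=> y y0; pose v := y / c; have v0 : 0 <= v by rewrite divr_ge0// ltW.
have yE : y = c * v by rewrite /v mulrCA divff ?gt_eqF// mulr1.
have [v1|/ltW v1] := leP v 1.
  exists (v `^ p^-1); first exact: powR_ge0.
  rewrite /power_gauge yE; congr (_ * _); rewrite -!powRrM mulVf ?gt_eqF// powRr1//.
  apply/max_idPl; have [->|vn0] := eqVneq v 0.
    by rewrite powR0// gt_eqF// mulr_gt0// invr_gt0.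
  rewrite -[leRHS]powRr1// ger_powR//; first by rewrite lt_neqAle eq_sym vn0 v0.
  by rewrite mulrC ler_pdivlMr// mul1r.
exists (v `^ q^-1); first exact: powR_ge0.
rewrite /power_gauge yE; congr (_ * _); rewrite -!powRrM mulVf ?gt_eqF// powRr1//.
apply/max_idPr; rewrite -[leRHS]powRr1// ler_powR//.
by rewrite mulrC ler_pdivrMr// mul1r.
Qed.

End power_gauge.

(** * The Gromov boundary *)

Section limn_einf_real.
Variable R : realType.
Implicit Types (s : nat -> R) (x : \bar R).

Lemma limn_einfE (s : nat -> \bar R) :
  limn_einf s = ereal_sup (range (einfs s)).
Proof. by rewrite limn_einf_lim; apply: cvg_lim => //; exact: cvg_einfs_sup. Qed.

Lemma lt_limn_einf s (c : R) : (c%:E < limn_einf (fun i => (s i)%:E))%E ->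
  exists N, forall i, (N <= i)%N -> c < s i.
Proof.
rewrite limn_einfE => /ereal_sup_gt[_ [N _ <-]] cN; exists N => i Ni.
rewrite -lte_fin (lt_le_trans cN)//; apply: ereal_inf_lbound.
by exists i.
Qed.

Lemma limn_einf_lt s (c : R) : (limn_einf (fun i => (s i)%:E) < c%:E)%E ->
  forall N, exists2 i, (N <= i)%N & s i < c.
Proof.
move=> lc N; apply: contrapT => H; move: lc; apply/negP; rewrite -leNgt limn_einfE.
apply: le_trans (ereal_sup_ubound _); last by exists N.
apply: le_ereal_inf_tmp => _ [i /= Ni <-]; rewrite lee_fin leNgt; apply/negP => ic.
by apply: H; exists i.
Qed.

Lemma limn_einf_ge s (c : R) N : (forall i, (N <= i)%N -> c <= s i) ->
  (c%:E <= limn_einf (fun i => (s i)%:E))%E.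
Proof.
move=> H; rewrite limn_einfE; apply: le_trans (ereal_sup_ubound _); last by exists N.
by apply: le_ereal_inf_tmp => _ [i /= Ni <-]; rewrite lee_fin H.
Qed.

Lemma limn_einf_le s (c : R) : (forall N, exists2 i, (N <= i)%N & s i <= c) ->
  (limn_einf (fun i => (s i)%:E) <= c%:E)%E.
Proof.
move=> H; rewrite leNgt; apply/negP => /lt_limn_einf[N HN].
by have [i /HN + ic] := H N; rewrite ltNge ic.
Qed.

End limn_einf_real.

Lemma gromov_equivalentP (R : realType) (T : Type) (m : T -> T -> R)
    (u v : nat -> T) :
  gromov_equivalent m u v <-> (forall w M, exists N, forall i, (N <= i)%N ->
    M <= gromov_product m w (u i) (v i)).
Proof.
split=> H w; have := H w; first by move=> /cvgryPge + M => /(_ M)[N _ HN]; exists N.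
by move=> h; apply/cvgryPge => M; have [N HN] := h M; exists N.
Qed.

Section boundary_limits.
Variables (R : realType) (X : metricType R) (Xb : completion X) (C : R).
Hypotheses (C1 : 1 <= C) (lc : locally_complete X) (inc : metric_boundary Xb !=set0).
Local Notation r := (dist_boundary Xb).
Local Notation k := (quasihyperbolic Xb).
Local Notation f := (qh_height_of Xb).
Local Notation P := (qh_scale Xb).
Hypothesis M : qh_model C f P k.

Let r0 x : 0 < r x. Proof. exact: dist_boundary_gt0. Qed.

Let expP x y : expR (P x y) = mdist x y + r x + r y.
Proof.
by rewrite /qh_scale lnK// posrE ltr_wpDl// addr_ge0 ?mdist_ge0// ltW.
Qed.

(** Divergence of [P (u i) w] means escape from every [d]-bounded set, because [r] is 1-Lipschitz;
    phrased with [P] it fits the estimates of the model. *)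
Definition boundary_limit (u : nat -> X) (o : with_infinity Xb) : Prop :=
  match o with
  | None => forall w B, exists N, forall i, (N <= i)%N -> B <= P (u i) w
  | Some z => metric_boundary Xb z /\ (forall e, 0 < e -> exists N, forall i,
      (N <= i)%N -> mdist (emb Xb (u i)) z < e)
  end.

(** [r] vanishes along both sequences, so [expR P] tends to the distance of the limits: this is how
    [d] on the boundary is recovered from scales. *)
Lemma boundary_limit_pair u v z z' e : boundary_limit u (Some z) ->
  boundary_limit v (Some z') -> 0 < e -> exists N, forall i j, (N <= i)%N ->
  (N <= j)%N -> `|expR (P (u i) (v j)) - mdist z z'| < e.
Proof.
move=> [bz hu] [bz' hv] e0; have e40 : 0 < e / 4 by rewrite divr_gt0.
have [N1 H1] := hu _ e40; have [N2 H2] := hv _ e40.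
exists (maxn N1 N2) => i j; rewrite !geq_max => /andP[/H1 h1 _] /andP[_ /H2 h2].
have := dist_boundary_le (u i) bz; have := dist_boundary_le (v j) bz'.
have := r0 (u i); have := r0 (v j).
rewrite expP -(emb_isometry Xb).
have t1 := metric_triangle (emb Xb (u i)) z (emb Xb (v j)).
have t2 := metric_triangle z z' (emb Xb (v j)).
have t3 := metric_triangle z (emb Xb (u i)) z'.
have t4 := metric_triangle (emb Xb (u i)) (emb Xb (v j)) z'.
move: t2 t3; rewrite (metric_sym z' (emb _ _)) (metric_sym z (emb _ (u i))).
by rewrite ltr_norml; lra.
Qed.

(** The bound precedes the sequence because products at infinity are infima over all
    representatives. *)
Lemma boundary_limit_bounded_uniform z w : exists B, forall u,
  boundary_limit u (Some z) -> exists N, forall i, (N <= i)%N -> P (u i) w <= B.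
Proof.
exists (ln (2 + mdist z (emb Xb w) + r w)) => u [bz hu].
have [N HN] := hu _ ltr01; exists N => i /HN h.
have d0 := mdist_ge0 z (emb Xb w); have rw := r0 w.
rewrite -ler_expR lnK ?posrE; last by lra.
rewrite expP -(emb_isometry Xb).
have := dist_boundary_le (u i) bz.
have := metric_triangle (emb Xb (u i)) z (emb Xb w); lra.
Qed.

Lemma boundary_limit_bounded u z w : boundary_limit u (Some z) ->
  exists B N, forall i, (N <= i)%N -> P (u i) w <= B.
Proof.
move=> uz; have [B H] := boundary_limit_bounded_uniform z w; exists B; exact: H.
Qed.

Lemma scale_boundary_limit u v z : boundary_limit u (Some z) ->
  boundary_limit v (Some z) -> forall S, exists N, forall i j, (N <= i)%N ->
  (N <= j)%N -> P (u i) (v j) <= S.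
Proof.
move=> uz vz S; have [N HN] := boundary_limit_pair uz vz (expR_gt0 S).
exists N => i j Ni Nj; have := HN i j Ni Nj.
rewrite mdistxx subr0 ger0_norm ?expR_ge0// => h.
by rewrite -ler_expR ltW.
Qed.

Lemma boundary_limit_unique u o o' : boundary_limit u o -> boundary_limit u o' ->
  o = o'.
Proof.
have key v z : boundary_limit v (Some z) -> boundary_limit v None -> False.
  move=> /(boundary_limit_bounded (v 0%N))[B [N HN]] /(_ (v 0%N) (B + 1))[N' HN'].
  have := HN _ (leq_maxl N N'); have := HN' _ (leq_maxr N N'); lra.
case: o => [z|]; case: o' => [z'|] // ho ho'; last 2 first.
- by have := key _ _ ho ho'.
- by have := key _ _ ho' ho.
congr Some; apply: mdist_limit_unique => e e0.
have e20 : 0 < e / 2 by rewrite divr_gt0.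
have [_ /(_ _ e20)[N HN]] := ho; have [_ /(_ _ e20)[N' HN']] := ho'.
have := HN _ (leq_maxl N N'); have := HN' _ (leq_maxr N N').
set i := maxn N N'; rewrite (metric_sym _ z).
have := metric_triangle z (emb Xb (u i)) z'; lra.
Qed.

Lemma boundary_limit_infty w0 (u : nat -> X) :
  (forall B, exists N, forall i, (N <= i)%N -> B <= P (u i) w0) ->
  boundary_limit u None.
Proof.
move=> H w B; have [N HN] := H (Order.max (B + 1) (P w w0 + 2)).
exists N => i /HN; rewrite ge_max => /andP[h1 h2].
have := qh_quasi_ultrametric M w (u i) w0.
by rewrite -lerBlDr le_max => /orP[]; lra.
Qed.

Lemma boundary_limit_product u v o : boundary_limit u o -> boundary_limit v o ->
  forall w N0, exists N, forall i j, (N <= i)%N -> (N <= j)%N ->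
  N0 <= gromov_product k w (u i) (v j).
Proof.
move=> uo vo w N0; have [[t Ht] _] := qh_product_large C1 w N0 M.
case: o uo vo => [z|] uz vz.
  have [N HN] := scale_boundary_limit uz vz (2 * f w - t).
  exists N => i j Ni Nj; apply: Ht; have := HN i j Ni Nj.
  have := qh_height_r M (u i) w; have := qh_height_r M (v j) w; lra.
have [N1 H1] := uz w (t + 1); have [N2 H2] := vz w (t + 1).
exists (maxn N1 N2) => i j; rewrite !geq_max => /andP[/H1 h1 _] /andP[_ /H2 h2].
apply: Ht; have := qh_quasi_ultrametric M w (u i) (v j).
by rewrite (qh_sym M w) -lerBlDr le_max => /orP[]; lra.
Qed.

(** Criterion for finite limits: while [P v w] is bounded, a large product forces [P x v] to be very
    negative, that is, [x] and [v] close to each other and to the boundary. *)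
Lemma product_near_finite w B S : exists t, forall x v,
  t <= gromov_product k w x v -> P v w <= B -> P x v <= S /\ P x w <= B + 1.
Proof.
have [_ [t Ht]] := qh_product_large C1 w (Order.max (B + 2) (2 * B + 1 - S)) M.
exists t => x v /Ht; rewrite ge_max => /andP[h1 h2] vB.
have h3 : P x w <= B + 1.
  have := qh_quasi_ultrametric M v x w.
  by rewrite -lerBlDr le_max => /orP[]; lra.
by split => //; lra.
Qed.

Lemma product_near_infty w D : exists t, forall x v,
  t <= gromov_product k w x v -> P x w + 2 <= P v w -> D <= P x w.
Proof.
have [_ [t Ht]] := qh_product_large C1 w (D + 2) M.
exists t => x v /Ht h1 h2.
have := qh_quasi_ultrametric M x v w.
by rewrite (qh_sym M v x) -lerBlDr le_max => /orP[]; lra.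
Qed.

Lemma gromov_sequence_limit u : gromov_sequence k u -> exists o, boundary_limit u o.
Proof.
move=> gu; pose w := u 0%N.
have [H|/existsNP[B /forallNP HB]] :=
    pselect (forall B, exists N, forall i, (N <= i)%N -> B <= P (u i) w).
  by exists None; exact: boundary_limit_infty H.
(* The sequence keeps returning to scale below [B] around [w]. One late return bounds all late
   terms, and then [P (u i) (u j)] tends to minus infinity. *)
have small S : exists N, forall i j, (N <= i)%N -> (N <= j)%N ->
    P (u i) (u j) <= S.
  have [t1 T1] := product_near_finite w B 0.
  have [t2 T2] := product_near_finite w (B + 1) S.
  have [N HN] := gu w (Order.max t1 t2).
  have [i0 [Ni0 /negP]] : exists i0, (N <= i0)%N /\ ~ B <= P (u i0) w.
    by have := HB N; move=> /existsNP[i0 /not_implyP]; exists i0.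
  rewrite -ltNge => /ltW ui0.
  exists N => i j Ni Nj.
  have bd j' : (N <= j')%N -> P (u j') w <= B + 1.
    move=> Nj'; have := HN j' i0 Nj' Ni0; rewrite ge_max => /andP[h _].
    by have [] := T1 _ _ h ui0.
  have := HN i j Ni Nj; rewrite ge_max => /andP[_ h].
  by have [] := T2 _ _ h (bd _ Nj).
have small' e : 0 < e -> exists N, forall i j, (N <= i)%N -> (N <= j)%N ->
    expR (P (u i) (u j)) < e.
  move=> e0; have [N HN] := small (ln (e / 2)); exists N => i j Ni Nj.
  have e20 : 0 < e / 2 by rewrite divr_gt0.
  have := HN i j Ni Nj; rewrite -ler_expR lnK ?posrE//; lra.
have cu : cauchy ((emb Xb \o u) @ \oo).
  apply: cauchy_mdistP => e e0; have [N HN] := small' e e0.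
  exists N => i j Ni Nj; have := HN i j Ni Nj.
  by rewrite expP /= emb_isometry; have := r0 (u i); have := r0 (u j); lra.
have [z _ /cvg_mdistP uz] := completion_complete (fun=> Logic.I) cu.
(* The limit is not in [X]: [expR (P (u i) (u i))] is twice [r (u i)] and tends to 0, whereas [r] is
   positive and 1-Lipschitz on [X]. *)
exists (Some z); split => // -[x _ xz].
have r20 : 0 < r x / 2 by rewrite divr_gt0.
have [N HN] := uz _ r20; have [N' HN'] := small' _ r20.
have := HN _ (leq_maxl N N'); have := HN' _ _ (leq_maxr N N') (leq_maxr N N').
set i := maxn N N'; rewrite /= -xz emb_isometry expP mdistxx.
have := dist_boundary_lipschitz inc x (u i); rewrite (metric_sym x).
have := r0 (u i); lra.
Qed.

Lemma gromov_equivalent_limit u v o o' : boundary_limit u o -> boundary_limit v o' ->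
  gromov_equivalent k u v <-> o = o'.
Proof.
move=> uo vo'; split; last first.
  move=> E; rewrite -E in vo'; apply/gromov_equivalentP => w N0.
  have [N HN] := boundary_limit_product uo vo' w N0.
  by exists N => i Ni; exact: HN.
have mixed u' v' z : boundary_limit u' (Some z) -> boundary_limit v' None ->
    (forall w N0, exists N, forall i, (N <= i)%N ->
      N0 <= gromov_product k w (v' i) (u' i)) -> False.
  move=> uz vN H; pose w := u' 0%N.
  have [B [N1 H1]] := boundary_limit_bounded w uz.
  have [t Ht] := product_near_finite w B 0.
  have [N2 H2] := H w t; have [N3 H3] := vN w (B + 2).
  pose i := maxn N1 (maxn N2 N3).
  have i1 : (N1 <= i)%N by rewrite leq_maxl.
  have i2 : (N2 <= i)%N by rewrite leq_max leq_maxl orbT.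
  have i3 : (N3 <= i)%N by rewrite !leq_max leqnn !orbT.
  have [_] := Ht _ _ (H2 i i2) (H1 i i1); have := H3 i i3; lra.
have psym w x y : gromov_product k w x y = gromov_product k w y x.
  by rewrite /gromov_product (qh_ksym M x y); lra.
case: o uo => [z|] uo; case: o' vo' => [z'|] vo' // /gromov_equivalentP H; last 2 first.
- exfalso; apply: (mixed _ _ _ uo vo') => w N0; have [N HN] := H w N0.
  by exists N => i /HN; rewrite psym.
- by exfalso; exact: (mixed _ _ _ vo' uo H).
congr Some; apply: mdist_limit_unique => e e0; pose w := u 0%N.
have [B [N1 H1]] := boundary_limit_bounded w vo'.
have e20 : 0 < e / 2 by rewrite divr_gt0.
have [t Ht] := product_near_finite w B (ln (e / 2)).
have [N2 H2] := H w t; have [N3 H3] := boundary_limit_pair uo vo' e20.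
pose i := maxn N1 (maxn N2 N3).
have i1 : (N1 <= i)%N by rewrite leq_maxl.
have i2 : (N2 <= i)%N by rewrite leq_max leq_maxl orbT.
have i3 : (N3 <= i)%N by rewrite !leq_max leqnn !orbT.
have [+ _] := Ht _ _ (H2 i i2) (H1 i i1).
rewrite -ler_expR lnK ?posrE// => h; have := H3 i i i3 i3.
by rewrite ltr_norml; lra.
Qed.

Lemma boundary_limit_gromov u o : boundary_limit u o -> gromov_sequence k u.
Proof. by move=> uo w N0; exact: (boundary_limit_product uo uo). Qed.

Lemma boundary_limit_exists (o : with_infinity Xb) :
  (forall z, o = Some z -> metric_boundary Xb z) -> exists u, boundary_limit u o.
Proof.
have [z0 bz0] := inc; have [x0 _] := completion_approx z0 ltr01.
case: o => [z /(_ z erefl) bz|_].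
  have pos n : 0 < n.+1%:R^-1 :> R by rewrite invr_gt0 ltr0Sn.
  have [u Hu] := choice (fun n => completion_approx z (pos n)).
  exists u; split => // e e0; exists (Num.trunc e^-1) => i Ni.
  apply: (lt_le_trans (Hu i)).
  have ei : 0 <= e^-1 by rewrite invr_ge0 ltW.
  have /andP[_ h] := truncn_itv ei.
  rewrite -[leRHS]invrK lef_pV2 ?posrE ?invr_gt0//.
  by rewrite (le_trans (ltW h))// ler_nat ltnS.
have [u Hu] := choice (fun n : nat => qh_unbounded M x0 n%:R).
exists u; apply: (@boundary_limit_infty x0) => B; exists (Num.trunc `|B|).+1 => i Bi.
rewrite (qh_sym M) (le_trans _ (Hu i))// (le_trans (ler_norm B))//.
have /andP[_ /ltW h] := truncn_itv (normr_ge0 B).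
by rewrite (le_trans h)// ler_nat.
Qed.

Lemma boundary_limit_range u o : boundary_limit u o ->
  forall z, o = Some z -> metric_boundary Xb z.
Proof. by move=> + z oz; rewrite oz => -[]. Qed.

Definition boundary_map_spec (phi : gromov_boundary k -> with_infinity Xb) :=
  forall zeta v, gclass zeta v <-> boundary_limit v (phi zeta).

Lemma boundary_map_exists : exists phi, boundary_map_spec phi.
Proof.
suff H (zeta : gromov_boundary k) : exists o, forall v, gclass zeta v <-> boundary_limit v o.
  by have [phi Hphi] := choice H; exists phi.
case: zeta => S [u gu SE]; rewrite /gclass /=.
have [p up] := gromov_sequence_limit gu; exists p => v; rewrite SE; split.
  move=> [gv euv]; have [q vp] := gromov_sequence_limit gv.
  by have -> := (gromov_equivalent_limit up vp).1 euv.
move=> vo; split; first exact: boundary_limit_gromov vo.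
exact/(gromov_equivalent_limit up vo).
Qed.

Section boundary_map.
Variable phi : gromov_boundary k -> with_infinity Xb.
Hypothesis phiP : boundary_map_spec phi.

Lemma gclass_nonempty (zeta : gromov_boundary k) : exists u : nat -> X, gclass zeta u.
Proof.
case: zeta => S [u gu SE]; exists u; rewrite /gclass /= SE; split => //.
have [p up] := gromov_sequence_limit gu.
exact/(gromov_equivalent_limit up up).
Qed.

Lemma boundary_map_range zeta z : phi zeta = Some z -> metric_boundary Xb z.
Proof.
have [u /phiP uo] := gclass_nonempty zeta; exact: boundary_limit_range uo _.
Qed.

Lemma boundary_map_inj : injective phi.
Proof.
move=> z1 z2 e; have : gclass z1 = gclass z2.
  by apply/seteqP; split => v /phiP h; apply/phiP; [rewrite -e|rewrite e].
by case: z1 {e} => S1 p1; case: z2 => S2 p2 /= E; exact: eq_exist.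
Qed.

Lemma boundary_map_surj o : (forall z, o = Some z -> metric_boundary Xb z) ->
  exists zeta, phi zeta = o.
Proof.
move=> /boundary_limit_exists[u uo].
have gu := boundary_limit_gromov uo.
pose S := [set v | gromov_sequence k v /\ gromov_equivalent k u v].
pose zeta : gromov_boundary k := exist _ S (ex_intro2 _ _ u gu erefl).
exists zeta; have : gclass zeta u by split => //; exact/(gromov_equivalent_limit uo uo).
by move=> /phiP u'; exact: boundary_limit_unique u' uo.
Qed.

End boundary_map.

Lemma product_pb_frequently (zeta : gromov_boundary k) w x t v : gclass zeta v ->
  (t%:E < gromov_product_pb w x zeta)%E ->
  exists N, forall i, (N <= i)%N -> t < gromov_product k w x (v i).
Proof.
move=> zv H; apply: lt_limn_einf; apply: (lt_le_trans H).
by apply: ereal_inf_lbound; exists v.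
Qed.

Lemma product_bb_frequently (eta zeta : gromov_boundary k) w t u v :
  gclass eta u -> gclass zeta v -> (t%:E < gromov_product_bb w eta zeta)%E ->
  exists N, forall i, (N <= i)%N -> t < gromov_product k w (u i) (v i).
Proof.
move=> eu zv H; apply: lt_limn_einf; apply: (lt_le_trans H).
by apply: ereal_inf_lbound; exists u => //; exists v.
Qed.

(** * Continuity of the boundary map *)

Section natural.
Variable phi : gromov_boundary k -> with_infinity Xb.
Hypothesis phiP : boundary_map_spec phi.

Lemma boundary_map_continuous_finite w zeta z U : phi zeta = Some z ->
  open U -> U z -> exists2 t, 0 < t & forall q : bordification k,
  (t%:E < gromov_product_bord w q zeta)%E ->
  exists2 y, extend_identity phi q = Some y & U y.
Proof.
move=> pz oU Uz.
have [e e0 eU] : exists2 e, 0 < e & forall y, mdist y z < e -> U y.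
  have /nbhs_ballP[e e0 H] : nbhs z U by exact: open_nbhs_nbhs.
  by exists e => // y yz; apply: H; rewrite ballEmdist/= metric_sym.
have [v zv] := gclass_nonempty zeta; have vz := (phiP zeta v).1 zv.
rewrite pz in vz; have [B [N1 H1]] := boundary_limit_bounded w vz.
have e20 : 0 < e / 2 by rewrite divr_gt0.
have e40 : 0 < e / 2 / 2 by rewrite divr_gt0.
have [_ /(_ _ e40)[N2 H2]] := vz.
have [t Ht] := product_near_finite w B (ln (e / 2 / 2)).
have close x i : t <= gromov_product k w x (v i) -> (maxn N1 N2 <= i)%N ->
    mdist (emb Xb x) z < e / 2 /\ P x w <= B + 1.
  move=> h; rewrite geq_max => /andP[/H1 i1 /H2 i2].
  have [+ ->] := Ht _ _ h i1; rewrite -ler_expR lnK ?posrE// expP => h'; split => //.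
  have := metric_triangle (emb Xb x) (emb Xb (v i)) z.
  by rewrite emb_isometry; have := r0 x; have := r0 (v i); lra.
exists (Order.max 1 t); first by rewrite lt_max ltr01.
have tm : t <= Order.max 1 t by rewrite le_max lexx orbT.
move=> [x|eta] /=.
  move=> /(product_pb_frequently zv)[N HN]; exists (emb Xb x) => //; apply: eU.
  pose i := maxn N (maxn N1 N2).
  have [h _] := close x i (le_trans tm (ltW (HN i (leq_maxl _ _)))) (leq_maxr _ _).
  by apply: lt_trans h _; lra.
have [u eu] := gclass_nonempty eta; have uo := (phiP eta u).1 eu.
move=> /(product_bb_frequently eu zv)[N HN].
have near i : (maxn N (maxn N1 N2) <= i)%N ->
    mdist (emb Xb (u i)) z < e / 2 /\ P (u i) w <= B + 1.
  rewrite geq_max => /andP[iN i12].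
  exact: (close _ i (le_trans tm (ltW (HN i iN))) i12).
case: (phi eta) uo => [y|] uo.
  exists y => //; apply: eU; have [_ /(_ _ e20)[N3 H3]] := uo.
  pose i := maxn N3 (maxn N (maxn N1 N2)).
  have [h _] := near i (leq_maxr _ _); have := H3 i (leq_maxl _ _).
  have := metric_triangle y (emb Xb (u i)) z; rewrite (metric_sym y (emb _ _)); lra.
(* The value at infinity is excluded: the representative of [eta] would leave the region in which
   [near] keeps it. *)
have [N3 H3] := uo w (B + 2).
pose i := maxn N3 (maxn N (maxn N1 N2)).
have [_ h] := near i (leq_maxr _ _); have := H3 i (leq_maxl _ _); lra.
Qed.

Lemma boundary_map_continuous_infty w zeta (U : set (with_infinity Xb)) : phi zeta = None ->
  U None -> open U -> exists2 t, 0 < t & forall q : bordification k,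
  (t%:E < gromov_product_bord w q zeta)%E -> U (extend_identity phi q).
Proof.
move=> pz UN [_ /(_ UN)[M0 HM]].
have [D HD] : exists D, forall y, D < mdist (emb Xb w) y -> U (Some y).
  have [[y0 Uy0]|allU] := pselect (exists y, ~ U (Some y)); last first.
    by exists 0 => y _; apply: contrapT => Uy; apply: allU; exists y.
  exists (mdist (emb Xb w) y0 + M0) => y Dy; apply: contrapT => Uy.
  have := HM y0 y Uy0 Uy; have := metric_triangle (emb Xb w) y0 y; lra.
have D1 : 0 < 2 * (`|D| + 1) + 2 * r w.
  by have := r0 w; have := normr_ge0 D; lra.
have far x : ln (2 * (`|D| + 1) + 2 * r w) <= P x w -> D + 1 <= mdist x w.
  rewrite -ler_expR lnK ?posrE// expP.
  have := dist_boundary_lipschitz inc x w; have := ler_norm D; lra.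
have [t Ht] := product_near_infty w (ln (2 * (`|D| + 1) + 2 * r w)).
have [v zv] := gclass_nonempty zeta; have vz := (phiP zeta v).1 zv.
rewrite pz in vz.
exists (Order.max 1 t); first by rewrite lt_max ltr01.
have tm : t <= Order.max 1 t by rewrite le_max lexx orbT.
move=> [x|eta] /=.
  move=> /(product_pb_frequently zv)[N HN]; apply: HD.
  have [N' HN'] := vz w (P x w + 2); pose i := maxn N N'.
  have h := Ht x (v i) (le_trans tm (ltW (HN i (leq_maxl _ _)))) (HN' i (leq_maxr _ _)).
  by rewrite emb_isometry metric_sym; have := far _ h; lra.
have [u eu] := gclass_nonempty eta; have uo := (phiP eta u).1 eu.
move=> /(product_bb_frequently eu zv)[N HN].
case: (phi eta) uo => [y|] uo //; apply: HD.
have [B [N1 H1]] := boundary_limit_bounded w uo.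
have [_ /(_ _ ltr01)[N2 H2]] := uo; have [N3 H3] := vz w (B + 2).
pose i := maxn (maxn N N1) (maxn N2 N3).
have iN : (N <= i)%N by rewrite !leq_max leqnn.
have i1 : (N1 <= i)%N by rewrite !leq_max leqnn !orbT.
have i2 : (N2 <= i)%N by rewrite !leq_max leqnn !orbT.
have i3 : (N3 <= i)%N by rewrite !leq_max leqnn !orbT.
have bd : P (u i) w + 2 <= P (v i) w by have := H1 i i1; have := H3 i i3; lra.
have /far := Ht (u i) (v i) (le_trans tm (ltW (HN i iN))) bd.
have := H2 i i2; have := metric_triangle (emb Xb w) y (emb Xb (u i)).
by rewrite emb_isometry (metric_sym w (u i)) (metric_sym y); lra.
Qed.

Lemma boundary_map_natural :
  (forall x y, ln (1 + mdist x y / r x) <= k x y) -> natural_map phi.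
Proof.
move=> kln; split; first exact: boundary_map_range.
move=> w p V; rewrite nbhsE => -[U [oU Up] UV].
case: p Up => [x|zeta] /= Up.
  have [e e0 eU] : exists2 e, 0 < e & forall y, mdist x y < e -> U (Some (emb Xb y)).
    have /nbhs_ballP[e e0 H] : nbhs (emb Xb x) (Some @^-1` U).
      by apply: open_nbhs_nbhs; split => //; exact: oU.1.
    by exists e => // y xy; apply: H; rewrite ballEmdist/= emb_isometry.
  have er : 1 < 1 + e / r x by rewrite ltrDl divr_gt0.
  exists (ln (1 + e / r x)); first by rewrite /= ln_gt0.
  move=> _ [y xy <-]; apply: UV; apply: eU; rewrite ltNge; apply/negP => ey.
  move: xy; apply/negP; rewrite -leNgt.
  apply: le_trans (kln x y); have rx := r0 x.
  rewrite ler_ln ?posrE; [|exact: lt_trans er|]; last first.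
    by rewrite ltr_wpDr// divr_ge0 ?mdist_ge0// ltW.
  by rewrite lerD2l ler_pM2r ?invr_gt0.
case pz : (phi zeta) => [z|]; rewrite pz in Up.
  have [t t0 Ht] := boundary_map_continuous_finite w pz oU.1 Up.
  by exists t => // q /Ht[y qy Uy]; apply: UV; rewrite /= qy.
have [t t0 Ht] := boundary_map_continuous_infty w pz Up oU.
by exists t => // q /Ht Uq; apply: UV.
Qed.
End natural.

(** * Busemann functions *)

Lemma busemann_product_sym (b : X -> R) x y :
  busemann_product k b x y = busemann_product k b y x.
Proof. by rewrite /busemann_product (qh_ksym M x y) (addrC (b x)). Qed.

Section busemann.
Variable phi : gromov_boundary k -> with_infinity Xb.
Hypothesis phiP : boundary_map_spec phi.
Variable d : R.
Hypothesis hyp : delta_hyperbolic k d.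

Let d0 : 0 <= d. Proof. by case: hyp. Qed.

Lemma gromov_product_itv x w y : 0 <= gromov_product k x w y <= k w x.
Proof.
rewrite /gromov_product; have := qh_ktri M w x y; have := qh_ktri M y w x.
rewrite (qh_ksym M y w) (qh_ksym M x y) => h1 h2; apply/andP; split; lra.
Qed.

(** By hyperbolicity late values of [(w|v i)_x] agree up to [d], also between two representatives,
    so the infimum of the lower limits is within [2 * d] of any late value. In particular it is
    finite and [fine] loses nothing. *)
Lemma product_pb_approx (zeta : gromov_boundary k) x w v : gclass zeta v ->
  exists N, forall i, (N <= i)%N ->
  `|fine (gromov_product_pb x w zeta) - gromov_product k x w (v i)| <= 2 * d.
Proof.
have d0' := d0.
move=> zv; pose g (u : nat -> X) (i : nat) := gromov_product k x w (u i).
(* Once [(u i|u' j)_x] exceeds [k w x], which bounds [(w|u i)_x], the latter is the minimum in the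
   hyperbolicity inequality. *)
have close u u' : gclass zeta u -> gclass zeta u' -> exists N, forall i j,
    (N <= i)%N -> (N <= j)%N -> g u i - d <= g u' j.
  move=> /phiP uo /phiP u'o; have [N HN] := boundary_limit_product uo u'o x (k w x).
  exists N => i j Ni Nj; have := HN i j Ni Nj.
  have [_ _ /(_ w (u' j) (u i) x)] := hyp.
  have /andP[_] := gromov_product_itv x w (u i).
  by rewrite lerBlDr ge_min /g => h1 /orP[]; lra.
have [N1 H1] := close v v zv zv.
have low i : (N1 <= i)%N -> ((g v i - 2 * d)%:E <= gromov_product_pb x w zeta)%E.
  move=> iN; apply: le_ereal_inf_tmp => _ [u zu <-].
  have [N2 H2] := close v u zv zu; apply: (@limn_einf_ge _ _ _ N2) => j Nj.
  have := H2 (maxn N1 N2) j (leq_maxr _ _) Nj.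
  have := H1 i (maxn N1 N2) iN (leq_maxl _ _); rewrite /g; lra.
have up i : (N1 <= i)%N -> (gromov_product_pb x w zeta <= (g v i + d)%:E)%E.
  move=> iN; apply: (@le_trans _ _ (limn_einf (fun i => (g v i)%:E))).
    by apply: ereal_inf_lbound; exists v.
  apply: limn_einf_le => N; exists (maxn N N1); first by rewrite leq_maxl.
  by have := H1 (maxn N N1) i (leq_maxr _ _) iN; lra.
exists N1 => i iN; have := low i iN; have := up i iN.
case: (gromov_product_pb x w zeta) => [c| |] //=; rewrite !lee_fin ler_norml /g; lra.
Qed.

Section fixed_busemann.
Variables (xi : gromov_boundary k) (w : X) (b : X -> R).
Hypothesis bE : b = busemann xi w.

Lemma busemann_approx v x : gclass xi v -> exists N, forall i, (N <= i)%N ->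
  `|b x - (k x (v i) - k w (v i))| <= 4 * d.
Proof.
move=> xv; have [N1 H1] := product_pb_approx x w xv.
have [N2 H2] := product_pb_approx w x xv.
exists (maxn N1 N2) => i; rewrite geq_max => /andP[/H1 h1 /H2 h2].
have E : k x (v i) - k w (v i) =
    gromov_product k x w (v i) - gromov_product k w x (v i).
  rewrite /gromov_product (qh_ksym M w x) (qh_ksym M (v i) x) (qh_ksym M (v i) w).
  lra.
have aux (p1 p2 q1 q2 : R) : `|p1 - q1| <= 2 * d -> `|p2 - q2| <= 2 * d ->
    `|p1 - p2 - (q1 - q2)| <= 4 * d by rewrite !ler_norml; lra.
by rewrite bE E; exact: aux h1 h2.
Qed.

Lemma busemann_product_approx v x y : gclass xi v -> exists N, forall i,
  (N <= i)%N -> `|busemann_product k b x y - (gromov_product k (v i) x y - k w (v i))|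
    <= 4 * d.
Proof.
move=> xv; have [N1 H1] := busemann_approx x xv; have [N2 H2] := busemann_approx y xv.
exists (maxn N1 N2) => i; rewrite geq_max => /andP[/H1 h1 /H2 h2].
move: h1 h2; rewrite /busemann_product /gromov_product.
move: (b x) (b y) (k x y) (k x (v i)) (k y (v i)) (k w (v i)) => bx' by' c1 c2 c3 c4.
by rewrite !ler_norml; lra.
Qed.

(** Seen from a late term of a sequence tending to [xi], the Busemann product is a Gromov product
    minus a constant. The [9 * d] consists of two errors [4 * d] and the [d] of hyperbolicity. *)
Lemma busemann_product_ultra x y z :
  Order.min (busemann_product k b x z) (busemann_product k b z y) - 9 * d <=
  busemann_product k b x y.
Proof.
have [v xv] := gclass_nonempty xi.
have [N1 H1] := busemann_product_approx x y xv.
have [N2 H2] := busemann_product_approx x z xv.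
have [N3 H3] := busemann_product_approx z y xv.
pose i := maxn N1 (maxn N2 N3).
have := H1 i (leq_maxl _ _); have := H2 i; rewrite !leq_max leqnn orbT => /(_ isT).
have := H3 i; rewrite !leq_max leqnn !orbT => /(_ isT).
have [_ _ /(_ x y z (v i))] := hyp.
rewrite !lerBlDr !ge_min !ler_norml => /orP[h|h] h3 h2 h1; apply/orP;
  [left|right]; lra.
Qed.

Lemma busemann_product_cross a B : 0 <= a -> phi xi = None ->
  (forall x N, exists c, N <= f c /\ P x c <= f c + a) ->
  (forall x y z c, P x c <= f c + (a + 1) -> P y c <= f c + (a + 1) ->
    P z c <= f c + (a + 1) -> forall tau,
    tau = gromov_product k c x z - gromov_product k c x y ->
    P x y - P x z <= Order.max tau (tau / C) + B) ->
  forall x y z tau,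
    tau = busemann_product k b x z - busemann_product k b x y ->
    P x y - P x z <= Order.max tau (tau / C) + (B + 8 * d).
Proof.
have C1' := C1; have d0' := d0.
move=> a0 xiN apex cross x y z tau tauE.
(* Apexes above [x] of height tending to infinity represent [xi], which carries the estimate at
   apexes over to Busemann products, at the cost of two errors [4 * d]. *)
have [v Hv] := choice (fun n : nat => apex x n%:R).
have xv : gclass xi v.
  apply/phiP; rewrite xiN; apply: (@boundary_limit_infty x) => D.
  exists (Num.trunc `|D|).+1 => i Di; have [h _] := Hv i.
  have /andP[_ /ltW h1] := truncn_itv (normr_ge0 D).
  have h2 : (Num.trunc `|D|).+1%:R <= i%:R :> R by rewrite ler_nat.
  have := qh_height M (v i) x; have := ler_norm D; lra.
have [N1 H1] := busemann_product_approx x y xv.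
have [N2 H2] := busemann_product_approx x z xv.
pose N3 := (Num.trunc (`|P x y| + `|P x z|)).+1.
pose i := maxn N1 (maxn N2 N3).
have := H1 i (leq_maxl _ _); have := H2 i; rewrite !leq_max leqnn orbT => /(_ isT).
rewrite !ler_norml => h2 h1.
have [fi Pi] := Hv i.
have s0 : 0 <= `|P x y| + `|P x z| by rewrite addr_ge0.
have t1 : `|P x y| + `|P x z| <= N3%:R.
  by have /andP[_ /ltW] := truncn_itv s0.
have t2 : N3%:R <= i%:R :> R by rewrite ler_nat !leq_max leqnn !orbT.
have hy : P x y <= f (v i) by have := ler_norm (P x y); have := normr_ge0 (P x z); lra.
have hz : P x z <= f (v i) by have := ler_norm (P x z); have := normr_ge0 (P x y); lra.
have yc : P y (v i) <= f (v i) + (a + 1) by rewrite addrA; exact: (qh_apex_le a0 M Pi hy).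
have zc : P z (v i) <= f (v i) + (a + 1) by rewrite addrA; exact: (qh_apex_le a0 M Pi hz).
have xc : P x (v i) <= f (v i) + (a + 1) by lra.
pose t := gromov_product k (v i) x z - gromov_product k (v i) x y.
apply: (le_trans (cross x y z (v i) xc yc zc t erefl)).
have tt : t <= tau + 8 * d.
  rewrite /t tauE; move: h1 h2; move: (busemann_product k b x y) => q1.
  by move: (busemann_product k b x z) => q2; lra.
have C0 : 0 < C by lra.
have tC : t / C <= tau / C + 8 * d.
  rewrite (@le_trans _ _ ((tau + 8 * d) / C))//.
    by rewrite ler_pM2r ?invr_gt0.
  by rewrite mulrDl lerD2l ler_pdivrMr// ler_peMr//; lra.
rewrite (addrC B) addrA lerD2r ge_max; apply/andP; split.
  by rewrite (le_trans tt)// lerD2r le_max lexx.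
by rewrite (le_trans tC)// lerD2r le_max lexx orbT.
Qed.

End fixed_busemann.
End busemann.

(** * Hamenstädt metrics *)

Section hamenstadt.
Variable phi : gromov_boundary k -> with_infinity Xb.
Hypothesis phiP : boundary_map_spec phi.
Variables (xi : gromov_boundary k) (b : X -> R) (D B : R).
Hypotheses (xiN : phi xi = None) (D0 : 0 <= D) (B0 : 0 <= B).
Local Notation q := (busemann_product k b).
Local Notation G := (@busemann_product_bb R X k b).
Hypothesis ultra : forall x y z, Order.min (q x z) (q z y) - D <= q x y.
Hypothesis cross : forall x y z tau, tau = q x z - q x y ->
  P x y - P x z <= Order.max tau (tau / C) + B.

Let qsym x y : q x y = q y x. Proof. exact: busemann_product_sym. Qed.

Let gap x y z m : m + B <= P x y - P x z ->
  (0 <= m -> m <= q x z - q x y) /\ (m <= 0 -> C * m <= q x z - q x y).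
Proof.
move=> h; apply: (max_divr_le C1); have := cross (erefl (q x z - q x y)).
by move=> h'; rewrite -(lerD2r B) (le_trans h).
Qed.

(** [gap] compares only pairs sharing a point, so this bound and the next two pass from the pair
    [(o, o)] through [(x, o)] to [(x, y)]. They make the product at infinity finite for distinct
    points and infinite on the diagonal. *)
Lemma busemann_product_low o S : exists c, forall x y, P x o <= S -> P x y <= S ->
  c <= q x y.
Proof.
have B0' := B0; pose m := - (`|f o| + `|S| + B).
have m0 : m <= 0 by rewrite oppr_le0 !addr_ge0.
exists (q o o + 2 * (C * m)) => x y xo xy.
have fo := qh_height_r M x o; have foo := qh_height M o o.
have n1 := ler_norm S; have n2 := ler_norm (- f o); rewrite normrN in n2.
have [|_ /(_ m0) h1] := @gap o o x m; first by rewrite (qh_sym M o x) /m; lra.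
have [|_ /(_ m0) h2] := @gap x o y m; first by rewrite /m; lra.
rewrite (qsym o x) in h1; move: h1 h2.
by move: (q o o) (q x o) (q x y) (C * m) => q1 q2 q3 q4; lra.
Qed.

Lemma busemann_product_large o S N : exists S', forall x y, P x o <= S ->
  P x y <= S' -> N <= q x y.
Proof.
have B0' := B0; have [c Hc] := busemann_product_low o (Order.max S (f o + 1)).
pose m := `|N - c|; have m0 : 0 <= m := normr_ge0 _.
have Nc := ler_norm (N - c).
exists (f o - m - B) => x y xo xy; have fo := qh_height_r M x o.
have h1 : c <= q x o.
  by apply: Hc; rewrite le_max xo.
have [|/(_ m0) h2 _] := @gap x o y m; first by lra.
move: h1 h2 Nc; rewrite /m; move: (q x o) (q x y) => q1 q2; lra.
Qed.

Lemma busemann_product_up o S S' : exists c, forall x y, P x o <= S ->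
  S' <= P x y -> q x y <= c.
Proof.
have B0' := B0; pose m := - (`|S'| + `|S| + B); pose m2 := - (1 + B).
have m0 : m <= 0 by rewrite oppr_le0 !addr_ge0.
have m20 : m2 <= 0 by rewrite oppr_le0 addr_ge0.
exists (q o o - C * m2 - C * m) => x y xo xy.
have n1 := ler_norm S; have n2 := ler_norm (- S'); rewrite normrN in n2.
have [|_ /(_ m0) h1] := @gap x y o m; first by rewrite /m; lra.
have fo := qh_height M o x; have foo := qh_diag M o.
have [|_ /(_ m20) h2] := @gap o x o m2; first by rewrite /m2; lra.
rewrite (qsym o x) in h2; move: h1 h2.
by move: (q o o) (q x o) (q x y) (C * m) (C * m2) => q1 q2 q3 q4 q5; lra.
Qed.

Let finite zeta : zeta <> xi -> exists z, phi zeta = Some z.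
Proof.
move=> zx; case E : (phi zeta) => [z|]; first by exists z.
by exfalso; apply: zx; apply: (boundary_map_inj phiP); rewrite E.
Qed.

Let limit_of zeta z u : phi zeta = Some z -> gclass zeta u -> boundary_limit u (Some z).
Proof. by move=> E /phiP; rewrite E. Qed.

Lemma busemann_bb_sym z1 z2 : G z1 z2 = G z2 z1.
Proof.
rewrite /busemann_product_bb; congr ereal_inf; apply/seteqP; split => l /=.
  move=> [u zu [v zv <-]]; exists v => //; exists u => //.
  by congr limn_einf; apply/funext => i; rewrite qsym.
move=> [u zu [v zv <-]]; exists v => //; exists u => //.
by congr limn_einf; apply/funext => i; rewrite qsym.
Qed.

Lemma busemann_bb_low z1 z2 : z1 <> xi -> z2 <> xi -> exists c : R, (c%:E <= G z1 z2)%E.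
Proof.
move=> /finite[y1 E1] /finite[y2 E2].
have [u0 _] := gclass_nonempty z1; pose o := u0 0%N.
have [S1 HS1] := boundary_limit_bounded_uniform y1 o.
pose S2 := ln (mdist y1 y2 + 1).
have [c Hc] := busemann_product_low o (Order.max S1 S2).
exists c; apply: le_ereal_inf_tmp => _ [u zu [v zv <-]].
have uy := limit_of E1 zu; have vy := limit_of E2 zv.
have [N1 H1] := HS1 _ uy; have [N2 H2] := boundary_limit_pair uy vy ltr01.
apply: (@limn_einf_ge _ _ _ (maxn N1 N2)) => i; rewrite geq_max => /andP[i1 i2].
apply: Hc; first by rewrite le_max H1.
have d1 : 0 < mdist y1 y2 + 1 by have := mdist_ge0 y1 y2; lra.
rewrite le_max; apply/orP; right; rewrite /S2 -ler_expR lnK ?posrE//.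
by have := H2 i i i2 i2; rewrite ltr_norml; lra.
Qed.

Lemma busemann_bb_self z : z <> xi -> G z z = +oo%E.
Proof.
move=> /finite[y E]; have [u0 _] := gclass_nonempty z; pose o := u0 0%N.
have [S HS] := boundary_limit_bounded_uniform y o.
apply/eqP; rewrite eq_le leey/=; apply: le_ereal_inf_tmp => _ [u zu [v zv <-]].
have uy := limit_of E zu; have vy := limit_of E zv.
have [N1 H1] := HS _ uy.
rewrite leye_eq; apply/eqP/eq_infty => N.
have [S' HS'] := busemann_product_large o S N.
have [N2 H2] := scale_boundary_limit uy vy S'.
apply: (@limn_einf_ge _ _ _ (maxn N1 N2)) => i; rewrite geq_max => /andP[i1 i2].
by apply: HS'; [exact: H1|exact: H2].
Qed.

Lemma busemann_bb_fin z1 z2 : z1 <> xi -> z2 <> xi -> z1 <> z2 ->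
  exists c : R, G z1 z2 = c%:E.
Proof.
move=> zx1 zx2 z12; have [c1 h1] := busemann_bb_low zx1 zx2.
suff [c2 h2] : exists c : R, (G z1 z2 <= c%:E)%E.
  by case: (G z1 z2) h1 h2 => [c| |]// _ _; exists c.
have [y1 E1] := finite zx1; have [y2 E2] := finite zx2.
have y12 : y1 <> y2.
  by move=> yy; apply: z12; apply: (boundary_map_inj phiP); rewrite E1 E2 yy.
have d0 : 0 < mdist y1 y2 by rewrite mdist_gt0; apply/eqP.
have [u zu] := gclass_nonempty z1; have [v zv] := gclass_nonempty z2.
have uy := limit_of E1 zu; have vy := limit_of E2 zv; pose o := u 0%N.
have [S HS] := boundary_limit_bounded_uniform y1 o; have [N1 H1] := HS _ uy.
have d20 : 0 < mdist y1 y2 / 2 by rewrite divr_gt0.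
have [N2 H2] := boundary_limit_pair uy vy d20.
have [c Hc] := busemann_product_up o S (ln (mdist y1 y2 / 2)).
exists c; apply: (@le_trans _ _ (limn_einf (fun i => (q (u i) (v i))%:E))).
  by apply: ereal_inf_lbound; exists u => //; exists v.
apply: limn_einf_le => N; exists (maxn N (maxn N1 N2)); first exact: leq_maxl.
set i := maxn _ _; apply: Hc; first by apply: H1; rewrite !leq_max leqnn orbT.
have i2 : (N2 <= i)%N by rewrite !leq_max leqnn !orbT.
rewrite -ler_expR lnK ?posrE//; have := H2 i i i2 i2; rewrite ltr_norml.
lra.
Qed.

Lemma busemann_bb_ultra z1 z2 z3 (m : R) : (m%:E <= G z1 z2)%E -> (m%:E <= G z2 z3)%E ->
  ((m - D)%:E <= G z1 z3)%E.
Proof.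
move=> h12 h23; apply: le_ereal_inf_tmp => _ [u zu [v zv <-]].
have [a za] := gclass_nonempty z2.
have near z z' (u' v' : nat -> X) e : (m%:E <= G z z')%E -> gclass z u' ->
    gclass z' v' -> 0 < e -> exists N, forall i, (N <= i)%N -> m - e < q (u' i) (v' i).
  move=> h zu' zv' e0; apply: lt_limn_einf; apply: (@lt_le_trans _ _ m%:E).
    by rewrite lte_fin ltrBlDr ltrDl.
  by apply: (le_trans h); apply: ereal_inf_lbound; exists u' => //; exists v'.
apply/lee_addgt0Pr => e e0; rewrite -leeBlDr// -EFinB.
have [N1 H1] := near _ _ _ _ _ h12 zu za e0.
have [N2 H2] := near _ _ _ _ _ h23 za zv e0.
apply: (@limn_einf_ge _ _ _ (maxn N1 N2)) => i; rewrite geq_max => /andP[/H1 i1 /H2 i2].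
have := ultra (u i) (v i) (a i); rewrite lerBlDr ge_min.
by move: i1 i2; move: (q _ _) (q _ _) (q _ _) => q1 q2 q3 i1 i2 /orP[]; lra.
Qed.

Variable eps : R.
Hypotheses (eps0 : 0 < eps) (epsD : expR (eps * D) ^+ 2 <= 2).
Local Notation Y := [set zeta : gromov_boundary k | zeta <> xi].

Definition hamenstadt_rho_real (z1 z2 : gromov_boundary k) : R :=
  fine (hamenstadt_rho b eps z1 z2).
Local Notation rho := hamenstadt_rho_real.

Lemma hamenstadt_rho_self z : z <> xi -> hamenstadt_rho b eps z z = 0%E.
Proof.
by move=> zx; rewrite /hamenstadt_rho busemann_bb_self// gt0_muley ?lte_fin.
Qed.

Lemma hamenstadt_rho_fin z1 z2 : z1 <> xi -> z2 <> xi -> z1 <> z2 ->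
  exists2 c : R, G z1 z2 = c%:E & rho z1 z2 = expR (- (eps * c)).
Proof.
move=> zx1 zx2 z12; have [c E] := busemann_bb_fin zx1 zx2 z12.
by exists c => //; rewrite /rho /hamenstadt_rho E.
Qed.

Lemma hamenstadt_rhoE z1 z2 : z1 <> xi -> z2 <> xi ->
  hamenstadt_rho b eps z1 z2 = (rho z1 z2)%:E.
Proof.
move=> zx1 zx2; have [<-|z12] := pselect (z1 = z2).
  by rewrite /rho hamenstadt_rho_self.
have [c E] := busemann_bb_fin zx1 zx2 z12.
by rewrite /rho /hamenstadt_rho E.
Qed.

Lemma hamenstadt_rho_eq0 z1 z2 : z1 <> xi -> z2 <> xi -> rho z1 z2 = 0 <-> z1 = z2.
Proof.
move=> zx1 zx2; split=> [|<-]; last by rewrite /rho hamenstadt_rho_self.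
move=> r12; apply: contrapT => z12; have [c _] := hamenstadt_rho_fin zx1 zx2 z12.
by rewrite r12 => /eqP; rewrite eq_sym expR_eq0.
Qed.

Lemma hamenstadt_rho_ge0 z1 z2 : 0 <= rho z1 z2.
Proof. by rewrite /rho fine_ge0// expeR_ge0. Qed.

Lemma hamenstadt_rho_sym z1 z2 : rho z1 z2 = rho z2 z1.
Proof. by rewrite /rho /hamenstadt_rho busemann_bb_sym. Qed.

Lemma hamenstadt_constant_ge1 : 1 <= expR (eps * D).
Proof. by rewrite -expR0 ler_expR mulr_ge0// ltW. Qed.

Lemma hamenstadt_rho_ultra z1 z2 z3 : z1 <> xi -> z2 <> xi -> z3 <> xi ->
  rho z1 z3 <= expR (eps * D) * Order.max (rho z1 z2) (rho z2 z3).
Proof.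
move=> x1 x2 x3; have K1 := hamenstadt_constant_ge1.
have m0 : 0 <= Order.max (rho z1 z2) (rho z2 z3).
  by rewrite le_max hamenstadt_rho_ge0.
have [E|n12] := pselect (z1 = z2).
  by rewrite -E (le_trans _ (ler_peMl _ K1)) ?le_max ?lexx ?orbT// hamenstadt_rho_ge0.
have [E|n23] := pselect (z2 = z3).
  by rewrite -E (le_trans _ (ler_peMl _ K1)) ?le_max ?lexx// hamenstadt_rho_ge0.
have [E|n13] := pselect (z1 = z3).
  by rewrite (hamenstadt_rho_eq0 x1 x3).2// mulr_ge0// expR_ge0.
have [c12 E12 ->] := hamenstadt_rho_fin x1 x2 n12.
have [c23 E23 ->] := hamenstadt_rho_fin x2 x3 n23.
have [c13 E13 ->] := hamenstadt_rho_fin x1 x3 n13.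
have := @busemann_bb_ultra z1 z2 z3 (Order.min c12 c23).
rewrite E12 E23 E13 !lee_fin !ge_min !lexx orbT => /(_ isT isT).
have [le|lt] := leP c12 c23 => h.
  rewrite (@le_trans _ _ (expR (eps * D) * expR (- (eps * c12))))//.
    by rewrite -expRD ler_expR; move: h; rewrite -(ler_pM2l eps0); lra.
  by rewrite ler_wpM2l ?expR_ge0// le_max lexx.
rewrite (@le_trans _ _ (expR (eps * D) * expR (- (eps * c23))))//.
  by rewrite -expRD ler_expR; move: h; rewrite -(ler_pM2l eps0); lra.
by rewrite ler_wpM2l ?expR_ge0// le_max lexx orbT.
Qed.

Lemma hamenstadtE z1 z2 : z1 <> xi -> z2 <> xi ->
  hamenstadt xi b eps z1 z2 = inf (chain_sums Y rho z1 z2).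
Proof.
move=> x1 x2; rewrite /hamenstadt.
have ne : chain_sums Y rho z1 z2 !=set0.
  by exists (rho z1 z2); exact: chain_sums_rho.
have lb : has_lbound (chain_sums Y rho z1 z2).
  by apply: chain_sums_lbound => y1 y2 _ _; exact: hamenstadt_rho_ge0.
rewrite -[RHS]/(fine (inf (chain_sums Y rho z1 z2))%:E) -ereal_inf_EFin//.
congr (fine (ereal_inf _)); apply/seteqP; split => l.
  move=> [n [c [n1 c0 cn cx ->]]].
  exists (\sum_(0 <= i < n) rho (c i) (c i.+1)); first by exists n, c.
  rewrite -sumEFin; apply: eq_big_nat => i /andP[_ ni].
  by rewrite hamenstadt_rhoE//; apply: cx => //; exact: ltnW.
move=> [_ [n [c [n1 c0 cn cx ->]]] <-]; exists n, c; split => //.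
rewrite -sumEFin; apply: eq_big_nat => i /andP[_ ni].
by rewrite hamenstadt_rhoE//; apply: cx => //; exact: ltnW.
Qed.

Lemma hamenstadt_metric : is_metric_on Y (hamenstadt xi b eps).
Proof.
have [m1 m2 m3 m4] : is_metric_on Y (fun z1 z2 => inf (chain_sums Y rho z1 z2)).
  apply: (@chain_inf_metric _ _ Y rho (expR (eps * D)) hamenstadt_constant_ge1 epsD).
  - by move=> z1 z2 _ _; exact: hamenstadt_rho_ge0.
  - by move=> z1 z2; exact: hamenstadt_rho_eq0.
  - by move=> z1 z2 _ _; exact: hamenstadt_rho_sym.
  - by move=> z1 z2 z3; exact: hamenstadt_rho_ultra.
split=> [x y Dx Dy|x y Dx Dy|x y Dx Dy|x y z Dx Dy Dz]; rewrite !hamenstadtE//.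
- exact: m1.
- exact: m2.
- exact: m3.
- exact: m4.
Qed.

Lemma hamenstadt_le_rho z1 z2 : z1 <> xi -> z2 <> xi ->
  hamenstadt xi b eps z1 z2 <= rho z1 z2.
Proof.
move=> x1 x2; rewrite hamenstadtE//; apply: chain_inf_le => //.
by move=> y1 y2 _ _; exact: hamenstadt_rho_ge0.
Qed.

Lemma rho_le_hamenstadt z1 z2 : z1 <> xi -> z2 <> xi ->
  rho z1 z2 <= 2 * hamenstadt xi b eps z1 z2.
Proof.
move=> x1 x2; rewrite hamenstadtE//.
apply: (@chain_inf_ge _ _ Y rho (expR (eps * D)) hamenstadt_constant_ge1 epsD) => //.
- by move=> y1 y2 _ _; exact: hamenstadt_rho_ge0.
- by move=> y1 y2; exact: hamenstadt_rho_eq0.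
- by move=> y1 y2 y3; exact: hamenstadt_rho_ultra.
Qed.

(* Only the two extremal approximations of the Gromov products at infinity
   are needed, which costs the additive constant [2]. *)
Lemma boundary_ratio z1 z2 z3 y1 y2 y3 (s : R) : z1 <> xi -> z2 <> xi ->
  z3 <> xi -> z1 <> z2 -> z1 <> z3 ->
  phi z1 = Some y1 -> phi z2 = Some y2 -> phi z3 = Some y3 ->
  rho z1 z2 <= expR (eps * s) * rho z1 z3 ->
  mdist y1 y2 <= expR (Order.max (s + 2) ((s + 2) / C) + B) * mdist y1 y3.
Proof.
have C0 : 0 < C := lt_le_trans ltr01 C1.
move=> x1 x2 x3 n12 n13 E1 E2 E3.
have [c12 G12 ->] := hamenstadt_rho_fin x1 x2 n12.
have [c13 G13 ->] := hamenstadt_rho_fin x1 x3 n13.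
rewrite -expRD ler_expR => h.
have cs : c13 - c12 <= s by rewrite -(ler_pM2l eps0); lra.
have [_ [u zu [a za <-]]] : exists2 l, [set limn_einf (fun i => (q (u i) (v i))%:E) |
    u in gclass z1 & v in gclass z3] l & (l < (c13 + 1)%:E)%E.
  by apply/ereal_inf_lt; rewrite -/(G z1 z3) G13 lte_fin ltrDl.
move=> /limn_einf_lt freq.
have [v zv] := gclass_nonempty z2.
have [N1 H1] : exists N, forall i, (N <= i)%N -> c12 - 1 < q (u i) (v i).
  apply: lt_limn_einf; apply: (@lt_le_trans _ _ (G z1 z2)).
    by rewrite G12 lte_fin ltrBlDr ltrDl.
  by apply: ereal_inf_lbound; exists u => //; exists v.
set E := expR _; have Epos : 0 < E := expR_gt0 _.
apply/ler_addgt0Pr => e e0.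
(* The error occurs once by itself and once multiplied by [E]. *)
have e'0 : 0 < e / (1 + E) by rewrite divr_gt0// addr_gt0.
have uy := limit_of E1 zu; have vy := limit_of E2 zv; have ay := limit_of E3 za.
have [N2 H2] := boundary_limit_pair uy vy e'0.
have [N3 H3] := boundary_limit_pair uy ay e'0.
have [i] := freq (maxn N1 (maxn N2 N3)).
rewrite !geq_max => /andP[/H1 i1 /andP[i2 i3]] qa.
have := H2 i i i2 i2; have := H3 i i i3 i3; rewrite !ltr_norml.
have : expR (P (u i) (v i)) <= E * expR (P (u i) (a i)).
  rewrite /E -expRD ler_expR -lerBlDr.
  apply: (le_trans (cross (erefl (q (u i) (a i) - q (u i) (v i))))).
  rewrite lerD2r.
  have t2 : q (u i) (a i) - q (u i) (v i) <= s + 2.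
    by move: i1 qa; move: (q _ _) (q _ _) => q1 q2; lra.
  rewrite ge_max !le_max t2/=; apply/orP; right.
  by rewrite ler_pM2r ?invr_gt0.
have : e = e / (1 + E) + E * (e / (1 + E)).
  by field; rewrite gt_eqF// addr_gt0.
move: (e / (1 + E)) => e' eE h1 /andP[_ h3] /andP[h2 _].
have h4 : E * expR (P (u i) (a i)) <= E * (mdist y1 y3 + e').
  by rewrite ler_pM2l//; lra.
lra.
Qed.

End hamenstadt.
End boundary_limits.

(** * The explicit gauge and the quasisymmetry of the boundary map *)

Lemma mdist_metric_on (R : realType) (Y : metricType R) (D : set Y) :
  is_metric_on D (@mdist R Y).
Proof.
split=> [x y _ _|x y _ _|x y _ _|x y z _ _ _].
- exact: mdist_ge0.
- by split=> [/mdist_positivity|->]; rewrite ?mdistxx.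
- exact: metric_sym.
- exact: metric_triangle.
Qed.

Lemma ln2_le1 (R : realType) : ln 2 <= 1 :> R.
Proof. by have := @le_ln1Dx R 1; apply; rewrite (lt_trans (ltrN10 R)). Qed.

(** Eliminates [d] from the gauge: the factor 2 of the chain metric and the error [8 * d] each cost
    at most [eps^-1] in the exponent. The slopes 1 and [1 / C] become the powers [eps^-1] and
    [(C * eps)^-1]. *)
Lemma power_gauge_bound (R : realType) (C B d eps t : R) : 1 <= C -> 0 < eps ->
  0 < t -> 8 * d <= eps^-1 ->
  expR (Order.max (ln (2 * t) / eps + 2) ((ln (2 * t) / eps + 2) / C) + (B + 8 * d))
  <= power_gauge (expR (2 + B + 2 * eps^-1)) (C * eps)^-1 eps^-1 t.
Proof.
move=> C1 eps0 t0 d8; have C0 : 0 < C := lt_le_trans ltr01 C1.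
have ei : 0 < eps^-1 by rewrite invr_gt0.
have l2 := ln2_le1 R.
have e1 : ln (2 * t) / eps <= ln t / eps + eps^-1.
  rewrite lnM ?posrE// addrC mulrDl lerD2l; nra.
have e2 : (ln (2 * t) / eps + 2) / C <= ln t / (C * eps) + eps^-1 + 2.
  apply: (@le_trans _ _ ((ln t / eps + (eps^-1 + 2)) / C)).
    by rewrite ler_pM2r ?invr_gt0//; lra.
  rewrite mulrDl -addrA -mulrA -invfM (mulrC eps) lerD2l ler_pdivrMr//.
  by rewrite ler_peMr//; lra.
rewrite /power_gauge /powR gt_eqF//.
have maxE (u v : R) : Order.max (expR u) (expR v) = expR (Order.max u v).
  have [uv|vu] := leP u v; first by apply/max_idPr; rewrite ler_expR.
  by apply/max_idPl; rewrite ler_expR ltW.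
rewrite maxE -expRD ler_expR.
set u := _^-1 * ln t; set v := _^-1 * ln t.
have hu : u <= Order.max u v by rewrite le_max lexx.
have hv : v <= Order.max u v by rewrite le_max lexx orbT.
suff : Order.max (ln (2 * t) / eps + 2) ((ln (2 * t) / eps + 2) / C) <=
    Order.max u v + 2 + eps^-1.
  move: (Order.max u v) (Order.max _ _) => m1 m2; lra.
rewrite ge_max; apply/andP; split.
  by move: hv; rewrite /v mulrC; move: (Order.max _ _) => m; lra.
by move: hu; rewrite /u mulrC; move: (Order.max _ _) => m; lra.
Qed.

Theorem theorem1p5 (R : realType) (A : R) (A_ge1 : 1 <= A) :
  exists eta : R -> R -> R,
    (forall eps, 0 < eps -> homeomorphism_halfline (eta eps)) /\
    forall (X : metricType R) (Xb : completion X),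
      ~ metric_bounded [set: X] ->
      locally_complete X ->
      uniform_space Xb A ->
      let k := quasihyperbolic Xb in
      gromov_hyperbolic k /\
      exists (phi : gromov_boundary k -> with_infinity Xb)
             (xi : gromov_boundary k)
             (f : gromov_boundary k -> Xb),
        [/\ natural_map phi,
            phi xi = None,
            (forall zeta, zeta <> xi -> phi zeta = Some (f zeta))
          & forall (b : X -> R) (delta eps : R),
              busemann_functions xi b ->
              delta_hyperbolic k delta ->
              admissible delta eps ->
              quasisymmetric [set zeta | zeta <> xi] (metric_boundary Xb)
                (hamenstadt xi b eps) (@mdist R Xb) (eta eps) f].
Proof.
pose C := 3 * A * (1 + 2 * ln A).
have C1 : 1 <= C := uniform_constant_ge1 A_ge1.
have C0 : 0 < C := lt_le_trans ltr01 C1.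
have [d0 hypd] := qh_hyperbolic C1.
have [a a0 apex] := qh_apex C1.
have a10 : 0 <= a + 1 by rewrite addr_ge0.
have [B B0 cross] := qh_cross C1 a10.
exists (fun eps => power_gauge (expR (2 + B + 2 * eps^-1)) (C * eps)^-1 eps^-1).
have gauge eps : 0 < eps -> homeomorphism_halfline
    (power_gauge (expR (2 + B + 2 * eps^-1)) (C * eps)^-1 eps^-1).
  move=> e0; apply: homeomorphism_power_gauge; rewrite ?expR_gt0//.
    by rewrite invr_gt0 mulr_gt0.
  have le : eps <= C * eps by rewrite ler_peMl// ltW.
  by rewrite lef_pV2// posrE// mulr_gt0.
split=> [//|X Xb unb lc unif k].
have M := uniform_qh_model A_ge1 unb lc unif.
have inc := uniform_incomplete unif.
split; first by exists d0; exact: hypd M.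
have [phi phiP] := boundary_map_exists C1 lc inc M.
have [xi xiN] : exists xi, phi xi = None by exact: (boundary_map_surj C1 lc inc M phiP).
have phi_inj := boundary_map_inj phiP.
have [z0 bz0] := inc.
(* The default [z0] is taken only at [xi], outside the domain of the quasisymmetry. *)
pose f zeta := odflt z0 (phi zeta).
have fE zeta : zeta <> xi -> phi zeta = Some (f zeta).
  move=> zx; rewrite /f; case E : (phi zeta) => [z|] //.
  by exfalso; apply: zx; apply: phi_inj; rewrite E.
exists phi, xi, f; split => //.
  apply: (boundary_map_natural C1 lc inc M phiP).
  exact: (quasihyperbolic_ge_ln inc lc (uniform_rectifiably_connected unif)).
move=> b d eps [w _ bE] hyp [eps0 adm].
have dge0 : 0 <= d by case: hyp.
have ultra := busemann_product_ultra C1 lc inc M phiP hyp (esym bE).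
have crossb := busemann_product_cross C1 lc inc M phiP hyp (esym bE) a0 xiN
  (fun x N => apex _ _ _ _ x N M)
  (fun x y z c xc yc zc => cross _ _ _ _ x y z c M xc yc zc).
have D0 : 0 <= 9 * d by rewrite mulr_ge0.
have B'0 : 0 <= B + 8 * d by rewrite addr_ge0// mulr_ge0.
have ed0 : 0 <= eps * d by rewrite mulr_ge0// ltW.
(* Squaring doubles the exponent to [18 * eps * d], which admissibility covers with its 22. *)
have epsD : expR (eps * (9 * d)) ^+ 2 <= 2.
  rewrite -expRM_natl (le_trans _ adm)// ler_expR; lra.
have d8 : 8 * d <= eps^-1.
  have : 22 * eps * d <= ln 2 by rewrite -ler_expR lnK// posrE.
  have := ln2_le1 R => l2 h; rewrite -[leRHS]mul1r ler_pdivlMr//; lra.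
have bdry_range zeta z : phi zeta = Some z -> metric_boundary Xb z.
  exact: (boundary_map_range C1 lc inc M phiP).
apply: quasisymmetric_of_bij.
- exact: gauge.
- by rewrite power_gauge0// invr_gt0// mulr_gt0.
- exact: (hamenstadt_metric C1 lc inc M phiP xiN D0 B'0 ultra crossb eps0 epsD).
- exact: mdist_metric_on.
- split.
  + by move=> zeta /= /fE /bdry_range.
  + move=> z1 z2; rewrite !inE/= => x1 x2 E; apply: phi_inj.
    by rewrite (fE _ x1) (fE _ x2) E.
  + move=> z /= bz; have [|zeta zE] := boundary_map_surj C1 lc inc M phiP (o := Some z).
      by move=> _ [<-].
    exists zeta; last by rewrite /f zE.
    by move=> E; move: zE; rewrite E xiN.
move=> t z1 z2 z3 t0 /= x1 x2 x3 H.
have gge0 : 0 <= power_gauge (expR (2 + B + 2 * eps^-1)) (C * eps)^-1 eps^-1 t.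
  by rewrite mulr_ge0 ?expR_ge0// le_max powR_ge0.
have [<-|n12] := pselect (z1 = z2); first by rewrite mdistxx mulr_ge0// mdist_ge0.
have [m_ge0 m_eq0 _ _] :=
  hamenstadt_metric C1 lc inc M phiP xiN D0 B'0 ultra crossb eps0 epsD.
have [E|n13] := pselect (z1 = z3).
  exfalso; apply: n12; apply/(m_eq0 _ _ x1 x2)/le_anti.
  by rewrite m_ge0// andbT (le_trans H)// (m_eq0 _ _ x1 x3).2// mulr0.
have r12 := rho_le_hamenstadt C1 lc inc M phiP xiN D0 B'0 ultra crossb eps0 epsD x1 x2.
have r13 := hamenstadt_le_rho C1 lc inc M phiP xiN B'0 crossb eps0 x1 x3.
(* Passing from the chain metric to [rho] loses a factor 2, so [t] becomes [2 * t], written in the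
   exponential form that [boundary_ratio] expects. *)
have key : hamenstadt_rho_real b eps z1 z2 <=
    expR (eps * (ln (2 * t) / eps)) * hamenstadt_rho_real b eps z1 z3.
  rewrite mulrCA divff ?gt_eqF// mulr1 lnK ?posrE ?mulr_gt0//.
  apply: (le_trans r12); rewrite -mulrA ler_pM2l//.
  by apply: (le_trans H); rewrite ler_pM2l.
have := boundary_ratio C1 lc inc M phiP xiN B'0 crossb eps0 x1 x2 x3 n12 n13
  (fE _ x1) (fE _ x2) (fE _ x3) key.
move=> /le_trans; apply; rewrite ler_wpM2r ?mdist_ge0//.
exact: power_gauge_bound.
Qed.
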